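(* Let $n\ge 1$, $1\le k\le n$, and let $\Omega\subset\mathbb{R}^{n+1}$ be a smooth bounded domain whose boundary $\Sigma=\partial\Omega$ is a smooth, closed, embedded hypersurface with $H_k\ge 0$. Then $$\frac{I_{k-1}^2-I_kI_{k-2}}{I_k}+\delta_{2,k}\left(\Omega,B_0\left(\frac{I_{k-1}}{I_k}\right)\right)^2=\frac{1}{k\binom{n}{k}}\int_\Sigma T_{k-1}\circ A(X^T,X^T)\,d\mu .$$ In particular, $$\frac{I_{k-1}^2-I_kI_{k-2}}{I_k}\le\frac{1}{k\binom{n}{k}}\int_\Sigma T_{k-1}\circ A(X^T,X^T)\,d\mu .$$ If $H_k>0$ on $\Sigma$, then equality holds in this last inequality if and only if $\Sigma$ is a sphere centered at the origin.
   Context: $X$ is the position vector, $\nu$ the outward unit normal of $\Sigma$, $X^T$ the component of $X$ tangential to $\Sigma$, $u=\langle X,\nu\rangle$ the support function, $d\mu$ the induced area measure. $A$ is the shape operator with respect to $\nu$ (positive for round spheres), with eigenvalues the principal curvatures $\kappa_1,\dots,\kappa_n$. $H_k=\binom{n}{k}^{-1}\sigma_k(\kappa_1,\dots,\kappa_n)$ is the normalized $k$-th mean curvature ($\sigma_k$ the $k$-th elementary symmetric polynomial, $H_0=1$). $I_{-1}=(n+1)|\Omega|$ and $I_j=\int_\Sigma H_j\,d\mu$ for $0\le j\le n$. The Newton tensors are $T_0=\mathrm{Id}$, $T_j=\sigma_j(\kappa)\,\mathrm{Id}-A\circ T_{j-1}$, and $T_{k-1}\circ A(Y,Y)=\langle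 T_{k-1}(A(Y)),Y\rangle$. $B_0(r)$ is the ball of radius $r$ centered at the origin, and $\delta_{2,k}(\Omega,B_0(r))=\left(\int_\Sigma(u-r)^2H_k\,d\mu\right)^{1/2}$. *)

(* Defs.v *)
From HB Require Import structures.
From mathcomp Require Import all_boot all_order all_algebra.
From mathcomp Require Import all_classical all_reals all_analysis.

Set Implicit Arguments.
Unset Strict Implicit.
Unset Printing Implicit Defensive.

Import Order.TTheory GRing.Theory Num.Theory.
Import numFieldNormedType.Exports.

Local Open Scope classical_set_scope.
Local Open Scope ring_scope.

(* The topology of 'rV[R]_n is the usual one, but its library norm `|x| is the
   sup norm; Euclidean lengths are always written with dotp or enorm. *)
Definition dotp (R : realType) (m : nat) (x y : 'rV[R]_m) : R :=
  \sum_(i < m) x ord0 i * y ord0 i.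

Definition enorm (R : realType) (m : nat) (x : 'rV[R]_m) : R :=
  Num.sqrt (dotp x x).

(* Borel sets of R^n. *)
Definition rV_display : measure_display.
Proof. exact: default_measure_display. Qed.

HB.instance Definition _ (R : realType) (n : nat) :=
  @isMeasurable.Build rV_display 'rV[R]_n <<s (@open 'rV[R]_n) >>
    (@sigma_algebra0 _ setT _) (@sigma_algebraC _ _)
    (@sigma_algebra_bigcup _ setT _).

(* Lebesgue measure of R^n as an iterated product measure, through
   R^(m+1) = R * R^m. *)
Fixpoint lebesgue_rV (R : realType) (n : nat) : set 'rV[R]_n -> \bar R :=
  match n return set 'rV[R]_n -> \bar R with
  | 0 => fun A => (\d_(0%R : 'rV[R]_0) A)%E
  | m.+1 => fun A =>
      (lebesgue_measure \x @lebesgue_rV R m)%E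
        [set z : measurableTypeR R * 'rV[R]_m |
          A (row_mx (const_mx z.1 : 'rV[R]_1) z.2)]
  end.

Fixpoint Ck_on (R : realType) (n : nat) (W : normedModType R)
    (V : set 'rV[R]_n) (k : nat) (f : 'rV[R]_n -> W) : Prop :=
  match k with
  | 0 => forall x, V x -> {for x, continuous f}
  | j.+1 => (forall x, V x -> differentiable f x) /\
            forall i : 'I_n, Ck_on V j (fun x => 'D_(delta_mx ord0 i) f x)
  end.

Definition smooth_on (R : realType) (n : nat) (W : normedModType R)
    (V : set 'rV[R]_n) (f : 'rV[R]_n -> W) : Prop :=
  forall k, Ck_on V k f.

Definition frontier (T : topologicalType) (A : set T) : set T :=
  closure A `\` interior A.

(* Near each boundary point, Omega is one side of the graph of a smooth
   function of n of the n+1 coordinates; [col' i x] is x with its i-th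
   coordinate removed and b selects the side.  This makes the boundary an
   embedded hypersurface, closed because Omega is bounded. *)
Definition smooth_boundary (R : realType) (n : nat)
    (Omega : set 'rV[R]_n.+1) : Prop :=
  forall p, frontier Omega p ->
    exists (i : 'I_n.+1) (b : bool) (g : 'rV[R]_n -> R),
      smooth_on [set: 'rV[R]_n] g /\
      \forall x \near p,
        Omega x <-> 0 < (-1) ^+ b * (x ord0 i - g (col' i x)).

Definition smooth_bounded_domain (R : realType) (n : nat)
    (Omega : set 'rV[R]_n.+1) : Prop :=
  [/\ Omega !=set0, open Omega, connected Omega, bounded_set Omega
    & smooth_boundary Omega].

Section Geometry.
Context {R : realType} {n : nat}.
Implicit Types (S Omega : set 'rV[R]_n.+1) (p v : 'rV[R]_n.+1).

Definition curve_in S p v (c : R -> 'rV[R]_n.+1) : Prop :=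
  [/\ c 0 = p, \forall t \near (0 : R), S (c t) & is_derive (0 : R) 1 c v].

Definition tangent S p : set 'rV[R]_n.+1 :=
  [set v | exists c, curve_in S p v c].

(* Injective regular parametrizations.  When S is an embedded hypersurface
   they are automatically homeomorphisms onto open subsets of S.  The rows of
   the Jacobian 'J phi x are the partial derivatives of phi. *)
Definition local_param S (V : set 'rV[R]_n)
    (phi : 'rV[R]_n -> 'rV[R]_n.+1) : Prop :=
  [/\ open V, smooth_on V phi, phi @` V `<=` S, set_inj V phi
    & forall x, V x -> row_free ('J phi x)].

(* mu is the area measure of S induced by the Euclidean metric: it is carried
   by S and has density sqrt (det (g_ij)) in every parametrization. *)
Definition area_measure S (mu : {measure set 'rV[R]_n.+1 -> \bar R}) : Prop :=
  mu (~` S) = 0%E /\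
  forall V phi, local_param S V phi ->
    forall E, measurable E -> E `<=` phi @` V ->
      mu E = (\int[@lebesgue_rV R n]_(x in V `&` phi @^-1` E)
                (Num.sqrt (\det ('J phi x *m ('J phi x)^T)))%:E)%E.

Definition normal Omega p : 'rV[R]_n.+1 :=
  get [set v : 'rV[R]_n.+1 | [/\ enorm v = 1,
                   forall w, tangent (frontier Omega) p w -> dotp v w = 0
                 & \forall t \near 0^'+, ~ closure Omega (p + t *: v)]].

(* A(v) = D_v nu, the derivative of the outward normal along any curve of the
   boundary with velocity v; only meaningful on tangent vectors. *)
Definition shape Omega p v : 'rV[R]_n.+1 :=
  get [set w : 'rV[R]_n.+1 | exists c, curve_in (frontier Omega) p v c /\
                 is_derive (0 : R) 1 (fun t => normal Omega (c t)) w].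

(* The eigenvalues of the shape operator on the tangent space, listed with
   multiplicity along an orthonormal basis of principal directions. *)
Definition curvatures Omega p : 'rV[R]_n :=
  get [set kappa : 'rV[R]_n | exists e : 'I_n -> 'rV[R]_n.+1,
    [/\ forall i, tangent (frontier Omega) p (e i),
        forall i j, dotp (e i) (e j) = (i == j)%:R
      & forall i, shape Omega p (e i) = kappa ord0 i *: e i]].

Definition esym (k : nat) (kappa : 'rV[R]_n) : R :=
  \sum_(J : {set 'I_n} | #|J| == k) \prod_(i in J) kappa ord0 i.

Definition mean_curv Omega (k : nat) p : R :=
  esym k (curvatures Omega p) / 'C(n, k)%:R.

Definition support_fun Omega p : R := dotp p (normal Omega p).

Definition tang_part Omega p : 'rV[R]_n.+1 :=
  p - support_fun Omega p *: normal Omega p.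

Fixpoint newton Omega p (j : nat) v : 'rV[R]_n.+1 :=
  match j with
  | 0 => v
  | i.+1 => esym i.+1 (curvatures Omega p) *: v
            - shape Omega p (newton Omega p i v)
  end.

(* I_j for j >= -1; the value at j < -1 is never used. *)
Definition curv_int Omega (mu : {measure set 'rV[R]_n.+1 -> \bar R})
    (j : int) : R :=
  match j with
  | Posz i => \int[mu]_(x in frontier Omega) mean_curv Omega i x
  | Negz _ => n.+1%:R * fine (@lebesgue_rV R n.+1 Omega)
  end.

(* delta_{2,k}(Omega, B_0(r)) *)
Definition delta2 Omega (mu : {measure set 'rV[R]_n.+1 -> \bar R})
    (k : nat) (r : R) : R :=
  Num.sqrt (\int[mu]_(x in frontier Omega)
              ((support_fun Omega x - r) ^+ 2 * mean_curv Omega k x)).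

Definition newton_int Omega (mu : {measure set 'rV[R]_n.+1 -> \bar R})
    (k : nat) : R :=
  \int[mu]_(x in frontier Omega)
    dotp (newton Omega x k.-1 (shape Omega x (tang_part Omega x)))
         (tang_part Omega x).

Definition centered_sphere S : Prop :=
  exists2 r : R, 0 < r & S = [set x | enorm x = r].

End Geometry.

(* Main.v *)
(** Near a boundary point the hypersurface is the graph x_i = g of a smooth
    function, so the smooth functions of the n graph parameters form a
    commutative ring with commuting derivations.  The tangential gradient, the
    shape operator A and its Newton tensors T_m live over this ring, and the
    Codazzi equation gives the identities
      div (T_m X^T) = (n - m) sigma_m - (m + 1) u sigma_(m+1),
      div (u T_m X^T) = u div (T_m X^T) + <T_m A X^T, X^T>
    by pure algebra.  Integrating them by the divergence theorem of the closed
    hypersurface, proved by multiplying with C^1 cutoffs supported in single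
    charts, yields for m = k - 1 the Minkowski formula int H_(k-1) = int u H_k
    and int <T_(k-1) A X^T, X^T> = k C(n,k) (int u^2 H_k - int u H_(k-1)); for
    k = 1 the last integral is (n+1)|Omega| by the divergence theorem in the
    domain.  Expanding (u - r)^2 H_k with r = I_(k-1) / I_k gives the identity.
    That I_k is not 0 follows from the boundary point p farthest from the
    origin, where p = |p| nu and every principal curvature is at least 1/|p|.
    In the equality case u = r everywhere, so |p| = r and r = u <= |X| <= r on
    the boundary, which forces the domain to be a ball. *)

From HB Require Import structures.
From mathcomp Require Import all_boot all_order all_algebra.
From mathcomp Require Import all_classical all_reals all_analysis.
From mathcomp Require Import measurable_realfun ring lra.
Require Import Defs.

Set Implicit Arguments.
Unset Strict Implicit.
Unset Printing Implicit Defensive.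

Import Order.TTheory GRing.Theory Num.Theory.
Import numFieldNormedType.Exports.

Local Open Scope classical_set_scope.
Local Open Scope ring_scope.

(** * Newton tensors over a ring with derivations *)

(** The normal, the shape operator and the curvatures are defined pointwise by choice, and an
    eigenvalue list chosen point by point carries no smoothness. Hence sigma_k is produced by a
    trace recursion, which is polynomial in the entries of A and so stays in the ring of smooth
    functions; eigenvalues are used only at a single point, to identify the two. All tensors are
    written in the n+1 ambient coordinates instead of a tangent frame: vector fields then have the
    same components in every chart and no Christoffel symbols occur. The price is explicit terms
    along nu, which disappear against X^T. Since A has the extra eigenvalue 0 on nu, its sigma_j are
    those of the principal curvatures. Lebesgue integrals undergo only coordinate reorderings and
    shears, both accessible because the measure is an iterated product. A divergence theorem
    differentiates a cutoff once, so C^1 bumps suffice. *)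

Section NewtonTensors.
Variables (F : comNzRingType) (N : nat) (c : nat -> F).
Hypothesis cK : forall j, c j * j.+1%:R = 1.

Lemma mulrnSI j (x y : F) : x *+ j.+1 = y *+ j.+1 -> x = y.
Proof.
move=> e; rewrite -[x]mulr1 -[y]mulr1 -(cK j) mulrCA [RHS]mulrCA.
by rewrite !mulr_natr e.
Qed.

(* Newton's recursion sigma_(j+1) = tr (A T_j) / (j+1), with c j in the role of
   1 / (j+1), defines both sequences over any commutative ring. *)
Definition trsig_tensor (A : 'M[F]_N) : nat -> F * 'M[F]_N :=
  fix rec j := match j with
  | 0 => (1, 1%:M)
  | i.+1 => let s := c i * \tr (A *m (rec i).2) in (s, s%:M - A *m (rec i).2)
  end.

Definition trsig (A : 'M[F]_N) j := (trsig_tensor A j).1.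
Definition trnewt (A : 'M[F]_N) j := (trsig_tensor A j).2.

Lemma trnewtS A j : trnewt A j.+1 = (trsig A j.+1)%:M - A *m trnewt A j.
Proof. by []. Qed.

Lemma trsigS A j : trsig A j.+1 *+ j.+1 = \tr (A *m trnewt A j).
Proof. by rewrite /trsig /= -mulr_natr mulrAC cK mul1r. Qed.

(** [j.+1] can be cancelled, so the trace recursion determines both sequences. This is how the
    tensors built from an eigenbasis are later identified with [trsig] and [trnewt]. *)
Lemma trsig_uniq A (s : nat -> F) (T : nat -> 'M[F]_N) :
  s 0%N = 1 -> T 0%N = 1%:M ->
  (forall j, s j.+1 *+ j.+1 = \tr (A *m T j)) ->
  (forall j, T j.+1 = (s j.+1)%:M - A *m T j) ->
  forall j, s j = trsig A j /\ T j = trnewt A j.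
Proof.
move=> s0 T0 sS TS; elim=> [|j [_ IT]]; first by rewrite s0 T0.
have es : s j.+1 = trsig A j.+1.
  by apply: (@mulrnSI j); rewrite sS IT trsigS.
by split=> //; rewrite TS trnewtS es IT.
Qed.

Definition mxpow (A : 'M[F]_N) l := iter l (mulmx A) 1%:M.

Lemma mxpowSr A l : mxpow A l *m A = mxpow A l.+1.
Proof.
elim: l => [|l IH]; first by rewrite /mxpow /= mul1mx mulmx1.
by rewrite /mxpow /= -mulmxA -/(mxpow A l) IH.
Qed.

(** Unfolds the recursion into a polynomial in A. Commutation with A, hence symmetry, and Newton's
    identities are read off from it. *)
Lemma trnewt_sum A j :
  trnewt A j = \sum_(l < j.+1) ((-1) ^+ l * trsig A (j - l)) *: mxpow A l.
Proof.
elim: j => [|j IH].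
  by rewrite big_ord1 /trsig /= mulr1 scale1r.
rewrite trnewtS IH [RHS]big_ord_recl subn0 expr0 mul1r scalemx1.
congr (_ + _).
rewrite mulmx_sumr -sumrN; apply: eq_bigr => l _.
by rewrite lift0 subSS exprS mulN1r mulNr scaleNr -scalemxAr.
Qed.

Lemma trnewt_comm A j : A *m trnewt A j = trnewt A j *m A.
Proof.
rewrite trnewt_sum mulmx_sumr mulmx_suml; apply: eq_bigr => l _.
by rewrite -scalemxAr -scalemxAl mxpowSr.
Qed.

Lemma trnewt_sym A j : A^T = A -> (trnewt A j)^T = trnewt A j.
Proof.
move=> sA; elim: j => [|j IH]; first exact: trmx1.
by rewrite trnewtS linearB /= tr_scalar_mx trmx_mul IH sA -trnewt_comm.
Qed.

Lemma newton_identity A j :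
  trsig A j.+1 *+ j.+1 =
    \sum_(l < j.+1) (-1) ^+ l * trsig A (j - l) * \tr (mxpow A l.+1).
Proof.
rewrite trsigS trnewt_sum mulmx_sumr linear_sum; apply: eq_bigr => l _.
by rewrite -scalemxAr linearZ.
Qed.

Section Derivation.
Variable D : F -> F.
Hypothesis DD : forall f g, D (f + g) = D f + D g.
Hypothesis DM : forall f g, D (f * g) = D f * g + f * D g.

Lemma der0 : D 0 = 0.
Proof. by apply: (addrI (D 0)); rewrite -DD !addr0. Qed.

Lemma derN f : D (- f) = - D f.
Proof. by apply: (addrI (D f)); rewrite -DD !subrr der0. Qed.

Lemma derB f g : D (f - g) = D f - D g.
Proof. by rewrite DD derN. Qed.

Lemma der1 : D 1 = 0.
Proof. by apply: (addrI (D 1)); rewrite -{3}(mulr1 1) DM mulr1 mul1r addr0. Qed.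

Lemma derMn f m : D (f *+ m) = D f *+ m.
Proof. by elim: m => [|m IH]; rewrite ?mulr0n ?der0 // !mulrS DD IH. Qed.

Lemma der_sum I (r : seq I) P (f : I -> F) :
  D (\sum_(i <- r | P i) f i) = \sum_(i <- r | P i) D (f i).
Proof. exact: (big_morph D DD der0). Qed.

Lemma der_sign l f : D ((-1) ^+ l * f) = (-1) ^+ l * D f.
Proof.
elim: l => [|l IH]; first by rewrite !mul1r.
by rewrite exprS -!mulrA !mulN1r derN IH.
Qed.

Lemma map_derM p q r (A : 'M[F]_(p, q)) (B : 'M[F]_(q, r)) :
  map_mx D (A *m B) = map_mx D A *m B + A *m map_mx D B.
Proof.
apply/matrixP => i j; rewrite !mxE der_sum -big_split; apply: eq_bigr => k _.
by rewrite DM !mxE.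
Qed.

Lemma der_tr (A : 'M[F]_N) : D (\tr A) = \tr (map_mx D A).
Proof. by rewrite /mxtrace der_sum; apply: eq_bigr => i _; rewrite mxE. Qed.

Lemma der_scalar_mx f : map_mx D (f%:M : 'M[F]_N) = (D f)%:M.
Proof. by apply/matrixP => i j; rewrite !mxE derMn. Qed.

(** Cyclicity of the trace brings each differentiated factor to the front, although [map_mx D A]
    need not commute with A. The matrix B collects powers of A during the induction; at m = 0 the
    value with [m.-1] is multiplied by 0. *)
Lemma der_tr_pow_mul A B m : A *m B = B *m A ->
  \tr (map_mx D (mxpow A m) *m B)
    = \tr (map_mx D A *m (mxpow A m.-1 *m B)) *+ m.
Proof.
elim: m B => [|m IH] B AB.
  by rewrite [mxpow A 0]/mxpow /= der_scalar_mx der1 raddf0 mul0mx raddf0.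
rewrite [mxpow A m.+1]/mxpow iterS -/(mxpow A m) map_derM mulmxDl raddfD /=.
rewrite mulrS mulmxA; congr (_ + _).
rewrite -!mulmxA mxtrace_mulC -!mulmxA IH; last by rewrite mulmxA AB.
case: m {IH} => [//|m]; congr (\tr (_ *m _) *+ _).
by rewrite /= -AB mulmxA mxpowSr.
Qed.

Lemma der_tr_pow A l :
  D (\tr (mxpow A l.+1)) = \tr (map_mx D A *m mxpow A l) *+ l.+1.
Proof.
have := @der_tr_pow_mul A 1%:M l.+1; rewrite !mulmx1 mul1mx => <- //.
exact: der_tr.
Qed.

(** Strong induction through Newton's identities: sigma is differentiated via traces of powers,
    where the failure of A and its derivative to commute is invisible. *)
Lemma der_trsig A j :
  D (trsig A j.+1) = \tr (map_mx D A *m trnewt A j).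
Proof.
pose r l := \tr (map_mx D A *m mxpow A l).
pose p l := \tr (mxpow A l.+1).
pose s := trsig A.
suff H j' : D (s j'.+1) = \sum_(l < j'.+1) (-1) ^+ l * s (j' - l)%N * r l.
  rewrite H trnewt_sum mulmx_sumr linear_sum; apply: eq_bigr => l _.
  by rewrite -scalemxAr linearZ.
have [m] := ubnP j'; elim: m j' => // m IH {}j; rewrite ltnS => jm.
apply: (@mulrnSI j).
rewrite -derMn newton_identity der_sum.
have D0 : D (s 0%N) = 0 by rewrite der1.
under eq_bigr => l _.
  rewrite -mulrA der_sign DM -/(p l) -/(s _) der_tr_pow -/(r l) mulrDr.
  rewrite mulrnAr mulrnAr mulrA.
over.
rewrite big_split /= addrC.
(* The induction hypothesis replaces each D s_(j-i). Both indices run over ['I_j.+1] under the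
   constraint l + i < j, so that the sums can be exchanged. *)
have -> : \sum_(i < j.+1) (-1) ^+ i * D (s (j - i)%N) * p i =
   \sum_(i < j.+1) \sum_(l < j.+1 | (l + i < j)%N)
       (-1) ^+ (i + l) * s (j - i - l).-1 * r l * p i.
  apply: eq_bigr => i _; case ji: (j - i)%N => [|t].
    rewrite D0 mulr0 mul0r big1 // => l li; exfalso.
    by move: li; rewrite ltnNge; have := leq_addl l i; move: ji => /eqP;
       rewrite subn_eq0 => /leq_trans H /H ->.
  rewrite IH; last by rewrite -ltnS -ji ltnS (leq_trans (leq_subr _ _)).
  rewrite -mulrA mulr_suml mulr_sumr.
  rewrite (big_ord_widen j.+1 (fun l => (-1) ^+ i * ((-1) ^+ l * s (t - l)%N * r l * p i))).
    apply: eq_big => l; first by rewrite -ji ltn_subRL addnC.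
    by move=> lt; rewrite exprD !mulrA subSn.
  by rewrite -ji leqW ?leq_subr.
rewrite (exchange_big_dep predT) //= -big_split /= -sumrMnl; apply: eq_bigr => l _.
have jl : (l <= j)%N by rewrite -ltnS.
(* Coefficient of r_l: l + 1 copies of s_(j-l) come from differentiating the power trace and j - l
   from Newton's identity, together the factor j + 1. *)
transitivity ((-1) ^+ l * (s (j - l)%N * r l) *+ l.+1
   + (-1) ^+ l * r l * (s (j - l)%N *+ (j - l))); last first.
  rewrite mulrnAr -mulrA [r l * _]mulrC -mulrnDr mulrA.
  by rewrite addSn subnKC.
congr (_ + _).
case jl': (j - l)%N => [|t].
  rewrite mulr0n mulr0 big1 // => i; rewrite ltnNge => /negP[].
  by move/eqP: jl'; rewrite subn_eq0 => /leq_trans; apply; apply: leq_addr.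
rewrite newton_identity mulr_sumr.
rewrite (big_ord_widen_cond j.+1 xpredT (fun i => (-1) ^+ l * r l * ((-1) ^+ i * trsig A (t - i) * \tr (mxpow A i.+1)))); last first.
  by rewrite -jl' leqW ?leq_subr.
apply: eq_big => i; first by rewrite -jl' ltn_subRL.
move=> li; rewrite exprD subnAC jl' subSn /=; last first.
  by rewrite -ltnS -jl' ltn_subRL.
by rewrite -/(s _) -/(p i); ring.
Qed.
End Derivation.

(** * Tangential calculus in ambient coordinates: Codazzi and the divergence of Newton tensors *)

Section TangentialCalculus.
Variables (del : 'I_N -> F -> F) (nu X : 'rV[F]_N).
Hypothesis delD : forall a f g, del a (f + g) = del a f + del a g.
Hypothesis delM : forall a f g, del a (f * g) = del a f * g + f * del a g.

Definition shape_mx : 'M[F]_N := \matrix_(a, b) del a (nu 0 b).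
Local Notation A := shape_mx.

Hypothesis nu1 : nu *m nu^T = 1%:M.
Hypothesis del_nu : forall f, \sum_a nu 0 a * del a f = 0.
Hypothesis A_sym : A^T = A.
(** Projected partials do not commute, since the projection varies with nu; the defect is expressed
    by A and nu. *)
Hypothesis del_comm : forall a b f, del a (del b f) - del b (del a f) =
  \sum_l (nu 0 a * A b l - nu 0 b * A a l) * del l f.
Hypothesis delX : forall a b, del a (X 0 b) = (a == b)%:R - nu 0 a * nu 0 b.

Definition divg (Y : 'rV[F]_N) : F := \sum_a del a (Y 0 a).
Definition mxdiv (T : 'M[F]_N) : 'rV[F]_N := \row_b \sum_a del a (T a b).
Definition grad (f : F) : 'rV[F]_N := \row_a del a f.

Lemma divgM (Y : 'rV[F]_N) f : divg (f *: Y) = f * divg Y + (Y *m (grad f)^T) 0 0.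
Proof.
rewrite /divg mxE mulr_sumr -big_split; apply: eq_bigr => a _.
by rewrite /= !mxE delM addrC mulrC [X in _ + X]mulrC.
Qed.

Lemma divg_mulmx (Y : 'rV[F]_N) (T : 'M[F]_N) :
  divg (Y *m T) = (Y *m (mxdiv T^T)^T) 0 0
    + \sum_a \sum_b del a (Y 0 b) * T b a.
Proof.
rewrite /divg mxE [X in X + _](_ : _ = \sum_a \sum_b Y 0 b * del a (T b a)).
  rewrite -big_split; apply: eq_bigr => a _ /=; rewrite mxE der_sum //.
  rewrite -big_split; apply: eq_bigr => b _ /=.
  by rewrite delM addrC.
rewrite exchange_big; apply: eq_bigr => b _; rewrite !mxE mulr_sumr.
by apply: eq_bigr => a _; rewrite mxE.
Qed.

Lemma nuA : nu *m A = 0.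
Proof. by apply/rowP => b; rewrite !mxE -[RHS](del_nu (nu 0 b)); apply: eq_bigr => a _; rewrite !mxE. Qed.

Lemma Anu : A *m nu^T = 0.
Proof. by rewrite -A_sym -trmx_mul nuA trmx0. Qed.

Lemma nu_trnewt j : nu *m trnewt A j = trsig A j *: nu.
Proof.
case: j => [|j]; first by rewrite mulmx1 scale1r.
by rewrite trnewtS mulmxBr mulmxA nuA mul0mx subr0 mul_mx_scalar.
Qed.

(** The commutation rule applied to nu_e. In ambient coordinates the symmetry of the derivative of A
    holds only up to terms along nu. *)
Lemma codazzi a b e : del a (A b e) - del b (A a e) =
  nu 0 a * (A *m A) b e - nu 0 b * (A *m A) a e.
Proof.
rewrite [in LHS]mxE [X in _ - _ X](_ : _ = del a (nu 0 e)); last by rewrite mxE.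
rewrite del_comm 2![(A *m A) _ _]mxE !mulr_sumr -sumrB; apply: eq_bigr => l _.
by rewrite mulrBl !mulrA !mxE.
Qed.

(** Newton tensors are divergence free along the hypersurface, so only a normal component is left.
    Its coefficient stays existential because the row is only ever paired with X^T. *)
Lemma mxdiv_trnewt m :
  exists f, mxdiv (trnewt A m) = f *: nu.
Proof.
elim: m => [|m [f IH]].
  exists 0; apply/rowP => b; rewrite !mxE mul0r big1 // => a _.
  by rewrite mxE derMn // der1 // mul0rn.
(* This is tr (T_m A^2), with the signs in which the computation delivers it. *)
exists (- \tr (trnewt A m *m (A *m A)) * -1).
set T := trnewt A m in IH *.
have TA : A *m T = T *m A by apply: trnewt_comm.
have sT : T^T = T by apply: trnewt_sym.
apply/rowP => e; rewrite mxE.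
transitivity (\sum_a (del a ((trsig A m.+1)%:M a e : F) - del a ((T *m A) a e))).
  by apply: eq_bigr => a _; rewrite trnewtS -TA -/T !mxE derB.
rewrite sumrB (bigD1 e) //= big1 ?addr0; last first.
  by move=> a ae; rewrite mxE (negPf ae) mulr0n der0.
rewrite mxE eqxx mulr1n der_trsig //.
have -> : \sum_a del a ((T *m A) a e) =
    \sum_b (mxdiv T) 0 b * A b e + \sum_a \sum_b T a b * del a (A b e).
  transitivity (\sum_a \sum_b (del a (T a b) * A b e + T a b * del a (A b e))).
    by apply: eq_bigr => a _; rewrite mxE der_sum //; apply: eq_bigr => b _; rewrite delM.
  under eq_bigr do rewrite big_split /=.
  rewrite big_split /=; congr (_ + _); rewrite exchange_big; apply: eq_bigr => b _.
  by rewrite [mxdiv _ _ _]mxE mulr_suml.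
have -> : \sum_b (mxdiv T) 0 b * A b e = 0.
  rewrite IH.
  transitivity (f * (nu *m A) 0 e); last by rewrite nuA mxE mulr0.
  rewrite [(nu *m A) _ _]mxE mulr_sumr; apply: eq_bigr => b _.
  by rewrite [(f *: nu) _ _]mxE mulrA.
rewrite add0r.
(* Codazzi moves the free index e onto the derivative. The sum becomes tr (D_e A T_m), which is the
   derivative of sigma_(m+1), plus normal terms. *)
have -> : \sum_a \sum_b T a b * del a (A b e) =
   \tr (map_mx (del e) A *m T) +
   \sum_a \sum_b T a b * (nu 0 a * (A *m A) e b - nu 0 e * (A *m A) a b).
  rewrite -mxtrace_tr trmx_mul sT map_trmx A_sym.
  rewrite /mxtrace -big_split; apply: eq_bigr => a _ /=; rewrite mxE -big_split.
  apply: eq_bigr => b _ /=; rewrite -codazzi -mulrDr; congr (_ * _).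
  rewrite [in RHS]mxE -[A b e](_ : A^T e b = _); last by rewrite mxE.
  rewrite A_sym -[A b a](_ : A^T a b = _); last by rewrite mxE.
  by rewrite A_sym addrC subrK.
rewrite opprD addrA subrr add0r.
have -> : \sum_a \sum_b T a b * (nu 0 a * (A *m A) e b - nu 0 e * (A *m A) a b)
   = ((nu *m T) *m (A *m A)^T) 0 e - \tr (T *m (A *m A)^T) * nu 0 e.
  rewrite mxE /mxtrace mulr_suml.
  rewrite [X in X - _](_ : _ = \sum_a \sum_b nu 0 a * T a b * (A *m A) e b); last first.
    rewrite exchange_big; apply: eq_bigr => b _; rewrite !mxE mulr_suml.
    by apply: eq_bigr => a _.
  rewrite -sumrB; apply: eq_bigr => a _; rewrite mxE mulr_suml -sumrB.
  by apply: eq_bigr => b _; rewrite !mxE; ring.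
(* nu T_m is a multiple of nu and nu A = 0, so only the term along nu_e survives. *)
rewrite nu_trnewt -scalemxAl trmx_mul A_sym !mulmxA nuA mul0mx scaler0 !mxE.
by ring.
Qed.

Definition supp : F := (X *m nu^T) 0 0.
Definition Xtan : 'rV[F]_N := X - supp *: nu.

Lemma Xtan_nu : Xtan *m nu^T = 0.
Proof.
rewrite mulmxBl -scalemxAl nu1 scalemx1 [X *m nu^T]mx11_scalar.
by rewrite subrr.
Qed.

(** The derivative of X contributes the tangential projection of nu, which is 0. What remains is X
    A, and X may be replaced by X^T since nu A = 0. *)
Lemma grad_supp : grad supp = Xtan *m A.
Proof.
rewrite mulmxBl -scalemxAl nuA scaler0 subr0; apply/rowP => a.
rewrite mxE [RHS]mxE /supp mxE der_sum //.
transitivity (\sum_b (a == b)%:R * nu 0 b - nu 0 a * (nu *m nu^T) 0 0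
   + \sum_b X 0 b * A b a).
  rewrite [(nu *m _) _ _]mxE mulr_sumr -sumrB -big_split; apply: eq_bigr => b _.
  rewrite /= delM delX -[A b a](_ : A^T a b = _); last by rewrite mxE.
  by rewrite A_sym !mxE; ring.
rewrite nu1 mxE eqxx mulr1 (bigD1 a) //= eqxx mul1r big1 ?addr0 ?subrr ?add0r //.
by move=> b; rewrite eq_sym => /negPf ->; rewrite mul0r.
Qed.

Lemma tr_trnewt m : \tr (trnewt A m) = trsig A m *+ N - trsig A m *+ m.
Proof.
case: m => [|m]; first by rewrite mulr0n subr0 mxtrace1.
by rewrite trnewtS raddfB /= mxtrace_scalar trsigS.
Qed.

(** N is the ambient dimension n+1. The trace of T_m also counts the direction nu, where T_m acts as
    sigma_m; removing it accounts for [m.+1] in place of m and leaves the factor n - m. *)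
Lemma divg_newton_position m :
  divg (Xtan *m trnewt A m) =
    trsig A m *+ N - trsig A m *+ m.+1 - supp * (trsig A m.+1 *+ m.+1).
Proof.
have sT : (trnewt A m)^T = trnewt A m by apply: trnewt_sym.
rewrite divg_mulmx sT; have [f ->] := mxdiv_trnewt m.
rewrite linearZ /= -scalemxAr Xtan_nu scaler0 mxE add0r.
(* The bracket is the matrix of tangential derivatives of X^T = X - u nu. *)
transitivity (\tr ((1%:M - nu^T *m nu - (grad supp)^T *m nu - supp *: A)
    *m trnewt A m)).
  apply: eq_bigr => a _; rewrite mxE; apply: eq_bigr => b _; congr (_ * _).
  rewrite !mxE derB // delM delX /divg !big_ord1 !mxE; ring.
rewrite !mulmxBl mul1mx !raddfB /= -!mulmxA nu_trnewt -!scalemxAr -scalemxAl !linearZ /=.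
rewrite trsigS tr_trnewt [\tr (nu^T *m nu)]mxtrace_mulC.
rewrite [\tr (_^T *m nu)]mxtrace_mulC nu1.
have -> : nu *m (grad supp)^T = 0.
  by rewrite grad_supp trmx_mul mulmxA A_sym nuA mul0mx.
by rewrite raddf0 mulr0 subr0 mxtrace1 mulr1 mulrSr opprD addrA.
Qed.
End TangentialCalculus.
End NewtonTensors.

(** * Tangential derivations obtained by projecting commuting partials *)

Section GraphCalculus.
Variables (F : comNzRingType) (N : nat) (c : nat -> F).
Hypothesis cK : forall j, c j * j.+1%:R = 1.
(** G stands for the gradient of a defining function, tau for the inverse of its length up to sign,
    and h records how the derivative of the extended X differs from the identity. *)
Variables (d : 'I_N -> F -> F) (G h X : 'rV[F]_N) (tau : F).
Hypothesis dD : forall a f g, d a (f + g) = d a f + d a g.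
Hypothesis dM : forall a f g, d a (f * g) = d a f * g + f * d a g.
Hypothesis dC : forall a b f, d a (d b f) = d b (d a f).
Hypothesis dG : forall a b, d a (G 0 b) = d b (G 0 a).
Hypothesis dX : forall a b, d a (X 0 b) = (a == b)%:R - h 0 b * G 0 a.
Hypothesis tau2 : tau ^+ 2 * (\sum_a G 0 a ^+ 2) = 1.

Definition gnormal : 'rV[F]_N := tau *: G.
Local Notation nu := gnormal.
Definition dnormal f := \sum_a nu 0 a * d a f.
Definition gdel a f := d a f - nu 0 a * dnormal f.

Lemma gnormalE a : nu 0 a = tau * G 0 a. Proof. by rewrite mxE. Qed.

Lemma sum_gnormal2 : \sum_a nu 0 a * nu 0 a = 1.
Proof.
rewrite -tau2 mulr_sumr; apply: eq_bigr => a _; rewrite gnormalE; ring.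
Qed.

Lemma gnormal1 : nu *m nu^T = 1%:M.
Proof.
rewrite [LHS]mx11_scalar; congr _%:M; rewrite -sum_gnormal2 mxE.
by apply: eq_bigr => a _; rewrite !mxE.
Qed.

Lemma dnormalD f g : dnormal (f + g) = dnormal f + dnormal g.
Proof.
by rewrite /dnormal -big_split; apply: eq_bigr => a _; rewrite dD mulrDr.
Qed.

Lemma dnormalM f g : dnormal (f * g) = dnormal f * g + f * dnormal g.
Proof.
rewrite /dnormal mulr_suml mulr_sumr -big_split; apply: eq_bigr => a _ /=.
by rewrite dM; ring.
Qed.

Lemma gdelD a f g : gdel a (f + g) = gdel a f + gdel a g.
Proof. by rewrite /gdel dD dnormalD; ring. Qed.

Lemma gdelM a f g : gdel a (f * g) = gdel a f * g + f * gdel a g.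
Proof. by rewrite /gdel dM dnormalM; ring. Qed.

Lemma gdel_nu f : \sum_a nu 0 a * gdel a f = 0.
Proof.
rewrite /gdel; under eq_bigr do rewrite mulrBr mulrA.
by rewrite sumrB -mulr_suml sum_gnormal2 mul1r subrr.
Qed.

Lemma gdel_proj a f : gdel a f = \sum_b ((a == b)%:R - nu 0 a * nu 0 b) * d b f.
Proof.
under eq_bigr do rewrite mulrBl -mulrA.
rewrite sumrB -mulr_sumr (bigD1 a) //= eqxx mul1r big1 ?addr0 //.
by move=> b; rewrite eq_sym => /negPf ->; rewrite mul0r.
Qed.

(** The defect h_b G_a in the derivative of X is normal in the index a, so the projection kills it
    and X differentiates like the true position vector. *)
Lemma gdelX a b : gdel a (X 0 b) = (a == b)%:R - nu 0 a * nu 0 b.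
Proof.
rewrite gdel_proj; under eq_bigr do rewrite dX mulrBr.
rewrite sumrB [X in X - _](bigD1 b) //= eqxx mulr1 big1 ?addr0; last first.
  by move=> e /negPf ->; rewrite mulr0.
rewrite [X in _ - X](_ : _ = 0) ?subr0 //.
transitivity (h 0 b * \sum_e ((a == e)%:R - nu 0 a * nu 0 e) * G 0 e).
  by rewrite mulr_sumr; apply: eq_bigr => e _; ring.
rewrite [X in _ * X](_ : _ = 0) ?mulr0 //.
under eq_bigr do rewrite mulrBl.
rewrite sumrB (bigD1 a) //= eqxx mul1r big1 ?addr0; last first.
  by move=> e; rewrite eq_sym => /negPf ->; rewrite mul0r.
rewrite -[X in X - _](mul1r (G 0 a)) -tau2 mulr_sumr mulr_suml -sumrB.
by rewrite big1 // => e _; rewrite !gnormalE; ring.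
Qed.

Lemma sum_nu_der (D : F -> F) :
  (forall f g, D (f + g) = D f + D g) ->
  (forall f g, D (f * g) = D f * g + f * D g) ->
  \sum_l nu 0 l * D (nu 0 l) = 0.
Proof.
move=> DD DM; apply: (mulrnSI cK (j := 1)).
rewrite mul0rn -[RHS](der1 DM) -sum_gnormal2 (der_sum DD) -sumrMnl.
by apply: eq_bigr => l _; rewrite DM; ring.
Qed.

Let K a b := d a (G 0 b).
Let m a := \sum_e nu 0 e * K a e.

(** tau is known only through tau^2 |G|^2 = 1; its derivative is extracted from sum_l nu_l d nu_l =
    0 and substituted. *)
Lemma d_gnormal a b : d a (nu 0 b) = tau * (K a b - nu 0 b * m a).
Proof.
have H : d a tau * (\sum_l nu 0 l * G 0 l) + tau * m a = 0.
  rewrite -[RHS](sum_nu_der (dD a) (dM a)) /m !mulr_sumr -big_split.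
  apply: eq_bigr => l _ /=; rewrite (gnormalE l) dM.
  by rewrite /K; ring.
have tq : tau * (\sum_l nu 0 l * G 0 l) = 1.
  by rewrite -tau2 !mulr_sumr; apply: eq_bigr => l _; rewrite gnormalE; ring.
have dt : d a tau = - tau * tau * m a.
  move/(congr1 (fun z => tau * z)): H.
  rewrite mulr0 mulrDr mulrCA tq mulr1 => /eqP; rewrite addr_eq0 => /eqP ->.
  by ring.
by rewrite gnormalE dM dt /K; ring.
Qed.

(** This is tau times the Hessian of the defining function, projected on both sides. In this form
    the symmetry of A follows from [dG]. *)
Lemma gdel_gnormal a b : gdel a (nu 0 b) =
  tau * (K a b - nu 0 b * m a - nu 0 a * m b
         + nu 0 a * nu 0 b * \sum_e nu 0 e * m e).
Proof.
rewrite /gdel d_gnormal.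
have -> : dnormal (nu 0 b) = tau * (m b - nu 0 b * \sum_e nu 0 e * m e).
  rewrite /dnormal {1}/m [X in _ * (_ - X)]mulr_sumr -sumrB mulr_sumr.
  by apply: eq_bigr => e _; rewrite d_gnormal /K dG; ring.
by ring.
Qed.

Lemma shape_gdel_sym : (shape_mx gdel nu)^T = shape_mx gdel nu.
Proof.
apply/matrixP => a b; rewrite !mxE -!gnormalE !gdel_gnormal /K dG.
by ring.
Qed.

(** Second derivatives cancel by [dC]. The coefficient of the normal derivative of f vanishes by the
    symmetry of A, and C is orthogonal to nu, which lets d be replaced by its projection. *)
Lemma gdel_comm a b f : gdel a (gdel b f) - gdel b (gdel a f) =
  \sum_l (nu 0 a * shape_mx gdel nu b l - nu 0 b * shape_mx gdel nu a l)
    * gdel l f.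
Proof.
pose C l := nu 0 a * d b (nu 0 l) - nu 0 b * d a (nu 0 l).
transitivity (\sum_l C l * d l f); last first.
  have Cnu : \sum_l C l * nu 0 l = 0.
    transitivity (nu 0 a * (\sum_l nu 0 l * d b (nu 0 l))
                - nu 0 b * (\sum_l nu 0 l * d a (nu 0 l))).
      by rewrite !mulr_sumr -sumrB; apply: eq_bigr => l _; rewrite /C; ring.
    by rewrite !sum_nu_der // !mulr0 subrr.
  transitivity (\sum_l C l * d l f - (\sum_l C l * nu 0 l) * dnormal f).
    by rewrite Cnu mul0r subr0.
  rewrite mulr_suml -sumrB.
  apply: eq_bigr => l _; rewrite /C ![shape_mx _ _ _ _]mxE /gdel.
  by ring.
have sym := congr1 (fun M : 'M[F]_N => M b a) shape_gdel_sym.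
rewrite [LHS]mxE ![shape_mx _ _ _ _]mxE in sym.
have dn e : d e (dnormal f) = \sum_l d e (nu 0 l) * d l f + dnormal (d e f).
  rewrite /dnormal (der_sum (dD e)) -big_split; apply: eq_bigr => l _.
  by rewrite dM /= dC.
have dnB u v : dnormal (u - v) = dnormal u - dnormal v.
  exact: (derB dnormalD).
have dB e u v : d e (u - v) = d e u - d e v by exact: (derB (dD e)).
transitivity ((gdel b (nu 0 a) - gdel a (nu 0 b)) * dnormal f
  + (nu 0 a * (\sum_l d b (nu 0 l) * d l f) - nu 0 b * (\sum_l d a (nu 0 l) * d l f))).
  rewrite /gdel !dB !dM !dnB !dnormalM !dn dC; ring.
rewrite sym subrr mul0r add0r !mulr_sumr -sumrB; apply: eq_bigr => l _.
by rewrite /C; ring.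
Qed.

(* The left-hand side is the density times the surface divergence; the density
   of the area measure is W = |G|, so W * tau is a sign. *)
Lemma divg_graph (W e : F) (Z : 'rV[F]_N) :
  W * tau = e -> e * e = 1 -> (forall a, d a e = 0) -> Z *m nu^T = 0 ->
  W * divg gdel Z = \sum_a d a (W * Z 0 a).
Proof.
move=> We ee de Znu.
have Z0 : \sum_a Z 0 a * nu 0 a = 0.
  transitivity ((Z *m nu^T) 0 0); last by rewrite Znu mxE.
  by rewrite mxE; apply: eq_bigr => a _; rewrite !mxE.
(* Differentiating the orthogonality of Z and nu moves the normal derivative from Z to nu. *)
have dn0 : \sum_a nu 0 a * dnormal (Z 0 a) = - \sum_a Z 0 a * dnormal (nu 0 a).
  apply/eqP; rewrite -addr_eq0 -big_split; apply/eqP.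
  transitivity (dnormal 0); last exact: (der0 dnormalD).
  rewrite -[in RHS]Z0 (der_sum dnormalD); apply: eq_bigr => a _.
  by rewrite dnormalM /=; ring.
(* From W tau = e with e constant: the derivative of W is determined by that of tau. *)
have dW a : d a W = e * m a.
  have te : tau * e * W = 1.
    by transitivity (W * tau * e); [ring|rewrite We].
  have dt : d a tau = - tau * tau * m a.
    have H : \sum_b nu 0 b * d a (nu 0 b) = \sum_b (d a tau * (nu 0 b * G 0 b)
          + tau * (nu 0 b * K a b)).
      by apply: eq_bigr => b _; rewrite (gnormalE b) dM /K; ring.
    rewrite sum_nu_der // big_split /= -!mulr_sumr -/(m a) in H.
    have tq : tau * (\sum_l nu 0 l * G 0 l) = 1.
      by rewrite -tau2 !mulr_sumr; apply: eq_bigr => l _; rewrite gnormalE; ring.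
    move/(congr1 (fun z => tau * z)): H.
    rewrite mulr0 mulrDr mulrCA tq mulr1 => h0.
    apply: (addIr (tau * (tau * m a))); rewrite -h0.
    by ring.
  have := congr1 (d a) We; rewrite dM de dt => /eqP.
  rewrite addr_eq0 => /eqP H.
  rewrite -[d a W]mulr1 -te !mulrA H.
  transitivity (W * tau * (W * tau) * e * m a); first by ring.
  by rewrite We ee mul1r.
transitivity (W * (\sum_a d a (Z 0 a)) + W * \sum_a Z 0 a * dnormal (nu 0 a)).
  rewrite /divg /gdel sumrB mulrBr; congr (_ + _).
  by rewrite dn0 mulrN opprK.
rewrite !mulr_sumr.
have -> : \sum_a W * (Z 0 a * dnormal (nu 0 a)) = \sum_a d a W * Z 0 a.
  transitivity (\sum_a e * (m a * Z 0 a)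
     - (e * \sum_e nu 0 e * m e) * (\sum_a Z 0 a * nu 0 a)).
    rewrite mulr_sumr -sumrB; apply: eq_bigr => a _.
    have -> : dnormal (nu 0 a) = tau * (m a - nu 0 a * \sum_e nu 0 e * m e).
      rewrite /dnormal {1}/m [X in _ * (_ - X)]mulr_sumr -sumrB mulr_sumr.
      by apply: eq_bigr => l _; rewrite d_gnormal /K dG; ring.
    by rewrite -We; ring.
  rewrite Z0 mulr0 subr0; apply: eq_bigr => a _; rewrite dW; ring.
by rewrite -big_split; apply: eq_bigr => a _; rewrite dM /= addrC.
Qed.
End GraphCalculus.

(** * The ring of smooth functions *)

Section SmoothFunctions.
Context {R : realType} {n : nat}.
Implicit Types (V : set 'rV[R]_n) (k : nat).

Local Notation e_ i := (delta_mx ord0 i : 'rV[R]_n).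

Lemma Ck_on_ext (W : normedModType R) V k (f g : 'rV[R]_n -> W) :
  f =1 g -> Ck_on V k f -> Ck_on V k g.
Proof. by move=> /funext ->. Qed.

Lemma Ck_onW (W : normedModType R) V k (f : 'rV[R]_n -> W) :
  Ck_on V k.+1 f -> Ck_on V k f.
Proof.
elim: k f => [|k IH] f [df Df] /=.
  by move=> x Vx; apply: differentiable_continuous; apply: df.
by split=> // i; apply: IH; apply: Df.
Qed.

Lemma Ck_on_sub (W : normedModType R) V V' k (f : 'rV[R]_n -> W) :
  V' `<=` V -> Ck_on V k f -> Ck_on V' k f.
Proof.
move=> VV'; elim: k f => [|k IH] f /=; first by move=> cf x /VV'; apply: cf.
by move=> [df Df]; split=> [x /VV'|i]; [apply: df|apply: IH; apply: Df].
Qed.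

Lemma Ck_on_cst (W : normedModType R) V k (c : W) : Ck_on V k (fun=> c).
Proof.
elim: k c => [|k IH] c /=; first by move=> x _; exact: cst_continuous.
split=> [x _|i]; first exact: differentiable_cst.
apply: (@Ck_on_ext _ _ _ (fun=> 0)); last exact: IH.
by move=> x; rewrite derive_cst.
Qed.

Lemma Ck_on_add (W : normedModType R) k (f g : 'rV[R]_n -> W) :
  Ck_on setT k f -> Ck_on setT k g -> Ck_on setT k (fun x => f x + g x).
Proof.
elim: k f g => [|k IH] f g /=.
  by move=> cf cg x _; exact: (cvgD (cf x I) (cg x I)).
move=> [df Df] [dg Dg]; split=> [x _|i].
  by apply: differentiableD; [apply: df|apply: dg].
apply: (@Ck_on_ext _ _ _ (fun x => 'D_(e_ i) f x + 'D_(e_ i) g x)); last exact: IH.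
by move=> x; rewrite deriveD //; apply: diff_derivable; [apply: df|apply: dg].
Qed.

Lemma Ck_on_mul k (f g : 'rV[R]_n -> R) :
  Ck_on setT k f -> Ck_on setT k g -> Ck_on setT k (fun x => f x * g x).
Proof.
elim: k f g => [|k IH] f g.
  by move=> cf cg x _; exact: (cvgM (cf x I) (cg x I)).
move=> cf cg; have [df Df] := cf; have [dg Dg] := cg; split=> [x _|i].
  by apply: differentiableM; [apply: df|apply: dg].
apply: (@Ck_on_ext _ _ _ (fun x => f x * 'D_(e_ i) g x + g x * 'D_(e_ i) f x)).
  by move=> x; rewrite deriveM //; apply: diff_derivable; [apply: df|apply: dg].
apply: Ck_on_add.
  by apply: IH; [exact: Ck_onW|exact: Dg].
by apply: IH; [exact: Ck_onW|exact: Df].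
Qed.

Lemma derive_comp_R (f : 'rV[R]_n -> R) (h : R -> R) (d : R) x :
  differentiable f x -> is_derive (f x) 1 h d ->
  differentiable (h \o f) x /\
  forall v, 'D_v (h \o f) x = d * 'D_v f x.
Proof.
move=> df [dh hd]; have dh' : differentiable h (f x) by apply/derivable1_diffP.
have dhf := differentiable_comp df dh'.
split=> // v; rewrite !deriveE // diff_comp //= deriv1E //.
by rewrite derive1E hd mulrC.
Qed.

(** The derivative is a product of copies of f^-1 and of D f, so each step of the induction gains
    one order. *)
Lemma Ck_on_inv k (f : 'rV[R]_n -> R) : (forall x, f x != 0) ->
  Ck_on setT k f -> Ck_on setT k (fun x => (f x)^-1).
Proof.
move=> f0; elim: k => [|k IH].
  by move=> cf x _; exact: (cvgV (f0 x) (cf x I)).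
move=> cf; have [df Df] := cf; split=> [x _|i].
  by apply: differentiableV; [apply: df|apply: f0].
apply: (@Ck_on_ext _ _ _ (fun x => (-1) * ((f x)^-1 * (f x)^-1) * 'D_(e_ i) f x)).
  move=> x; rewrite deriveV //; last by apply: diff_derivable; apply: df.
  by rewrite expr2 invfM scaleNr mulN1r mulNr.
apply: Ck_on_mul; last exact: Df.
apply: Ck_on_mul; first exact: Ck_on_cst.
by apply: Ck_on_mul; apply: IH; apply: Ck_onW.
Qed.

Lemma Ck_on_sqrt k (f : 'rV[R]_n -> R) : (forall x, 0 < f x) ->
  Ck_on setT k f -> Ck_on setT k (fun x => Num.sqrt (f x)).
Proof.
move=> f0; elim: k => [|k IH].
  move=> cf x _; apply: (@continuous_comp _ _ _ f Num.sqrt); first exact: cf.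
  exact: sqrt_continuous.
move=> cf; have [df Df] := cf.
have H x := derive_comp_R (df x I) (is_derive1_sqrt (f0 x)).
split=> [x _|i]; first by have [] := H x.
apply: (@Ck_on_ext _ _ _ (fun x => (2 * Num.sqrt (f x))^-1 * 'D_(e_ i) f x)).
  by move=> x; have [_ /(_ (e_ i)) ->] := H x.
apply: Ck_on_mul; last exact: Df.
apply: Ck_on_inv.
  by move=> x; rewrite mulf_neq0 // ?pnatr_eq0 // gt_eqF // sqrtr_gt0.
by apply: Ck_on_mul; [exact: Ck_on_cst|apply: IH; apply: Ck_onW].
Qed.

Lemma is_derive_linear (W : normedModType R) (f : {linear 'rV[R]_n -> W}) x v :
  continuous f -> is_derive x v f (f v).
Proof.
move=> cf; have df : differentiable f x by apply: linear_differentiable.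
split; first exact: diff_derivable.
by rewrite deriveE // diff_lin.
Qed.

Lemma Ck_on_linear (W : normedModType R) k (f : {linear 'rV[R]_n -> W}) :
  continuous f -> Ck_on setT k f.
Proof.
move=> cf; case: k => [|k]; first by move=> x _; apply: cf.
split=> [x _|i]; first exact: linear_differentiable.
apply: (@Ck_on_ext _ _ _ (fun=> f (e_ i))); last exact: Ck_on_cst.
by move=> x; rewrite (@derive_val _ _ _ _ _ _ _ (is_derive_linear x (e_ i) cf)).
Qed.

Definition coord_fun (i : 'I_n) (y : 'rV[R]_n) : R := y 0 i.
Lemma coord_fun_linear i : linear (coord_fun i).
Proof. by move=> a y z; rewrite /coord_fun !mxE. Qed.
HB.instance Definition _ i :=
  GRing.isLinear.Build R 'rV[R]_n R _ (coord_fun i) (coord_fun_linear i).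

Lemma coord_fun_continuous i : continuous (coord_fun i).
Proof. exact: coord_continuous. Qed.

Lemma is_derive_coord_fun i x v : is_derive x v (coord_fun i) (v 0 i).
Proof. exact: is_derive_linear (coord_fun_continuous (i:=i)). Qed.

Lemma Ck_on_scale (W : normedModType R) k (f : 'rV[R]_n -> R) (w : W) :
  Ck_on setT k f -> Ck_on setT k (fun x => f x *: w).
Proof.
elim: k f => [|k IH] f.
  by move=> cf x _; exact: (cvgZr_tmp (cf x I)).
move=> [df Df]; split=> [x _|i]; first by apply: differentiableZl; exact: (df _ I).
apply: (@Ck_on_ext _ _ _ (fun x => 'D_(e_ i) f x *: w)); last exact/IH/Df.
by move=> x; rewrite !deriveE ?diffZl //; do ?apply: differentiableZl; exact: (df _ I).
Qed.

Definition smooth_pred : {pred ('rV[R]_n -> R)} :=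
  fun f => `[< smooth_on setT f >].

Lemma smooth_pred_subring : subring_closed smooth_pred.
Proof.
split.
- by apply/asboolP => k; apply: Ck_on_cst.
- move=> f g /asboolP sf /asboolP sg; apply/asboolP => k.
  apply: Ck_on_add; first exact: sf.
  apply: (@Ck_on_ext _ _ _ (fun x => (-1) * g x)).
    by move=> x; rewrite mulN1r.
  by apply: Ck_on_mul; [exact: Ck_on_cst|exact: sg].
- move=> f g /asboolP sf /asboolP sg; apply/asboolP => k.
  by apply: Ck_on_mul; [exact: sf|exact: sg].
Qed.
HB.instance Definition _ :=
  GRing.isSubringClosed.Build _ smooth_pred smooth_pred_subring.

(** Smoothness is required globally because [smooth_boundary] provides g on all of R^n; the abstract
    algebra then applies without shrinking domains. *)
Record smooth_fun := SmoothFun {smooth_val :> 'rV[R]_n -> R; _ : smooth_pred smooth_val}.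
HB.instance Definition _ := [isSub for smooth_val].
HB.instance Definition _ := [Choice of smooth_fun by <:].
HB.instance Definition _ := [SubChoice_isSubComNzRing of smooth_fun by <:].

Lemma smooth_funP (f : smooth_fun) : smooth_on setT f.
Proof. by case: f => f /= /asboolP. Qed.

Definition mk_smooth (f : 'rV[R]_n -> R) (sf : smooth_on setT f) : smooth_fun :=
  SmoothFun (asboolT sf).

Lemma smooth_fun_eqP (f g : smooth_fun) : f =1 g <-> f = g.
Proof. by split=> [/funext fg|->//]; apply: val_inj. Qed.
End SmoothFunctions.

(** * Symmetry of second partial derivatives *)

Section Schwarz.
Context {R : realType} {V : normedModType R}.

Lemma derive_line (F : V -> R) (y v : V) (t : R) :
  derivable F (y + t *: v) v ->
  is_derive t (1 : R) (fun s => F (y + s *: v)) ('D_v F (y + t *: v)).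
Proof.
have E : (fun h : R => h^-1 *: (F (y + (h *: (1 : R) + t) *: v) - F (y + t *: v)))
    = (fun h : R => h^-1 *: (F (h *: v + (y + t *: v)) - F (y + t *: v))).
  apply/funext => h; congr (_ *: (F _ - _)).
  by rewrite [h *: 1]mulr1 scalerDl addrCA.
move=> dF; split.
- by rewrite /derivable /= E.
- by rewrite /derive /= E.
Qed.

Lemma MVT_line (F : V -> R) (y v : V) (s : R) : 0 < s ->
  (forall z, differentiable F z) ->
  exists2 t, 0 <= t <= s & F (y + s *: v) - F y = s * 'D_v F (y + t *: v).
Proof.
move=> s0 dF.
have H t : is_derive t (1 : R) (fun s => F (y + s *: v)) ('D_v F (y + t *: v)).
  by apply: derive_line; apply: diff_derivable.
have cF : {within `[0, s], continuous (fun s : R => F (y + s *: v))}.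
  apply: continuous_subspaceT => t.
  by apply: differentiable_continuous; apply/derivable1_diffP; have [] := H t.
have [t] := MVT s0 (fun t _ => H t) cF; rewrite in_itv /= => /andP[t0 ts] e; exists t; first by rewrite !ltW.
by move: e; rewrite scale0r addr0 subr0 mulrC.
Qed.

(** The mean value theorem is applied twice to the second difference: in direction v to z |-> F (z +
    s w) - F z, then in direction w to D_v F. *)
Lemma MVT_mixed (F : V -> R) (y v w : V) (s : R) : 0 < s ->
  (forall z, differentiable F z) -> (forall z, differentiable ('D_v F) z) ->
  exists t u, [/\ 0 <= t <= s, 0 <= u <= s &
   F (y + s *: v + s *: w) - F (y + s *: v) - (F (y + s *: w) - F y)
     = s * (s * 'D_w ('D_v F) (y + t *: v + u *: w))].
Proof.
move=> s0 dF dvF.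
have dsh (z : V) : differentiable (fun z : V => z + s *: w) z by [].
pose P z := F (z + s *: w) - F z.
have dFs (z : V) : differentiable (fun z : V => F (z + s *: w)) z.
  exact: (differentiable_comp (dsh z) (dF _)).
have dP z : differentiable P z := differentiableB (dFs z) (dF z).
have [t ts E] := MVT_line y v s0 dP.
have DP z : 'D_v P z = 'D_v F (z + s *: w) - 'D_v F z.
  rewrite deriveB; last 2 first.
  - exact: diff_derivable.
  - exact: diff_derivable.
  congr (_ - _); apply: (congr1 (fun f : R -> R => lim (f @ 0^'))).
  by apply/funext => h; rewrite /= addrA.
have [u us E'] := MVT_line (y + t *: v) w s0 dvF.
by exists t, u; split=> //; rewrite -E' -DP -E.
Qed.

(** All four parameters tend to 0 with s, so continuity at y forces equality in the limit. *)
Lemma eq_of_mixed_values (f1 f2 : V -> R) (y v w : V) :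
  {for y, continuous f1} -> {for y, continuous f2} ->
  (forall s, 0 < s -> exists t u t' u',
     [/\ 0 <= t <= s, 0 <= u <= s, 0 <= t' <= s, 0 <= u' <= s &
        f1 (y + t *: v + u *: w) = f2 (y + t' *: w + u' *: v)]) ->
  f1 y = f2 y.
Proof.
move=> c1 c2 H; apply/eqP; rewrite -subr_eq0 -normr_le0; apply/ler_addgt0Pl => e e0.
rewrite addr0.
have e2 : 0 < e / 2 by rewrite divr_gt0.
move/cvgrPdist_lt: c1 => /(_ _ e2)/nbhs_ballP[d1 /= d10 H1].
move/cvgrPdist_lt: c2 => /(_ _ e2)/nbhs_ballP[d2 /= d20 H2].
pose d := Num.min d1 d2.
have d0 : 0 < d by rewrite lt_min d10.
(* With this step size every evaluation point stays within d of y. *)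
pose s := d / (1 + `|v| + `|w|).
have q0 : 0 < 1 + `|v| + `|w| by rewrite -addrA ltr_pwDl ?addr_ge0.
have s0 : 0 < s by rewrite divr_gt0.
have close t u : 0 <= t <= s -> 0 <= u <= s -> `|t *: v + u *: w| < d.
  move=> /andP[t0 ts] /andP[u0 us].
  apply: (le_lt_trans (ler_normD _ _)); rewrite !normrZ (ger0_norm t0) (ger0_norm u0).
  apply: (@le_lt_trans _ _ (s * (`|v| + `|w|))).
    by rewrite mulrDr lerD // ler_wpM2r.
  by rewrite /s mulrAC ltr_pdivrMr // ltr_pM2l // -addrA ltrDr.
have [t1 [u1 [t2 [u2 [t1s u1s t2s u2s E]]]]] := H s s0.
have B1 : `|f1 y - f1 (y + t1 *: v + u1 *: w)| < e / 2.
  apply: H1; rewrite -ball_normE /= -addrA opprD addrA subrr sub0r normrN.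
  by apply: (lt_le_trans (close _ _ t1s u1s)); rewrite /d ge_min lexx.
have B2 : `|f2 y - f2 (y + t2 *: w + u2 *: v)| < e / 2.
  apply: H2; rewrite -ball_normE /= -addrA opprD addrA subrr sub0r normrN addrC.
  by apply: (lt_le_trans (close _ _ u2s t2s)); rewrite /d ge_min lexx orbT.
move: B1 B2; rewrite E !ltr_norml => /andP[? ?] /andP[? ?]; rewrite ler_norml.
by apply/andP; lra.
Qed.

(** The second difference is symmetric in v and w, and it is s^2 times a value of either mixed
    derivative near y. *)
Lemma schwarz (F : V -> R) (y v w : V) :
  (forall z, differentiable F z) ->
  (forall z, differentiable ('D_v F) z) -> (forall z, differentiable ('D_w F) z) ->
  {for y, continuous ('D_w ('D_v F))} -> {for y, continuous ('D_v ('D_w F))} ->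
  'D_w ('D_v F) y = 'D_v ('D_w F) y.
Proof.
move=> dF dv dw c1 c2; apply: (eq_of_mixed_values (v := v) (w := w) c1 c2) => s s0.
have [t1 [u1 [t1s u1s E1]]] := @MVT_mixed F y v w s s0 dF dv.
have [t2 [u2 [t2s u2s E2]]] := @MVT_mixed F y w v s s0 dF dw.
exists t1, u1, t2, u2; split; [exact: t1s|exact: u1s|exact: t2s|exact: u2s|].
have can (p q : R) : s * (s * p) = s * (s * q) -> p = q.
  have sn : s != 0 by rewrite gt_eqF.
  by move=> /(mulfI sn)/(mulfI sn).
apply: can; refine (Logic.eq_trans (Logic.eq_sym E1) (Logic.eq_trans _ E2)).
have com (p q r x : R) : p - q - (r - x) = p - r - (q - x) by ring.
by rewrite com -!addrA [s *: v + s *: w]addrC.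
Qed.
End Schwarz.

(** * Commuting derivations on the smooth functions *)

Section SmoothDerivations.
Context {R : realType} {n : nat}.
Local Notation S := (@smooth_fun R n).

Lemma smooth_fun_diff (f : S) y : differentiable f y.
Proof. by have [df _] := smooth_funP f 1; exact: df. Qed.

Lemma smooth_fun_cont (f : S) : continuous f.
Proof. by move=> y; apply: (smooth_funP f 0). Qed.

Lemma smooth_partial (j : 'I_n) (f : S) : smooth_on setT ('D_(delta_mx ord0 j) f).
Proof. by move=> k; have [_] := smooth_funP f k.+1; apply. Qed.

Definition spart j f : S := mk_smooth (smooth_partial j f).
Lemma smooth_cst_fun (a : R) : smooth_on [set: 'rV[R]_n] (fun=> a).
Proof. by move=> k; exact: Ck_on_cst. Qed.
Definition scst a : S := mk_smooth (smooth_cst_fun a).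

Lemma smooth_coord_fun (j : 'I_n) : smooth_on setT (coord_fun j : 'rV[R]_n -> R).
Proof. by move=> k; apply: Ck_on_linear; exact: coord_fun_continuous. Qed.
Definition scoord j : S := mk_smooth (smooth_coord_fun j).

Lemma smooth_addE (f g : S) y : (f + g : S) y = f y + g y. Proof. by []. Qed.
Lemma smooth_mulE (f g : S) y : (f * g : S) y = f y * g y. Proof. by []. Qed.
Lemma smooth_oppE (f : S) y : (- f : S) y = - f y. Proof. by []. Qed.
Lemma smooth_0E y : (0 : S) y = 0. Proof. by []. Qed.
Lemma smooth_sumE I r (P : pred I) (f : I -> S) y :
  (\sum_(i <- r | P i) f i) y = \sum_(i <- r | P i) f i y.
Proof. by elim/big_rec2 : _ => // i u v _ <-. Qed.

(** Evaluation at a point is made a ring morphism so that matrix identities over the ring pass to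
    real matrices through [map_mx]. *)
Definition sev (y : 'rV[R]_n) (f : S) : R := f y.
Lemma sev_additive y : zmod_morphism (sev y). Proof. by []. Qed.
HB.instance Definition _ y := GRing.isZmodMorphism.Build S R (sev y) (sev_additive y).
Lemma sev_multiplicative y : monoid_morphism (sev y). Proof. by []. Qed.
HB.instance Definition _ y := GRing.isMonoidMorphism.Build S R (sev y) (sev_multiplicative y).

Lemma spartD j (f g : S) : spart j (f + g) = spart j f + spart j g.
Proof.
apply/smooth_fun_eqP => y; rewrite smooth_addE /=.
by apply: deriveD; apply: diff_derivable; apply: smooth_fun_diff.
Qed.

Lemma spartM j (f g : S) : spart j (f * g) = spart j f * g + f * spart j g.
Proof.
apply/smooth_fun_eqP => y; rewrite smooth_addE !smooth_mulE /=.
have [df dg] : derivable f y (delta_mx ord0 j) /\ derivable g y (delta_mx ord0 j).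
  by split; apply: diff_derivable; apply: smooth_fun_diff.
refine (Logic.eq_trans (deriveM df dg) _).
by rewrite addrC [X in X + _ = _]mulrC.
Qed.

Lemma spartC i j (f : S) : spart i (spart j f) = spart j (spart i f).
Proof.
apply/smooth_fun_eqP => y /=; apply: schwarz.
- exact: smooth_fun_diff.
- exact: (smooth_fun_diff (spart j f)).
- exact: (smooth_fun_diff (spart i f)).
- exact: (smooth_fun_cont (f := spart i (spart j f))).
- exact: (smooth_fun_cont (f := spart j (spart i f))).
Qed.

Lemma spart_cst j a : spart j (scst a) = 0.
Proof. by apply/smooth_fun_eqP => y /=; rewrite derive_cst. Qed.

Lemma spart_coord j i : spart j (scoord i) = (j == i)%:R.
Proof.
apply/smooth_fun_eqP => y /=.
rewrite (@derive_val _ _ _ _ _ _ _ (is_derive_coord_fun i y (delta_mx ord0 j))).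
by rewrite !mxE eqxx /= eq_sym; case: eqP.
Qed.

Definition sinvn j : S := scst (j.+1%:R^-1).
Lemma sinvnK j : sinvn j * j.+1%:R = 1.
Proof.
apply/smooth_fun_eqP => y; rewrite smooth_mulE -[(_%:R : S) _]/(sev y _) rmorph_nat /=.
by rewrite mulVf // pnatr_eq0.
Qed.
End SmoothDerivations.

(** * The calculus of a graph chart *)

Section Chart.
Context {R : realType} {n : nat}.
Local Notation S := (@smooth_fun R n).
Variables (i0 : 'I_n.+1) (b : bool) (g : S).

(* Functions of the n parameters are extended to R^(n+1) independently of x_i0,
   so cpart is the ambient partial derivative, and cgrad is the gradient of
   x_i0 - g. *)
Definition cpart (a : 'I_n.+1) (f : S) : S :=
  if unlift i0 a is Some j then spart j f else 0.

Lemma cpartD a (f h : S) : cpart a (f + h) = cpart a f + cpart a h.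
Proof. by rewrite /cpart; case: unlift => [j|]; rewrite ?spartD ?addr0. Qed.

Lemma cpartM a (f h : S) : cpart a (f * h) = cpart a f * h + f * cpart a h.
Proof. by rewrite /cpart; case: unlift => [j|]; rewrite ?spartM // mul0r mulr0 addr0. Qed.

Lemma cpart0 a : cpart a 0 = 0.
Proof. exact: (der0 (cpartD a)). Qed.

Lemma cpartC a c (f : S) : cpart a (cpart c f) = cpart c (cpart a f).
Proof.
rewrite {1 4}/cpart; case: (unlift i0 a) => [j|]; last by rewrite cpart0.
by rewrite /cpart; case: (unlift i0 c) => [l|]; rewrite 1?spartC // (der0 (spartD j)).
Qed.

Lemma cpart_cst a x : cpart a (scst x) = 0.
Proof. by rewrite /cpart; case: unlift => [j|]; rewrite ?spart_cst. Qed.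

Definition cgrad : 'rV[S]_n.+1 := \row_a ((a == i0)%:R - cpart a g).
Definition cpos : 'rV[S]_n.+1 :=
  \row_a (if unlift i0 a is Some j then scoord j else g).
Definition cdir : 'rV[S]_n.+1 := \row_a (a == i0)%:R.

Lemma cpart_grad a c : cpart a (cgrad 0 c) = cpart c (cgrad 0 a).
Proof.
rewrite !mxE !(derB (cpartD _)) cpartC.
by rewrite !(derMn (cpartD _)) !(der1 (cpartM _)) !mul0rn.
Qed.

Lemma cpart_pos a c : cpart a (cpos 0 c) = (a == c)%:R - cdir 0 c * cgrad 0 a.
Proof.
rewrite !mxE; case: (unliftP i0 c) => [j ->|->].
  rewrite [_ == i0]eq_sym (negPf (neq_lift _ _)) mul0r subr0 /cpart.
  case: (unliftP i0 a) => [l ->|->]; first by rewrite spart_coord (inj_eq (@lift_inj _ _)).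
  by rewrite (negPf (neq_lift _ _)).
by rewrite eqxx mul1r opprB addrC subrK.
Qed.

Definition cnorm2 : S := \sum_a cgrad 0 a ^+ 2.

Lemma cnorm2_ge1 y : 1 <= cnorm2 y.
Proof.
rewrite smooth_sumE (bigD1 i0) // (_ : cgrad 0 i0 = 1); last first.
  by rewrite mxE eqxx /cpart unlift_none subr0.
rewrite expr1n lerDl sumr_ge0 // => a _.
by rewrite expr2 smooth_mulE -expr2 sqr_ge0.
Qed.

Lemma cnorm2_gt0 y : 0 < cnorm2 y.
Proof. exact: lt_le_trans (cnorm2_ge1 y). Qed.

Lemma smooth_cnorm : smooth_on setT (fun y => Num.sqrt (cnorm2 y)).
Proof. by move=> k; apply: Ck_on_sqrt; [exact: cnorm2_gt0|exact: smooth_funP]. Qed.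
Definition cnorm : S := mk_smooth smooth_cnorm.

Lemma cnorm_gt0 y : 0 < cnorm y.
Proof. by rewrite sqrtr_gt0 cnorm2_gt0. Qed.

Lemma smooth_cinorm : smooth_on setT (fun y => (cnorm y)^-1).
Proof.
move=> k; apply: Ck_on_inv; last exact: smooth_funP.
by move=> y; rewrite gt_eqF // cnorm_gt0.
Qed.
Definition cinorm : S := mk_smooth smooth_cinorm.

(** Omega is the side where (-1)^b (x_i - g) > 0, so the outward normal is opposite to (-1)^b times
    the gradient. *)
Definition csign : S := scst (- (-1) ^+ b).
Definition ctau : S := csign * cinorm.

Lemma csign2 : csign * csign = 1.
Proof.
apply/smooth_fun_eqP => y; rewrite smooth_mulE /= mulrNN -expr2.
by case: b; rewrite ?expr1 ?expr0 ?sqrrN expr1n.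
Qed.

Lemma cnormK : cnorm * cinorm = 1.
Proof. by apply/smooth_fun_eqP => y; rewrite smooth_mulE /= mulfV // gt_eqF // cnorm_gt0. Qed.

Lemma cnorm_sq : cnorm * cnorm = cnorm2.
Proof.
by apply/smooth_fun_eqP => y; rewrite smooth_mulE /= -expr2 sqr_sqrtr // ltW // cnorm2_gt0.
Qed.

Lemma cnorm_tau : cnorm * ctau = csign.
Proof. by rewrite /ctau mulrCA cnormK mulr1. Qed.

Lemma ctau2 : ctau ^+ 2 * (\sum_a cgrad 0 a ^+ 2) = 1.
Proof.
rewrite -/cnorm2 -cnorm_sq.
transitivity ((cnorm * ctau) * (cnorm * ctau)); first by ring.
by rewrite cnorm_tau csign2.
Qed.

Definition cnu : 'rV[S]_n.+1 := gnormal cgrad ctau.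
Definition cdel : 'I_n.+1 -> S -> S := gdel cpart cgrad ctau.
Definition cshape : 'M[S]_n.+1 := shape_mx cdel cnu.
Definition csig m : S := trsig sinvn cshape m.
Definition cnewt m : 'M[S]_n.+1 := trnewt sinvn cshape m.
Definition csupp : S := supp cnu cpos.
Definition cXtan : 'rV[S]_n.+1 := Xtan cnu cpos.

Lemma cdelD a f h : cdel a (f + h) = cdel a f + cdel a h.
Proof. exact: (gdelD cgrad ctau cpartD). Qed.
Lemma cdelM a f h : cdel a (f * h) = cdel a f * h + f * cdel a h.
Proof. exact: (gdelM cgrad ctau cpartM). Qed.
Lemma cnu1 : cnu *m cnu^T = 1%:M.
Proof. exact: (gnormal1 ctau2). Qed.
Lemma cdel_nu f : \sum_a cnu 0 a * cdel a f = 0.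
Proof. exact: (gdel_nu cpart ctau2). Qed.
Lemma cshape_sym : cshape^T = cshape.
Proof. exact: (shape_gdel_sym sinvnK cpartD cpartM cpart_grad ctau2). Qed.
Lemma cdel_comm a c f : cdel a (cdel c f) - cdel c (cdel a f) =
  \sum_l (cnu 0 a * cshape c l - cnu 0 c * cshape a l) * cdel l f.
Proof. exact: (gdel_comm sinvnK cpartD cpartM cpartC cpart_grad ctau2). Qed.
Lemma cdel_pos a c : cdel a (cpos 0 c) = (a == c)%:R - cnu 0 a * cnu 0 c.
Proof. exact: (gdelX cpart_pos ctau2). Qed.
Lemma cshape_nu : cshape *m cnu^T = 0.
Proof. exact: (Anu cdel_nu cshape_sym). Qed.
Lemma cXtan_nu : cXtan *m cnu^T = 0.
Proof. exact: (Xtan_nu cpos cnu1). Qed.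

(** [cnorm] is the area density, so the weighted surface divergence becomes a Euclidean divergence
    in the n parameters. The component along [i0] drops out because the extended functions do not
    depend on that coordinate. *)
Lemma cdivg_graph (Z : 'rV[S]_n.+1) : Z *m cnu^T = 0 ->
  cnorm * divg cdel Z = \sum_j spart j (cnorm * Z 0 (lift i0 j)).
Proof.
move=> Zn; rewrite (divg_graph sinvnK cpartD cpartM cpart_grad ctau2 cnorm_tau csign2 _ Zn); last first.
  by move=> a; rewrite cpart_cst.
rewrite (bigD1_ord i0) //= {1}/cpart unlift_none add0r.
by apply: eq_bigr => j _; rewrite /cpart liftK.
Qed.

Lemma cdivg_newton m : divg cdel (cXtan *m cnewt m) =
  csig m *+ n.+1 - csig m *+ m.+1 - csupp * (csig m.+1 *+ m.+1).
Proof.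
exact: (divg_newton_position sinvnK cdelD cdelM cnu1 cdel_nu cshape_sym cdel_comm cdel_pos).
Qed.

Lemma cdivg_supp_newton m : divg cdel (csupp *: (cXtan *m cnewt m)) =
  csupp * (csig m *+ n.+1 - csig m *+ m.+1 - csupp * (csig m.+1 *+ m.+1))
  + (cXtan *m cshape *m cnewt m *m cXtan^T) 0 0.
Proof.
rewrite (divgM cdelM) cdivg_newton; congr (_ + _).
have -> : grad cdel csupp = cXtan *m cshape.
  exact: (grad_supp cdelD cdelM cnu1 cdel_nu cshape_sym cdel_pos).
rewrite trmx_mul cshape_sym mulmxA; congr ((_ *m _) 0 0).
by rewrite -!mulmxA (trnewt_comm sinvn).
Qed.

(** nu is an eigenvector of the symmetric T_m, so its orthogonal complement is preserved. *)
Lemma cnewt_tan m (Z : 'rV[S]_n.+1) : Z *m cnu^T = 0 -> Z *m cnewt m *m cnu^T = 0.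
Proof.
move=> Zn; rewrite -mulmxA.
have -> : cnewt m *m cnu^T = csig m *: cnu^T.
  rewrite -[cnewt m](trnewt_sym sinvn m cshape_sym) -trmx_mul.
  by rewrite (nu_trnewt sinvn cdel_nu) linearZ.
by rewrite -scalemxAr Zn scaler0.
Qed.
End Chart.

(** * Integration on row vectors *)

Section RowMeasurability.
Context {R : realType}.
Local Notation T := (measurableTypeR R).

Lemma rV_open_measurable n (A : set 'rV[R]_n) : open A -> measurable A.
Proof. exact: sub_sigma_algebra. Qed.

Lemma rV_closed_measurable n (A : set 'rV[R]_n) : closed A -> measurable A.
Proof.
by move=> cA; rewrite -[A]setCK; apply: measurableC; apply: rV_open_measurable; exact: closed_openC.
Qed.

Lemma measurable_to_R d (X : measurableType d) (D : set X) (f : X -> R) :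
  (forall U, open U -> measurable (D `&` f @^-1` U)) -> measurable_fun D (f : X -> T).
Proof.
move=> H; apply: (@measurability _ _ _ _ _ _ (@measurable_realfun.RGenOpens.G R)); first exact: measurable_realfun.RGenOpens.measurableE.
move=> _ [U [a [b ->]] <-]; apply: H; exact: interval_open.
Qed.

Lemma continuous_rV_measurable n (f : 'rV[R]_n -> R) (D : set 'rV[R]_n) :
  measurable D -> continuous f -> measurable_fun D (f : 'rV[R]_n -> T).
Proof.
move=> mD cf; apply: measurable_to_R => U oU; apply: measurableI => //.
by apply: rV_open_measurable; apply: open_comp => // x _; exact: cf.
Qed.

Lemma ratr_close (x e : R) : 0 < e -> exists q : rat, `|x - ratr q| < e.
Proof.
move=> e0; have [] := @dense_rat R (ball x e).
- by exists x; exact: ballxx.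
- exact: ball_open.
- by move=> y [+ [q _ qy]]; rewrite -qy => xq; exists q.
Qed.

Lemma ratr_rV_close n (x : 'rV[R]_n) (e : R) : 0 < e ->
  exists q : 'rV[rat]_n, forall j, `|x 0 j - ratr (q 0 j)| < e.
Proof.
move=> e0; have /choice[f Hf] j := ratr_close (x 0 j) e0.
by exists (\row_j f j) => j; rewrite mxE.
Qed.

(** The product sigma-algebra is not presented by open sets, so P is written as a countable union of
    boxes with rational centre and radius 1/(k+1). A box that leaves P is replaced by the empty
    set. *)
Lemma open_prod_measurable m (P : set (T * 'rV[R]_m)) :
  (forall z, P z -> exists2 e : R, 0 < e &
     forall w : T * 'rV[R]_m, `|z.1 - w.1| < e -> (forall j, `|z.2 0 j - w.2 0 j| < e) -> P w) ->
  measurable P.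
Proof.
move=> HP.
pose r (k : nat) : R := k.+1%:R^-1.
pose box (q : rat * 'rV[rat]_m * nat) : set (T * 'rV[R]_m) :=
  [set x : R | `|ratr q.1.1 - x| < r q.2] `*`
  [set y : 'rV[R]_m | forall j, `|ratr (q.1.2 0 j) - y 0 j| < r q.2].
pose F q := if `[< box q `<=` P >] then box q else set0.
have -> : P = \bigcup_q F q.
  apply/seteqP; split=> [z Pz|z [q _]]; last first.
    by rewrite /F; case: asboolP => // + bz; apply.
  have [e e0 He] := HP z Pz.
  have [k kE] : exists k, r k < e / 2.
    have /cvgrPdist_lt/(_ (e / 2))[|k _ /(_ k (leqnn k))] := @cvg_harmonic R.
      by rewrite divr_gt0.
    by rewrite sub0r normrN ger0_norm ?harmonic_ge0 // => ?; exists k.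
  have rk : 0 < r k by rewrite invr_gt0.
  have [q1 Hq1] := ratr_close z.1 rk.
  have [q2 Hq2] := ratr_rV_close z.2 rk.
  exists (q1, q2, k) => //; rewrite /F; case: asboolP => [_|[]].
    by split=> /= [|j]; rewrite distrC.
  move=> w [/= w1 w2]; apply: He => [|j].
    rewrite (_ : z.1 - w.1 = (z.1 - ratr q1) + (ratr q1 - w.1)); last by rewrite addrA subrK.
    by apply: (le_lt_trans (ler_normD _ _)); rewrite (splitr e) ltrD // (lt_trans _ kE).
  rewrite (_ : z.2 0 j - w.2 0 j = (z.2 0 j - ratr (q2 0 j)) + (ratr (q2 0 j) - w.2 0 j)); last by rewrite addrA subrK.
  by apply: (le_lt_trans (ler_normD _ _)); rewrite (splitr e) ltrD // (lt_trans _ kE).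
apply: countable_bigcupT_measurable; first exact: countableP.
move=> q; rewrite /F; case: asboolP => // _; apply: measurableX.
  have := @measurable_itv R `](ratr q.1.1 - r q.2), (ratr q.1.1 + r q.2)[.
  congr measurable; apply/seteqP; split=> x /=.
    by rewrite in_itv /= ltr_norml => /andP[? ?]; apply/andP; lra.
  by rewrite in_itv /= ltr_norml => /andP[? ?]; apply/andP; lra.
rewrite (_ : [set y : 'rV[R]_m | _] = \bigcap_(j in [set: 'I_m]) [set y : 'rV[R]_m | `|ratr (q.1.2 0 j) - y 0 j| < r q.2]); last first.
  by apply/seteqP; split=> y /= H j => [_|]; apply: H.
apply: fin_bigcap_measurable => // j _; apply: rV_open_measurable.
apply: (@open_comp _ _ (fun y : 'rV[R]_m => `|ratr (q.1.2 0 j) - y 0 j|) [set x | x < r q.2]).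
  by move=> y _; apply: (cvg_norm (cvgB (cvg_cst _) (coord_continuous (i := 0) (j := j) (x := y)))).
exact: open_lt.
Qed.

Lemma rV_cvg (X : topologicalType) (F : set_system X) n (f : X -> 'rV[R]_n) (l : 'rV[R]_n) :
  Filter F -> (forall j, (fun x => f x 0 j) @ F --> l 0 j) -> f @ F --> l.
Proof.
move=> FF H; apply/cvgrPdist_lt => e e0.
have : \forall x \near F, forall j, `|l 0 j - f x 0 j| < e.
  apply: filter_forall => j; by have /cvgrPdist_lt := H j; apply.
apply: filterS => x Hx; rewrite /Num.Def.normr /= mx_normrE.
by apply: bigmax_lt => // -[i j] _; rewrite !mxE ord1.
Qed.

Lemma rV_continuous (X : topologicalType) n (f : X -> 'rV[R]_n) :
  (forall j, continuous (fun x => f x 0 j)) -> continuous f.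
Proof. by move=> H x; apply: rV_cvg => j; exact: H. Qed.

Lemma open_prod_measurable' m (P : set (R * 'rV[R]_m)) : open P ->
  measurable (P : set (T * 'rV[R]_m)).
Proof.
move=> oP; apply: open_prod_measurable => z Pz.
have /nbhs_ballP[e /= e0 He] : nbhs (z : R * 'rV[R]_m) P by exact: open_nbhs_nbhs.
exists e => // w w1 w2; apply: He; split => //=.
by split=> // i j; rewrite ord1; exact: w2.
Qed.

Lemma continuous_prod_measurable m k (f : R * 'rV[R]_m -> 'rV[R]_k) :
  continuous f -> measurable_fun [set: T * 'rV[R]_m] f.
Proof.
move=> cf; apply: (@measurability _ _ _ 'rV[R]_k _ _ (@open 'rV[R]_k)) => //.
move=> _ [U oU <-]; rewrite setTI; apply: open_prod_measurable'.
by apply: open_comp => // z _; exact: cf.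
Qed.

Lemma continuous_prod_measurable_R m (f : R * 'rV[R]_m -> R) :
  continuous f -> measurable_fun [set: T * 'rV[R]_m] (f : T * 'rV[R]_m -> T).
Proof.
move=> cf; apply: measurable_to_R => U oU; rewrite setTI; apply: open_prod_measurable'.
by apply: open_comp => // z _; exact: cf.
Qed.
End RowMeasurability.

(** * Lebesgue measure on rows *)

Section RowProduct.
Context {R : realType} {m : nat}.
Local Notation T := (measurableTypeR R).

Definition rowc (z : T * 'rV[R]_m) : 'rV[R]_m.+1 := row_mx (const_mx z.1 : 'rV[R]_1) z.2.
Definition unrow (x : 'rV[R]_m.+1) : T * 'rV[R]_m :=
  (x 0 0, \row_j x 0 (lift ord0 j)).

Lemma rowc0 z : rowc z 0 0 = z.1.
Proof.
rewrite /rowc (_ : (0 : 'I_m.+1) = lshift m (0 : 'I_1)); last exact/val_inj.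
by refine (Logic.eq_trans (row_mxEl _ _ _ _) _); rewrite mxE.
Qed.

Lemma rowcS z j : rowc z 0 (lift ord0 j) = z.2 0 j.
Proof.
rewrite /rowc (_ : lift ord0 j = rshift 1 j); last exact/val_inj.
exact: row_mxEr.
Qed.

Lemma rowcK : cancel rowc unrow.
Proof.
move=> [s y]; congr (_, _); first exact: rowc0.
by apply/rowP => j; rewrite mxE rowcS.
Qed.

Lemma rowc_continuous : continuous (rowc : R * 'rV[R]_m -> 'rV[R]_m.+1).
Proof.
apply: rV_continuous => j; case: (unliftP ord0 j) => [k ->|->].
  under eq_fun do rewrite rowcS.
  move=> z; apply: (@continuous_comp _ _ _ snd (fun y : 'rV[R]_m => y 0 k)).
    exact: cvg_snd.
  exact: coord_continuous.
by under eq_fun do rewrite rowc0; move=> z; exact: cvg_fst.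
Qed.

Lemma rowc_measurable : measurable_fun [set: T * 'rV[R]_m] rowc.
Proof. exact: continuous_prod_measurable rowc_continuous. Qed.

Lemma unrow_measurable : measurable_fun [set: 'rV[R]_m.+1] unrow.
Proof.
apply: measurable_fun_pair.
  by apply: continuous_rV_measurable => // x; exact: coord_continuous.
apply: (@measurability _ _ _ 'rV[R]_m _ _ (@open 'rV[R]_m)) => //.
move=> _ [U oU <-]; rewrite setTI; apply: rV_open_measurable.
have cf : continuous (fun x : 'rV[R]_m.+1 => (\row_j x 0 (lift ord0 j) : 'rV[R]_m)).
  apply: rV_continuous => j; under eq_fun do rewrite mxE.
  by move=> x; exact: coord_continuous.
by apply: open_comp => // x _; exact: cf.
Qed.

Variable mu : {sigma_finite_measure set 'rV[R]_m -> \bar R}.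

Definition rowprod : set 'rV[R]_m.+1 -> \bar R :=
  pushforward (lebesgue_measure \x mu)%E rowc.

HB.instance Definition _ := isMeasurableFun.Build _ _ _ _ rowc rowc_measurable.
Let rowprod0 : rowprod set0 = 0%E.
Proof. by rewrite /rowprod /pushforward preimage_set0 measure0. Qed.
Let rowprod_ge0 A : (0 <= rowprod A)%E.
Proof. exact: measure_ge0. Qed.
Let rowprod_additive : semi_sigma_additive rowprod.
Proof.
exact: (measure_semi_sigma_additive (s := pushforward (lebesgue_measure \x mu)%E (rowc : {mfun _ >-> _}))).
Qed.
HB.instance Definition _ := isMeasure.Build _ _ _ rowprod
  rowprod0 rowprod_ge0 rowprod_additive.

Lemma rowprod_sigma_finite : sigma_finite setT rowprod.
Proof.
have /sigma_finiteP[F [TF ndF Foo]] := sigma_finiteT (@lebesgue_measure R).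
have /sigma_finiteP[G [TG ndG Goo]] := sigma_finiteT mu.
exists (fun k => unrow @^-1` (F k `*` G k)).
  apply/seteqP; split=> // x _.
  have [k _ Fk] : (\bigcup_i F i) (unrow x).1 by rewrite -TF.
  have [l _ Gl] : (\bigcup_i G i) (unrow x).2 by rewrite -TG.
  exists (maxn k l) => //; split.
    by move: Fk; exact/subsetPset/ndF/leq_maxl.
  by move: Gl; exact/subsetPset/ndG/leq_maxr.
move=> k; have [mF fF] := Foo k; have [mG fG] := Goo k; split.
  rewrite -[X in measurable X]setTI; apply: unrow_measurable => //.
  exact: measurableX.
rewrite /rowprod /pushforward (_ : rowc @^-1` _ = F k `*` G k).
  by rewrite product_measure1E// lte_mul_pinfty// ge0_fin_numE.
by apply/seteqP; split=> z; rewrite /preimage /mkset rowcK.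
Qed.
HB.instance Definition _ := Measure_isSigmaFinite.Build _ _ _ rowprod rowprod_sigma_finite.
End RowProduct.

Section LebesgueRow.
Context {R : realType}.
Local Notation T := (measurableTypeR R).

(** [lebesgue_rV] is a bare set function. The induction carries sigma-finiteness because the next
    product measure is built on it. *)
Lemma lebesgue_rV_ex n : exists mu : {sigma_finite_measure set 'rV[R]_n -> \bar R},
  @lebesgue_rV R n = mu.
Proof.
elim: n => [|n [mu IH]].
  by exists (\d_(0%R : 'rV[R]_0))%E.
by exists (rowprod mu); rewrite /= IH.
Qed.

Definition leb n : {sigma_finite_measure set 'rV[R]_n -> \bar R} :=
  projT1 (cid (lebesgue_rV_ex n)).

Lemma lebE n : @lebesgue_rV R n = leb n.
Proof. exact: projT2 (cid (lebesgue_rV_ex n)). Qed.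

Lemma lebS n : leb n.+1 = rowprod (leb n) :> (set _ -> \bar R).
Proof. by rewrite -lebE /= lebE. Qed.

Lemma leb0 A : leb 0 A = (\d_(0%R : 'rV[R]_0) A)%E.
Proof. by rewrite -lebE. Qed.

Definition cube n (M : R) : set 'rV[R]_n := [set x | forall j, `|x 0 j| <= M].

Lemma cube_measurable n M : measurable (@cube n M).
Proof.
rewrite (_ : cube M = \bigcap_(j in [set: 'I_n]) [set y : 'rV[R]_n | `|y 0 j| <= M]); last first.
  by apply/seteqP; split=> y /= H j => [_|]; apply: H.
apply: fin_bigcap_measurable => // j _; apply: rV_closed_measurable.
apply: (@closed_comp _ _ (fun y : 'rV[R]_n => `|y 0 j|) [set x | x <= M]).
  move=> y _; exact: (cvg_norm (coord_continuous (i := 0) (j := j) (x := y))).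
exact: closed_le.
Qed.

Lemma leb_cube n M : (leb n (@cube n M) < +oo)%E.
Proof.
elim: n => [|n IH]; first by rewrite leb0 diracE ltry.
rewrite lebS /rowprod /pushforward (_ : _ @^-1` _ = [set` `[- M, M]] `*` @cube n M); last first.
  apply/seteqP; split=> -[s y] /=.
    move=> H; split; last by move=> j; have := H (lift ord0 j); rewrite rowcS.
    by have := H 0; rewrite rowc0 /= in_itv /= ler_norml.
  rewrite in_itv /= -ler_norml => -[sM yM] j; case: (unliftP ord0 j) => [k ->|->].
    by rewrite rowcS; exact: yM.
  by rewrite rowc0.
rewrite product_measure1E //; last exact: cube_measurable.
apply: lte_mul_pinfty => //.
have : @lebesgue_measure R [set` `[- M, M]] \is a fin_num.
  by rewrite lebesgue_measure_itv /=; case: ifP => // _; rewrite -EFinD.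
exact.
Qed.
End LebesgueRow.

(** * Integrands of bounded support, Fubini and the fundamental theorem of calculus *)

Section BoundedSupport.
Context {R : realType}.
Local Notation T := (measurableTypeR R).
Local Notation l1 := (@lebesgue_measure R).

(* Bounded, measurable and of bounded support, on R, R^n and R * R^n; this makes
   every integral below finite. *)
Definition bbR (f : T -> R) : Prop := measurable_fun [set: T] f /\
  exists C M, forall s, `|f s| <= C /\ (f s != 0 -> `|s| <= M).
Definition bb n (F : 'rV[R]_n -> R) : Prop := measurable_fun setT F /\
  exists C M, forall x, `|F x| <= C /\ (F x != 0 -> cube M x).
Definition bbp n (H : T * 'rV[R]_n -> R) : Prop := measurable_fun setT H /\
  exists C M, forall z, `|H z| <= C /\ (H z != 0 -> `|z.1| <= M /\ cube M z.2).

Lemma integrable_bounded_support d (X : measurableType d) (mu : {measure set X -> \bar R})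
    (f : X -> R) (A : set X) (C : R) :
  measurable A -> (mu A < +oo)%E -> measurable_fun setT f ->
  (forall x, `|f x| <= C) -> (forall x, f x != 0 -> A x) ->
  mu.-integrable setT (EFin \o f).
Proof.
move=> mA fA mf fC f0.
have : mu.-integrable A (EFin \o f).
  apply: measurable_bounded_integrable => //; first exact: measurable_funTS.
  by exists C; split; [rewrite num_real|move=> x Cx y _; exact: le_trans (ltW Cx)].
rewrite integrable_mkcond // (_ : _ \_ A = EFin \o f) //.
apply/funext => x; rewrite patchE; case: ifPn => //.
rewrite notin_setE => nA; apply/eqP; rewrite eq_sym; apply/eqP.
by congr EFin; apply/eqP; apply: contra_notT nA; exact: f0.
Qed.

Lemma bb_integrable n (F : 'rV[R]_n -> R) : bb F -> (leb n).-integrable setT (EFin \o F).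
Proof.
move=> [mF [C [M H]]].
apply: (@integrable_bounded_support _ _ (leb n) F (cube M) C) => //.
- exact: cube_measurable.
- exact: leb_cube.
- by move=> x; have [] := H x.
- by move=> x; have [] := H x.
Qed.

Definition lprod n : {measure set (T * 'rV[R]_n) -> \bar R} := (l1 \x leb n)%E.

Lemma itv_fin_measure (M : R) : (l1 [set s : R | (`|s| <= M)%R] < +oo)%E.
Proof.
rewrite (_ : [set s : R | _] = [set` `[- M, M]]).
  by rewrite lebesgue_measure_itv /=; case: ifP => // _; rewrite -EFinD ltry.
by apply/seteqP; split=> s /=; rewrite in_itv /= ler_norml.
Qed.

Lemma itv_norm_measurable (M : R) : measurable ([set s : R | `|s| <= M] : set T).
Proof.
rewrite (_ : [set s : R | _] = [set` `[- M, M]]); first exact: measurable_itv.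
by apply/seteqP; split=> s /=; rewrite in_itv /= ler_norml.
Qed.

Lemma bbR_integrable (f : T -> R) : bbR f -> l1.-integrable setT (EFin \o f).
Proof.
move=> [mf [C [M H]]].
apply: (@integrable_bounded_support _ _ l1 f [set s : R | `|s| <= M] C) => //.
- exact: itv_norm_measurable.
- exact: itv_fin_measure.
- by move=> x; have [] := H x.
- by move=> x; have [] := H x.
Qed.

Lemma box_fin_measure n M :
  ((l1 \x leb n) ([set s : R | (`|s| <= M)%R] `*` @cube R n M) < +oo)%E.
Proof.
rewrite product_measure1E //; [|exact: itv_norm_measurable|exact: cube_measurable].
apply: lte_mul_pinfty => //; last exact: leb_cube.
by rewrite ge0_fin_numE // itv_fin_measure.
Qed.

Lemma bbp_integrable n (H : T * 'rV[R]_n -> R) : bbp H ->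
  (lprod n).-integrable setT (EFin \o H).
Proof.
move=> [mH [C [M HH]]].
apply: (@integrable_bounded_support _ _ (lprod n) H
  ([set s : R | `|s| <= M] `*` @cube R n M) C) => //.
- by apply: measurableX; [exact: itv_norm_measurable|exact: cube_measurable].
- exact: box_fin_measure.
- by move=> z; have [] := HH z.
- by move=> z; have [_ +] := HH z => /[apply].
Qed.

Lemma bbp_slice1 n (H : T * 'rV[R]_n -> R) s : bbp H -> bb (fun y => H (s, y)).
Proof.
move=> [mH [C [M HH]]]; split; first exact: measurable_fun_pair2.
by exists C, M => y; have [? h] := HH (s, y); split=> // /h[].
Qed.

Lemma bbp_slice2 n (H : T * 'rV[R]_n -> R) y : bbp H -> bbR (fun s => H (s, y)).
Proof.
move=> [mH [C [M HH]]]; split; first exact: measurable_fun_pair1.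
by exists C, M => s; have [? h] := HH (s, y); split=> // /h[].
Qed.

Lemma bbp_fubini1 n (H : T * 'rV[R]_n -> R) : bbp H ->
  \int[lprod n]_z H z = \int[l1]_s (\int[leb n]_y H (s, y)).
Proof.
move=> bH; rewrite /Rintegral -(integral12_prod_meas1 (bbp_integrable bH)).
congr fine; apply: eq_integral => s _; rewrite fineK //.
exact: (integrable_fin_num measurableT (bb_integrable (bbp_slice1 s bH))).
Qed.

Lemma bbp_fubini2 n (H : T * 'rV[R]_n -> R) : bbp H ->
  \int[lprod n]_z H z = \int[leb n]_y (\int[l1]_s H (s, y)).
Proof.
move=> bH; rewrite /Rintegral -(integral21_prod_meas1 (bbp_integrable bH)).
congr fine; apply: eq_integral => y _; rewrite fineK //.
exact: (integrable_fin_num measurableT (bbR_integrable (bbp_slice2 y bH))).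
Qed.

Lemma bb_rowc n (F : 'rV[R]_n.+1 -> R) : bb F -> bbp (F \o @rowc R n).
Proof.
move=> [mF [C [M H]]]; split; first exact: measurableT_comp mF (@rowc_measurable R n).
exists C, M => z; have [? h] := H (rowc z); split=> // /h zM; split.
  by have := zM 0; rewrite rowc0.
by move=> j; have := zM (lift ord0 j); rewrite rowcS.
Qed.

Lemma bb_prod n (F : 'rV[R]_n.+1 -> R) : bb F ->
  \int[leb n.+1]_x F x = \int[lprod n]_z F (rowc z).
Proof.
move=> bF; rewrite /Rintegral; congr fine.
rewrite (@eq_measure_integral _ _ _ setT (pushforward (lprod n) (@rowc R n : {mfun _ >-> _}))); last first.
  by move=> A _ _; exact: (congr1 (fun m => m A) (lebS n)).
have bH := bb_rowc bF; have [mF _] := bF.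
rewrite (@integral_pushforward _ _ _ _ _ (@rowc R n) (@rowc_measurable R n)
   (lprod n) setT (EFin \o F)) //; first exact/measurable_realfun.measurable_EFinP.
exact: bbp_integrable.
Qed.

Lemma RintegralT_eq0 d (X : measurableType d) (mu : {measure set X -> \bar R}) (f : X -> R) :
  (forall x, f x = 0) -> \int[mu]_x f x = 0.
Proof.
move=> f0; rewrite /Rintegral (eq_integral (fun=> 0%E)) ?integral0 //.
by move=> x _; rewrite f0.
Qed.

Lemma integral_derive_compact (f df : R -> R) M :
  (forall s : R, is_derive s (1 : R) f (df s)) -> continuous df ->
  (forall s, f s != 0 -> `|s| <= M) -> (forall s, df s != 0 -> `|s| <= M) ->
  \int[l1]_s df s = 0.
Proof.
move=> fd cdf f0 df0.
(* Positive and strictly larger than M, so that f vanishes at both ends of [-N, N]. *)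
pose N := `|M| + 1.
have MN : M < N by rewrite (le_lt_trans (ler_norm M)) // ltrDl.
have N0 : 0 < N by rewrite ltr_wpDl.
have cf : continuous f.
  by move=> s; apply: differentiable_continuous; apply/derivable1_diffP; have [] := fd s.
have fN s : N <= `|s| -> f s = 0.
  by move=> Ns; apply/eqP; apply: contraTT Ns => /f0 sM; rewrite -ltNge (le_lt_trans sM).
rewrite (_ : \int[l1]_s df s = \int[l1]_(s in `[- N, N]) df s); last first.
  rewrite [RHS]Rintegral_mkcond; apply: eq_Rintegral => s _; rewrite patchE.
  case: ifPn => //; rewrite notin_setE /= => /negP; rewrite in_itv /= -ler_norml => Ns.
  by apply/eqP; apply: contraNT Ns => /df0 sM; rewrite (le_trans sM) // ltW.
rewrite /Rintegral (@continuous_FTC2 _ df f).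
- have fN1 : f N = 0 by apply: fN; rewrite ger0_norm // ltW.
  have fN2 : f (- N) = 0 by apply: fN; rewrite normrN ger0_norm // ltW.
  by rewrite fN1 fN2 subee.
- by rewrite (lt_trans _ N0) // oppr_lt0.
- exact: continuous_subspaceT.
- split=> [s _||]; first by have [] := fd s.
  + by apply: cvg_at_right_filter; exact: cf.
  + by apply: cvg_at_left_filter; exact: cf.
- by move=> s _; rewrite derive1E; have [] := fd s.
Qed.

End BoundedSupport.

(** * Integrals of compactly supported partial derivatives *)

Section RowIntegrals.
Context {R : realType}.
Local Notation T := (measurableTypeR R).
Local Notation l1 := (@lebesgue_measure R).
Local Notation e_ j := (delta_mx ord0 j).

Lemma cube_closed n M : closed (@cube R n M).
Proof.
rewrite (_ : cube M = \bigcap_(j in [set: 'I_n]) [set y : 'rV[R]_n | `|y 0 j| <= M]); last first.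
  by apply/seteqP; split=> y /= H j => [_|]; apply: H.
apply: closed_bigI => j _.
apply: (@closed_comp _ _ (fun y : 'rV[R]_n => `|y 0 j|) [set x | x <= M]).
  move=> y _; exact: (cvg_norm (coord_continuous (i := 0) (j := j) (x := y))).
exact: closed_le.
Qed.

Lemma cube_compact n M : compact (@cube R n M).
Proof.
apply: bounded_closed_compact; last exact: cube_closed.
exists `|M|; split; first by rewrite num_real.
move=> x Mx y yM; rewrite /Num.Def.normr /= mx_normrE.
apply: bigmax_le => [|[i j] _]; first by rewrite (le_trans _ (ltW Mx)).
by rewrite /= ord1 (le_trans (yM j)) // (le_trans (ler_norm M)) // ltW.
Qed.

Lemma cube_bounded n M (F : 'rV[R]_n -> R) : continuous F ->
  exists C, forall x, cube M x -> `|F x| <= C.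
Proof.
move=> cF; have : bounded_set (F @` @cube R n M).
  by apply: compact_bounded; apply: continuous_compact (@cube_compact n M); apply: continuous_subspaceT.
move=> [C [_ HC]]; exists (C + 1) => x xM.
by apply: (HC (C + 1)); [rewrite ltrDl|exists x].
Qed.

Lemma continuous_bb n M (F : 'rV[R]_n -> R) : continuous F ->
  (forall x, F x != 0 -> cube M x) -> bb F.
Proof.
move=> cF FM; split; first exact: continuous_rV_measurable.
have [C HC] := cube_bounded M cF.
exists `|C|, M => x; split; last exact: FM.
have [->|/FM/HC/le_trans] := eqVneq (F x) 0; first by rewrite normr0.
by apply; rewrite ler_norm.
Qed.

Lemma derive_supp n M (F : 'rV[R]_n -> R) v : (forall x, F x != 0 -> cube M x) ->
  forall x, 'D_v F x != 0 -> cube M x.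
Proof.
move=> FM x; apply: contra_neqP => nM.
have H : \forall y \near x, F y = (fun=> 0) y.
  have oM : open (~` @cube R n M) by apply: closed_openC; exact: cube_closed.
  near=> y; apply/eqP; apply: contra_notT (nM) => /FM yM.
  have : (~` @cube R n M) y by near: y; exact: open_nbhs_nbhs.
  by move=> /(_ yM).
by rewrite (near_eq_derive _ H) derive_cst.
Unshelve. all: by end_near. Qed.

Lemma rvD n (u v : 'rV[R]_n) j : (u + v) 0 j = u 0 j + v 0 j.
Proof. by rewrite mxE. Qed.

Lemma rvZ n (a : R) (u : 'rV[R]_n) j : (a *: u) 0 j = a * u 0 j.
Proof. by rewrite mxE. Qed.

Lemma derive_rowc n (F : 'rV[R]_n.+1 -> R) (s : R) (y v : 'rV[R]_n) :
  derivable F (rowc (s, y)) (rowc (0, v)) ->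
  derivable (fun z => F (rowc (s, z))) y v /\
  'D_v (fun z => F (rowc (s, z))) y = 'D_(rowc (0, v)) F (rowc (s, y)).
Proof.
have E : (fun h : R => h^-1 *: (F (rowc (s, h *: v + y)) - F (rowc (s, y))))
    = (fun h : R => h^-1 *: (F (h *: rowc (0, v) + rowc (s, y)) - F (rowc (s, y)))).
  apply/funext => h; congr (_ *: (F _ - _)); apply/rowP => j.
  case: (unliftP ord0 j) => [k ->|->]; rewrite rvD rvZ.
    by rewrite !rowcS rvD rvZ.
  by rewrite !rowc0 /= mulr0 add0r.
by move=> d; split; [rewrite /derivable /= E|rewrite /derive /= E].
Qed.

Lemma rowc_deltaS n (j : 'I_n) : rowc (0, e_ j) = e_ (lift ord0 j) :> 'rV[R]_n.+1.
Proof.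
apply/rowP => k; case: (unliftP ord0 k) => [l ->|->].
  by rewrite rowcS !mxE (inj_eq (@lift_inj _ _)).
by rewrite rowc0 !mxE (negPf (neq_lift _ _)) andbF.
Qed.

(** The measure splits off coordinate 0. A derivative in a later coordinate acts on the slices,
    where the induction hypothesis applies; one in coordinate 0 is integrated first along lines. *)
Lemma integral_partial n (j : 'I_n) (F : 'rV[R]_n -> R) M :
  continuous F -> (forall x, derivable F x (e_ j)) -> continuous ('D_(e_ j) F) ->
  (forall x, F x != 0 -> cube M x) ->
  \int[leb n]_x 'D_(e_ j) F x = 0.
Proof.
elim: n j F => [[]//|n IH] j F cF dF cdF FM.
have dM := derive_supp (v := e_ j) FM.
have bD := continuous_bb cdF dM.
rewrite bb_prod //; case: (unliftP ord0 j) => [k jk|j0].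
  rewrite (bbp_fubini1 (bb_rowc bD)); apply: RintegralT_eq0 => s /=.
  have dk y : derivable (fun z => F (rowc (s, z))) y (e_ k) /\
      'D_(e_ k) (fun z => F (rowc (s, z))) y = 'D_(e_ j) F (rowc (s, y)).
    by rewrite jk -rowc_deltaS; apply: derive_rowc; rewrite rowc_deltaS -jk.
  have E : (fun y => 'D_(e_ j) F (rowc (s, y))) = 'D_(e_ k) (fun z => F (rowc (s, z))).
    by apply/funext => y; rewrite (dk y).2.
  have crow : continuous (fun y : 'rV[R]_n => rowc (s, y)).
    apply: rV_continuous => l; case: (unliftP ord0 l) => [l' ->|->].
      by under eq_fun do rewrite rowcS; move=> y; exact: coord_continuous.
    by under eq_fun do rewrite rowc0; move=> y; exact: cst_continuous.
  rewrite E; apply: IH.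
  - by move=> y; apply: (@continuous_comp _ _ _ (fun y => rowc (s, y)) F); [exact: crow|exact: cF].
  - by move=> y; have [] := dk y.
  - rewrite -E => y; apply: (@continuous_comp _ _ _ (fun y => rowc (s, y)) ('D_(e_ j) F)); [exact: crow|exact: cdF].
  - by move=> y /FM yM l; have := yM (lift ord0 l); rewrite rowcS.
rewrite (bbp_fubini2 (bb_rowc bD)); apply: RintegralT_eq0 => y /=.
have [x0 row_line] : exists x0, forall s, rowc (s, y) = x0 + s *: e_ ord0.
  exists (rowc (0, y)) => s; apply/rowP => k; case: (unliftP ord0 k) => [l ->|->].
    rewrite rvD rvZ !rowcS mxE.
    by rewrite [lift _ _ == _]eq_sym (negPf (neq_lift _ _)) andbF mulr0 addr0.
  by rewrite rvD rvZ !rowc0 mxE !eqxx mulr1 add0r.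
have cline : continuous (fun s : R => rowc (s, y)).
  apply: rV_continuous => l; case: (unliftP ord0 l) => [l' ->|->].
    by under eq_fun do rewrite rowcS; move=> s; exact: cst_continuous.
  by under eq_fun do rewrite rowc0; move=> s; exact: cvg_id.
apply: (@integral_derive_compact _ (fun s => F (rowc (s, y))) _ M).
- move=> s; under eq_fun do rewrite row_line.
  have dl : derivable F (x0 + s *: e_ ord0) (e_ ord0).
    by have := dF (rowc (s, y)); rewrite row_line j0.
  by rewrite row_line j0; exact: derive_line dl.
- move=> s; apply: (@continuous_comp _ _ _ (fun s : R => rowc (s, y)) ('D_(e_ j) F)); [exact: cline|exact: cdF].
- by move=> s /FM /(_ 0); rewrite rowc0.
- by move=> s /dM /(_ 0); rewrite rowc0.
Qed.
End RowIntegrals.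

(** * Invariance of the integral under shears and reordering of coordinates *)

Section ShearInsertion.
Context {R : realType}.
Local Notation T := (measurableTypeR R).
Local Notation l1 := (@lebesgue_measure R).

Lemma bbR_translate (f : T -> R) c : bbR f -> bbR (fun s => f (s + c)).
Proof.
move=> [mf [C [M H]]]; split.
  apply: (measurableT_comp mf); apply: measurable_realfun.continuous_measurable_fun.
  by move=> s; apply: cvgD; [exact: cvg_id|exact: cvg_cst].
exists C, (M + `|c|) => s; have [? h] := H (s + c); split=> // /h sM.
rewrite -[s](addrK c) (le_trans (ler_normB _ _)) // lerD2r //.
Qed.

Definition tshift (c : R) (s : T) : T := s + c.
Lemma tshift_measurable c : measurable_fun [set: T] (tshift c).
Proof.
apply: measurable_realfun.continuous_measurable_fun.
by move=> s; apply: cvgD; [exact: cvg_id|exact: cvg_cst].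
Qed.
HB.instance Definition _ c := isMeasurableFun.Build _ _ _ _ (tshift c) (tshift_measurable c).

Lemma lebesgue_translate c (A : set T) : measurable A ->
  l1 A = pushforward l1 (tshift c) A.
Proof.
apply: (@lebesgue_measure_unique R (pushforward l1 (tshift c : {mfun T >-> T}))).
move=> X /ocitvP[->|[[a b] /= ab ->]].
  by rewrite !measure0.
transitivity (l1 [set` `]a - c, b - c]%R]).
  rewrite !lebesgue_measure_itv /= !lte_fin ltrD2r; case: ifP => // _.
  by rewrite -!EFinD; congr EFin; ring.
apply: (congr1 l1).
by apply/seteqP; split=> s /=; rewrite /tshift !in_itv /= ltrBlDr lerBrDr.
Qed.

Lemma integral_translate (f : T -> R) c : bbR f ->
  \int[l1]_s f (s + c) = \int[l1]_s f s.
Proof.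
move=> bf; have [mf _] := bf.
rewrite /Rintegral; congr fine.
rewrite [RHS](@eq_measure_integral _ _ _ setT (pushforward l1 (tshift c : {mfun _ >-> _}))); last first.
  by move=> A mA _; exact: lebesgue_translate.
rewrite (@integral_pushforward _ _ _ _ _ (tshift c) (tshift_measurable c) l1 setT (EFin \o f)) //.
  exact/measurable_realfun.measurable_EFinP.
exact: (bbR_integrable (bbR_translate c bf)).
Qed.

(** One end lies outside the support and the other is 0: the half-line is the positive one for b
    false, contributing - f 0, and the negative one for b true, contributing f 0. *)
Lemma integral_half_line (b : bool) (f df : R -> R) M :
  (forall s : R, is_derive s (1 : R) f (df s)) -> continuous df ->
  (forall s, f s != 0 -> `|s| <= M) -> (forall s, df s != 0 -> `|s| <= M) ->
  \int[l1]_s (if 0 < (-1) ^+ b * s then df s else 0) = - (-1) ^+ b * f 0.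
Proof.
move=> fd cdf f0 df0.
pose N := `|M| + 1.
have MN : M < N by rewrite (le_lt_trans (ler_norm M)) // ltrDl.
have N0 : 0 < N by rewrite ltr_wpDl.
have cf : continuous f.
  by move=> s; apply: differentiable_continuous; apply/derivable1_diffP; have [] := fd s.
have fN s : N <= `|s| -> f s = 0.
  by move=> Ns; apply/eqP; apply: contraTT Ns => /f0 sM; rewrite -ltNge (le_lt_trans sM).
have dfN s : N < `|s| -> df s = 0.
  move=> Ns; apply/eqP; apply: contraTT Ns => /df0 sM.
  by rewrite -leNgt (le_trans sM) // ltW.
have fN1 : f N = 0 by apply: fN; rewrite ger0_norm // ltW.
have fN2 : f (- N) = 0 by apply: fN; rewrite normrN ger0_norm // ltW.
have FTC a c : a < c -> (\int[l1]_(s in `[a, c]) (df s)%:E = (f c)%:E - (f a)%:E)%E.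
  move=> ac; apply: continuous_FTC2 => //.
  - exact: continuous_subspaceT.
  - split=> [s _||]; first by have [] := fd s.
    + by apply: cvg_at_right_filter; exact: cf.
    + by apply: cvg_at_left_filter; exact: cf.
  - by move=> s _; rewrite derive1E; have [] := fd s.
have mdf : measurable_fun setT df by exact: measurable_realfun.continuous_measurable_fun.
case: b.
  rewrite expr1 opprK mul1r.
  transitivity (\int[l1]_(s in `[- N, 0[) df s).
    rewrite [RHS]Rintegral_mkcond; apply: eq_Rintegral => s _; rewrite patchE.
    rewrite mem_setE in_itv /= mulN1r oppr_gt0.
    case: ltP => s0; last by rewrite andbF.
    rewrite andbT; case: leP => // sN; apply: dfN.
    by rewrite ltr0_norm // ltrNr.
  transitivity (fine (\int[l1]_(s in `[- N, 0]) (df s)%:E)); last first.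
    by rewrite FTC ?oppr_lt0 // fN2 sube0.
  rewrite /Rintegral; congr fine; apply: integral_itv_bndo_bndc.
  by apply/measurable_realfun.measurable_EFinP; exact: measurable_funTS.
rewrite expr0 mulN1r.
transitivity (\int[l1]_(s in `]0, N]) df s).
  rewrite [RHS]Rintegral_mkcond; apply: eq_Rintegral => s _; rewrite patchE.
  rewrite mem_setE in_itv /= mul1r.
  case: ltP => s0 //=; case: leP => // sN; apply: dfN.
  by rewrite gtr0_norm.
transitivity (fine (\int[l1]_(s in `[0, N]) (df s)%:E)); last first.
  by rewrite FTC // fN1 sub0e.
rewrite /Rintegral; congr fine; apply: integral_itv_obnd_cbnd.
by apply/measurable_realfun.measurable_EFinP; exact: measurable_funTS.
Qed.

(** Inverse of x |-> (x_i, [col' i x]): it parametrizes R^(n+1) with coordinate i singled out. *)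
Definition ins n (i : 'I_n.+1) (z : R * 'rV[R]_n) : 'rV[R]_n.+1 :=
  \row_a (if unlift i a is Some j then z.2 0 j else z.1).

Lemma ins_i n (i : 'I_n.+1) z : ins i z 0 i = z.1.
Proof. by rewrite mxE unlift_none. Qed.
Lemma ins_lift n (i : 'I_n.+1) z j : ins i z 0 (lift i j) = z.2 0 j.
Proof. by rewrite mxE liftK. Qed.

Lemma ins_col' n (i : 'I_n.+1) (x : 'rV[R]_n.+1) : ins i (x 0 i, col' i x) = x.
Proof.
by apply/rowP => a; case: (unliftP i a) => [j ->|->]; rewrite ?ins_lift ?ins_i // mxE.
Qed.

Lemma col'_ins n (i : 'I_n.+1) z : col' i (ins i z) = z.2.
Proof. by apply/rowP => j; rewrite mxE ins_lift. Qed.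

Lemma ins_continuous n (i : 'I_n.+1) : continuous (ins i).
Proof.
apply: rV_continuous => a; case: (unliftP i a) => [j ->|->].
  under eq_fun do rewrite ins_lift.
  move=> z; apply: (@continuous_comp _ _ _ snd (fun y : 'rV[R]_n => y 0 j)).
    exact: cvg_snd.
  exact: coord_continuous.
by under eq_fun do rewrite ins_i; move=> z; exact: cvg_fst.
Qed.

Lemma bb_ins n (i : 'I_n.+1) (F : 'rV[R]_n.+1 -> R) : bb F -> bbp (F \o ins i).
Proof.
move=> [mF [C [M H]]]; split.
  by apply: (measurableT_comp mF); exact: continuous_prod_measurable (@ins_continuous _ i).
exists C, M => z; have [? h] := H (ins i z); split=> // /h zM; split.
  by have := zM i; rewrite ins_i.
by move=> j; have := zM (lift i j); rewrite ins_lift.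
Qed.

Lemma ins_rowc n (i : 'I_n.+1) (s t : R) (y : 'rV[R]_n) :
  ins (lift ord0 i) (s, rowc (t, y)) = rowc (t, ins i (s, y)).
Proof.
apply/rowP => a; case: (unliftP ord0 a) => [c ->|->]; last first.
  rewrite rowc0 mxE; case: unliftP => [j|]; last by [].
  case: (unliftP ord0 j) => [l ->|->]; last by rewrite rowc0.
  by move/(congr1 val) => /=; rewrite /bump /=; case: ltngtP.
rewrite rowcS; case: (unliftP i c) => [j ->|->]; last by rewrite !ins_i.
rewrite ins_lift (_ : lift ord0 (lift i j) = lift (lift ord0 i) (lift ord0 j)).
  by rewrite ins_lift rowcS.
by apply: val_inj; rewrite /= /bump /= !add1n ltnS; case: leqP.
Qed.

Lemma ins0 n z : ins (ord0 : 'I_n.+1) z = rowc z.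
Proof.
apply/rowP => a; case: (unliftP ord0 a) => [j ->|->].
  by rewrite ins_lift rowcS.
by rewrite ins_i rowc0.
Qed.

(** Keeps the class [bb] stable under integrating out coordinate 0, as the induction in
    [integral_ins] requires. *)
Lemma bb_slice_integral n (F : 'rV[R]_n.+1 -> R) : bb F ->
  bb (fun y => \int[l1]_t F (rowc (t, y))).
Proof.
move=> bF; have bH := bb_rowc bF; split.
  have /= m := measurable_fubini_G (bbp_integrable bH).
  have mf : measurable_fun [set: \bar R] (@fine R) by exact: fine_measurable.
  exact: (measurableT_comp mf m).
have [_ [C [M H]]] := bF.
exists (C * fine (l1 [set s : R | (`|s| <= M)%R])), M => y; split; last first.
  apply: contra_neqP => nM; apply: RintegralT_eq0 => t.
  apply/eqP; apply: contra_notT nM; have [_ h] := H (rowc (t, y)) => /h tM j.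
  by have := tM (lift ord0 j); rewrite rowcS.
have bs := bbp_slice2 y bH.
apply: (le_trans (le_normr_Rintegral measurableT (bbR_integrable bs))).
have mB := itv_norm_measurable M.
rewrite -Rintegral_cst //.
rewrite (_ : \int[l1]_t `|F (rowc (t, y))| = \int[l1]_(t in [set s : R | `|s| <= M]) `|F (rowc (t, y))|); last first.
  rewrite [RHS]Rintegral_mkcond; apply: eq_Rintegral => t _; rewrite patchE.
  case: ifPn => //; rewrite notin_setE /= => tM; apply/eqP; rewrite normr_eq0.
  apply: contra_notT tM; have [_ h] := H (rowc (t, y)) => /h /(_ 0).
  by rewrite rowc0.
have [mf _] := bs.
apply: le_Rintegral => //.
- apply: (@integrableS _ _ _ _ setT) => //.
  exact: (integrable_norm (bbR_integrable bs)).
- apply: measurable_bounded_integrable => //; first exact: itv_fin_measure.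
  by exists `|C|; split; [rewrite num_real|move=> x Cx ? _; exact: ltW].
- by move=> t _; have [] := H (rowc (t, y)).
Qed.

(** The measure is defined by splitting off coordinate 0. For a later coordinate, Fubini puts
    coordinate 0 innermost, the induction hypothesis is applied to the resulting function of the
    tail, and the slices are then reassembled. *)
Lemma integral_ins n (i : 'I_n.+1) (F : 'rV[R]_n.+1 -> R) : bb F ->
  \int[leb n.+1]_x F x = \int[lprod n]_z F (ins i z).
Proof.
elim: n i F => [|n IH] i F bF.
  rewrite (ord1 i) bb_prod //; apply: eq_Rintegral => z _; rewrite -[RHS]/(F (ins ord0 z)).
  by rewrite ins0.
case: (unliftP ord0 i) => [i' ->|->]; last first.
  by rewrite bb_prod //; apply: eq_Rintegral => z _; rewrite ins0.
have bH := bb_rowc bF.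
rewrite bb_prod // (bbp_fubini2 bH).
have bF' := bb_slice_integral bF.
transitivity (\int[leb n.+1]_y (\int[l1]_t F (rowc (t, y)))).
  by [].
rewrite (IH i' _ bF') (bbp_fubini1 (bb_ins i' bF')).
rewrite (bbp_fubini1 (bb_ins _ bF)).
apply: eq_Rintegral => s _ /=.
have bG : bb (fun y => F (ins (lift ord0 i') (s, y))).
  exact: (bbp_slice1 s (bb_ins _ bF)).
rewrite (bb_prod bG) (bbp_fubini2 (bb_rowc bG)).
apply: eq_Rintegral => y _; apply: eq_Rintegral => t _ /=.
by rewrite ins_rowc.
Qed.

Lemma bbp_shear n (g : 'rV[R]_n -> R) (H : T * 'rV[R]_n -> R) : continuous g ->
  bbp H -> bbp (fun z => H (z.1 + g z.2, z.2)).
Proof.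
move=> cg [mH [C [M HH]]]; split.
  apply: (measurableT_comp mH); apply: measurable_fun_pair => //.
  apply: (@continuous_prod_measurable_R _ _ (fun z : R * 'rV[R]_n => z.1 + g z.2)).
  move=> z; apply: cvgD; first exact: cvg_fst.
  by apply: (@continuous_comp _ _ _ snd g); [exact: cvg_snd|exact: cg].
have [D HD] := cube_bounded M cg.
exists C, (Num.max M (M + D)) => z.
have [? h] := HH (z.1 + g z.2, z.2); split=> // /h[/= z1 z2]; split.
  rewrite le_max; apply/orP; right.
  by rewrite -[z.1](addrK (g z.2)) (le_trans (ler_normB _ _)) // lerD // HD.
by move=> j; rewrite le_max z2.
Qed.

(** On each line with fixed second component the shear is a translation. *)
Lemma integral_shear n (g : 'rV[R]_n -> R) (H : T * 'rV[R]_n -> R) : continuous g ->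
  bbp H -> \int[lprod n]_z H z = \int[lprod n]_z H (z.1 + g z.2, z.2).
Proof.
move=> cg bH; rewrite (bbp_fubini2 bH) (bbp_fubini2 (bbp_shear cg bH)).
apply: eq_Rintegral => y _ /=.
by rewrite (integral_translate (g y) (bbp_slice2 y bH)).
Qed.

End ShearInsertion.

(** * Chain rule along a graph and closure properties of the integrands *)

Section ChartDivergence.
Context {R : realType} {n : nat}.
Local Notation T := (measurableTypeR R).
Local Notation l1 := (@lebesgue_measure R).
Local Notation e_ j := (delta_mx ord0 j).

(** The regularity of test functions and cutoffs: a divergence theorem differentiates them once. *)
Definition C1f N (F : 'rV[R]_N -> R) : Prop :=
  (forall x, differentiable F x) /\ forall a, continuous ('D_(e_ a) F).

Lemma C1f_cont N (F : 'rV[R]_N -> R) : C1f F -> continuous F.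
Proof. by move=> [dF _] x; apply: differentiable_continuous. Qed.

Lemma smooth_C1f N (f : @smooth_fun R N) : C1f f.
Proof.
split; first exact: smooth_fun_diff.
by move=> a; exact: (smooth_fun_cont (f := spart a f)).
Qed.

Definition ins_lin (i : 'I_n.+1) (y : 'rV[R]_n) : 'rV[R]_n.+1 := ins i (0, y).
Lemma ins_lin_linear i : linear (ins_lin i).
Proof.
move=> c y z; apply/rowP => a; rewrite rvD rvZ.
case: (unliftP i a) => [j ->|->]; first by rewrite !ins_lift /= rvD rvZ.
by rewrite !ins_i mulr0 addr0.
Qed.
HB.instance Definition _ i :=
  GRing.isLinear.Build R 'rV[R]_n 'rV[R]_n.+1 _ (ins_lin i) (ins_lin_linear i).

Lemma ins_lin_continuous i : continuous (ins_lin i).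
Proof.
apply: rV_continuous => a; case: (unliftP i a) => [j ->|->].
  by under eq_fun do rewrite ins_lift; move=> y; exact: coord_continuous.
by under eq_fun do rewrite ins_i; move=> y; exact: cst_continuous.
Qed.

Lemma rv_delta N (i a : 'I_N) : (e_ i : 'rV[R]_N) 0 a = (a == i)%:R.
Proof. by rewrite mxE eqxx. Qed.

Lemma ins_split i (s : R) y : ins i (s, y) = ins_lin i y + s *: e_ i.
Proof.
apply/rowP => a; rewrite rvD rvZ rv_delta.
case: (unliftP i a) => [j ->|->]; rewrite ?ins_lift ?ins_i /=.
  by rewrite [lift _ _ == _]eq_sym (negPf (neq_lift _ _)) mulr0 addr0.
by rewrite eqxx mulr1 add0r.
Qed.

Lemma ins_delta i j : ins_lin i (e_ j) = e_ (lift i j).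
Proof.
apply/rowP => a; case: (unliftP i a) => [l ->|->].
  by rewrite ins_lift !mxE (inj_eq (@lift_inj _ _)).
by rewrite ins_i !mxE (negPf (neq_lift _ _)) andbF.
Qed.

Lemma graph_differentiable i (g : 'rV[R]_n -> R) y : differentiable g y ->
  differentiable (fun z => ins i (g z, z)) y /\
  forall v, 'D_v (fun z => ins i (g z, z)) y = ins i ('D_v g y, v).
Proof.
move=> dg.
have E : (fun z => ins i (g z, z)) = (fun z => ins_lin i z + g z *: e_ i).
  by apply/funext => z; rewrite ins_split.
have dl : differentiable (ins_lin i) y.
  by apply: linear_differentiable; exact: ins_lin_continuous.
have dz : differentiable (fun z => g z *: (e_ i : 'rV[R]_n.+1)) y.
  exact: differentiableZl.
have d : differentiable (fun z => ins_lin i z + g z *: (e_ i : 'rV[R]_n.+1)) y.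
  exact: differentiableD dl dz.
rewrite E; split=> // v.
rewrite deriveD; [|exact: diff_derivable|exact: diff_derivable].
rewrite ins_split; congr (_ + _).
  by have [_] := is_derive_linear (f := ins_lin i) y v (@ins_lin_continuous i).
by rewrite !deriveE // diffZl.
Qed.

Lemma chain_graph i (g : 'rV[R]_n -> R) (F : 'rV[R]_n.+1 -> R) y :
  differentiable g y -> differentiable F (ins i (g y, y)) ->
  differentiable (fun z => F (ins i (g z, z))) y /\
  forall j, 'D_(e_ j) (fun z => F (ins i (g z, z))) y =
    'D_(e_ (lift i j)) F (ins i (g y, y)) + 'D_(e_ j) g y * 'D_(e_ i) F (ins i (g y, y)).
Proof.
move=> dg dF; have [dG DG] := graph_differentiable i dg.
have dc := differentiable_comp dG dF; split; first exact: dc.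
move=> j.
have -> : 'D_(e_ j) (fun z => F (ins i (g z, z))) y = 'd F (ins i (g y, y)) (ins i ('D_(e_ j) g y, e_ j)).
  rewrite -DG (deriveE (e_ j) dG); apply: (Logic.eq_trans (deriveE (e_ j) dc)).
  by rewrite (diff_comp dG dF).
rewrite [ins i ('D_(e_ j) g y, e_ j)]ins_split ins_delta !deriveE //.
by rewrite linearD linearZ.
Qed.

Lemma bbp_if N (H : T * 'rV[R]_N -> R) (b : bool) :
  bbp H -> bbp (fun z => if 0 < (-1) ^+ b * z.1 then H z else 0).
Proof.
move=> [mH [C [M HH]]]; split.
  apply: measurable_fun_ifT => //.
  apply: measurable_fun_ltr => //; apply: measurable_funM => //.
exists C, M => z; have [h1 h2] := HH z; case: ifP => // _.
by rewrite normr0 eqxx; split=> //; exact: le_trans h1.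
Qed.

Lemma bbp_mul N (H : T * 'rV[R]_N -> R) (g : 'rV[R]_N -> R) : continuous g ->
  bbp H -> bbp (fun z => g z.2 * H z).
Proof.
move=> cg [mH [C [M HH]]]; split.
  apply: measurable_funM => //.
  apply: (@continuous_prod_measurable_R _ _ (fun z : R * 'rV[R]_N => g z.2)).
  by move=> z; apply: (@continuous_comp _ _ _ snd g); [exact: cvg_snd|exact: cg].
have [D HD] := cube_bounded M cg.
exists (`|D| * C), M => z; have [h1 h2] := HH z.
have C0 : 0 <= C by exact: le_trans h1.
have [->|Hz] := eqVneq (H z) 0.
  by rewrite mulr0 normr0 eqxx; split=> //; exact: mulr_ge0.
split; last by move=> _; exact: h2.
rewrite normrM ler_pM // (le_trans _ (ler_norm D)) //.
by apply: HD; have [] := h2 Hz.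
Qed.

Lemma bbp_add N (H K : T * 'rV[R]_N -> R) : bbp H -> bbp K -> bbp (fun z => H z + K z).
Proof.
move=> [mH [C [M HH]]] [mK [D [L KK]]]; split; first exact: measurable_funD.
exists (C + D), (Num.max M L) => z; have [h1 h2] := HH z; have [k1 k2] := KK z.
split; first by rewrite (le_trans (ler_normD _ _)) // lerD.
have [H0|/h2[a b] _] := eqVneq (H z) 0; last first.
  by split=> [|j]; rewrite le_max ?a ?b.
by rewrite H0 add0r => /k2[a b]; split=> [|j]; rewrite le_max ?a ?b orbT.
Qed.

Lemma bbp0 N : bbp (fun _ : T * 'rV[R]_N => 0).
Proof. by split; [exact: measurable_cst|exists 0, 0 => z; rewrite normr0 eqxx]. Qed.

Lemma bbp_sum N I (r : seq I) (H : I -> T * 'rV[R]_N -> R) :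
  (forall a, bbp (H a)) -> bbp (fun z => \sum_(a <- r) H a z).
Proof.
move=> bH; elim: r => [|a r IH].
  by under eq_fun do rewrite big_nil; exact: bbp0.
by under eq_fun do rewrite big_cons; exact: bbp_add.
Qed.

Lemma Rintegral_sum d (X : measurableType d) (mu : {measure set X -> \bar R}) D I (r : seq I)
    (f : I -> X -> R) : measurable D -> (forall a, mu.-integrable D (EFin \o f a)) ->
  \int[mu]_(x in D) (\sum_(a <- r) f a x) = \sum_(a <- r) \int[mu]_(x in D) f a x.
Proof.
move=> mD fi; elim: r => [|a r IH].
  rewrite big_nil; under eq_Rintegral do rewrite big_nil.
  by rewrite Rintegral_cst // mul0r.
rewrite big_cons -IH; under eq_Rintegral do rewrite big_cons.
apply: RintegralD => //.
have -> : EFin \o (fun x => \sum_(b <- r) f b x) = (fun x => \sum_(b <- r) (f b x)%:E)%E.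
  by apply/funext => x; rewrite /= sumEFin.
by apply: integrable_sum => // b _; exact: fi.
Qed.

End ChartDivergence.

Lemma continuous_sum (R : realType) (X : topologicalType) I (r : seq I) (f : I -> X -> R) :
  (forall a, continuous (f a)) -> continuous (fun x => \sum_(a <- r) f a x).
Proof.
move=> cf; elim: r => [|a r IH] x.
  by under eq_fun do rewrite big_nil; exact: cst_continuous.
under eq_fun do rewrite big_cons.
by apply: cvgD; [exact: cf|exact: IH].
Qed.

(** * Divergence theorem on one side of a graph *)

Section ChartDivergenceTheorem.
Context {R : realType} {n : nat}.
Local Notation T := (measurableTypeR R).
Local Notation l1 := (@lebesgue_measure R).
Local Notation e_ j := (delta_mx ord0 j).
Variables (i : 'I_n.+1) (b : bool) (g : @smooth_fun R n).

Lemma col'_continuous : continuous (col' i : 'rV[R]_n.+1 -> 'rV[R]_n).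
Proof.
apply: rV_continuous => j; under eq_fun do rewrite mxE.
by move=> x; exact: coord_continuous.
Qed.

Lemma side_continuous :
  continuous (fun x : 'rV[R]_n.+1 => (-1) ^+ b * (x 0 i - g (col' i x))).
Proof.
have c1 : continuous (fun x : 'rV[R]_n.+1 => g (col' i x)).
  move=> x; apply: (@continuous_comp _ _ _ (col' i) g).
    exact: col'_continuous.
  exact: smooth_fun_cont.
have c2 : continuous (fun x : 'rV[R]_n.+1 => x 0 i - g (col' i x)).
  move=> x; exact: (cvgB (@coord_continuous _ _ _ 0 i x) (c1 x)).
by move=> x; apply: (continuous_comp (c2 x)); exact: mulrl_continuous.
Qed.

Lemma cgrad_i y : cgrad i g 0 i y = 1.
Proof. by rewrite mxE eqxx /cpart unlift_none subr0. Qed.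

Lemma cgrad_lift j y : cgrad i g 0 (lift i j) y = - 'D_(e_ j) g y.
Proof.
by rewrite mxE eq_sym (negPf (neq_lift _ _)) sub0r /cpart liftK.
Qed.

(* The shear that maps the half-space 0 < z.1 onto one side of the graph. *)
Let Psi (z : R * 'rV[R]_n) := ins i (z.1 + g z.2, z.2).

Lemma shift_graph_smooth (s : R) : (forall y, differentiable (fun z => s + g z) y) /\
  forall y j, 'D_(e_ j) (fun z => s + g z) y = 'D_(e_ j) g y.
Proof.
have d y : differentiable (fun z => s + g z) y.
  by apply: differentiableD => //; exact: smooth_fun_diff.
split=> // y j; rewrite deriveD //; last by apply: diff_derivable; exact: smooth_fun_diff.
by rewrite derive_cst add0r.
Qed.

Lemma Psi_chain (F : 'rV[R]_n.+1 -> R) s y : differentiable F (Psi (s, y)) ->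
  differentiable (fun y => F (Psi (s, y))) y /\ forall j,
  'D_(e_ j) (fun y => F (Psi (s, y))) y =
    'D_(e_ (lift i j)) F (Psi (s, y)) + 'D_(e_ j) g y * 'D_(e_ i) F (Psi (s, y)).
Proof.
move=> dF; have [dg Dg] := shift_graph_smooth s.
have [d D] := @chain_graph _ _ i (fun z => s + g z) F y (dg y) dF.
by split; [exact: d|move=> j; rewrite -Dg; exact: D].
Qed.

Lemma Psi_continuous (X : topologicalType) (u : X -> R) (v : X -> 'rV[R]_n) :
  continuous u -> continuous v -> continuous (fun x => Psi (u x, v x)).
Proof.
move=> cu cv; apply: rV_continuous => a; case: (unliftP i a) => [j ->|->].
  under eq_fun do rewrite ins_lift.
  move=> x; apply: (@continuous_comp _ _ _ v (fun y : 'rV[R]_n => y 0 j)).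
    exact: cv.
  exact: coord_continuous.
under eq_fun do rewrite ins_i.
move=> x; apply: cvgD; first exact: cu.
by apply: (@continuous_comp _ _ _ v g); [exact: cv|exact: smooth_fun_cont].
Qed.

Lemma bbp_Psi (F : 'rV[R]_n.+1 -> R) : bb F -> bbp (fun z => F (Psi z)).
Proof. by move=> bF; exact: (bbp_shear (@smooth_fun_cont _ _ g) (bb_ins i bF)). Qed.

Lemma Psi_supp (F : 'rV[R]_n.+1 -> R) M s y : (forall x, F x != 0 -> cube M x) ->
  F (Psi (s, y)) != 0 -> `|s| <= M + `|g y| /\ cube M y.
Proof.
move=> FM /FM H; split; last by move=> j; have := H (lift i j); rewrite ins_lift.
have := H i; rewrite ins_i /= => sM.
by rewrite -[s](addrK (g y)) (le_trans (ler_normB _ _)) // lerD2r.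
Qed.

(** The shear turns the region into a half-space. The divergence is regrouped into total derivatives
    along the parameters, which integrate to 0 on each slice, and a derivative transversal to the
    graph, which is integrated over a half-line and leaves the boundary term. *)
Lemma chart_divergence (Z : 'I_n.+1 -> 'rV[R]_n.+1 -> R) M :
  (forall a, C1f (Z a)) -> (forall a x, Z a x != 0 -> cube M x) ->
  \int[leb n.+1]_x (if 0 < (-1) ^+ b * (x 0 i - g (col' i x))
                    then \sum_a 'D_(e_ a) (Z a) x else 0)
  = \int[leb n]_y (\sum_a (- (-1) ^+ b * cgrad i g 0 a y) * Z a (ins i (g y, y))).
Proof.
move=> CZ ZM.
have dZ a x : differentiable (Z a) x by have [] := CZ a.
have cZ a : continuous (Z a) by exact: C1f_cont.
have cDZ a c : continuous ('D_(e_ c) (Z a)) by have [] := CZ a.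
have bDZ a c : bb ('D_(e_ c) (Z a)).
  by apply: (continuous_bb (cDZ a c)); apply: derive_supp; exact: ZM.
have bD : bb (fun x => \sum_a 'D_(e_ a) (Z a) x).
  apply: (@continuous_bb _ _ M).
    by apply: continuous_sum => a; exact: cDZ.
  move=> x; apply: contra_neqP => nM; rewrite big1 // => a _.
  by apply/eqP; apply: contra_notT nM; apply: derive_supp; exact: ZM.
have bL : bb (fun x => if 0 < (-1) ^+ b * (x 0 i - g (col' i x))
                    then \sum_a 'D_(e_ a) (Z a) x else 0).
  have [mD [C [L HD]]] := bD; split.
    apply: measurable_fun_ifT => //; apply: measurable_fun_ltr => //.
    by apply: continuous_rV_measurable => //; exact: side_continuous.
  exists C, L => x; have [h1 h2] := HD x; case: ifP => // _.
  by rewrite normr0 eqxx; split=> //; exact: le_trans h1.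
rewrite (integral_ins i bL) (integral_shear (@smooth_fun_cont _ _ g) (bb_ins i bL)).
pose Gr a := cgrad i g 0 a : 'rV[R]_n -> R.
(* [Q] is the s-derivative of the flux sum_a G_a Z_a, and each [B j] below is the y_j-derivative of
   Z_(lift i j) on the sheared slice. The terms with D_j g cancel between them. *)
pose Q (z : T * 'rV[R]_n) := \sum_a Gr a z.2 * 'D_(e_ i) (Z a) (Psi z).
pose B j (z : T * 'rV[R]_n) := 'D_(e_ (lift i j)) (Z (lift i j)) (Psi z)
   + 'D_(e_ j) g z.2 * 'D_(e_ i) (Z (lift i j)) (Psi z).
pose cut (H : T * 'rV[R]_n -> R) z := if 0 < (-1) ^+ b * z.1 then H z else 0.
have bQ : bbp Q.
  apply: bbp_sum => a; apply: bbp_mul; first exact: smooth_fun_cont.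
  exact: (bbp_Psi (bDZ _ _)).
have bB j : bbp (B j).
  apply: bbp_add; first exact: (bbp_Psi (bDZ _ _)).
  exact: (bbp_mul (@smooth_fun_cont _ _ (spart j g)) (bbp_Psi (bDZ _ _))).
transitivity (\int[lprod n]_z (cut Q z + \sum_j cut (B j) z)).
  apply: eq_Rintegral => z _; rewrite /comp -/(Psi z).
  have -> : (Psi z) 0 i - g (col' i (Psi z)) = z.1.
    by rewrite ins_i col'_ins /= addrK.
  rewrite /cut; case: ifP => _; last by rewrite big1 ?addr0.
  rewrite (bigD1_ord i) //= /Q (bigD1_ord i) //= /Gr cgrad_i mul1r -addrA; congr (_ + _).
  rewrite -big_split; apply: eq_bigr => j _ /=.
  by rewrite cgrad_lift /B mulNr addrC addrK.
rewrite RintegralD //; last 2 first.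
- exact: (bbp_integrable (bbp_if b bQ)).
- exact: (bbp_integrable (bbp_sum (index_enum 'I_n) (fun j => bbp_if b (bB j)))).
rewrite Rintegral_sum //; last by move=> j; exact: (bbp_integrable (bbp_if b (bB j))).
rewrite [X in _ + X]big1 ?addr0; last first.
  move=> j _; rewrite (bbp_fubini1 (bbp_if b (bB j))); apply: RintegralT_eq0 => s /=.
  case: (boolP (0 < (-1) ^+ b * s)) => _; last by apply: RintegralT_eq0.
  have ch y := Psi_chain (F := Z (lift i j)) (dZ (lift i j) (Psi (s, y))).
  have E : (fun y => B j (s, y)) = 'D_(e_ j) (fun y => Z (lift i j) (Psi (s, y))).
    by apply/funext => y; rewrite (ch y).2.
  rewrite E; apply: (@integral_partial _ _ j _ M).
  - by move=> y; apply: differentiable_continuous; have [] := ch y.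
  - by move=> y; apply: diff_derivable; have [] := ch y.
  - rewrite -E; have c1 a c : continuous (fun y : 'rV[R]_n => 'D_(e_ c) (Z a) (Psi (s, y))).
      have cP : continuous (fun y : 'rV[R]_n => Psi (s, y)).
        by apply: (@Psi_continuous _ (fun=> s) id) => ?; [exact: cst_continuous|exact: cvg_id].
      move=> y; exact: (continuous_comp (cP y) (cDZ a c _)).
    have cB : continuous (fun y : 'rV[R]_n => B j (s, y)).
      move=> y; exact: (cvgD (c1 _ _ y) (cvgM (@smooth_fun_cont _ _ (spart j g) y) (c1 _ _ y))).
    exact: cB.
  - by move=> y /(Psi_supp (ZM (lift i j)))[].
rewrite (bbp_fubini2 (bbp_if b bQ)); apply: eq_Rintegral => y _ /=.
have lineE s : Psi (s, y) = Psi (0, y) + s *: e_ i.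
  rewrite /Psi /= add0r !ins_split -addrA -scalerDl; congr (_ + _ *: _).
  by rewrite addrC.
move: lineE; set x0 := Psi (0, y) => lineE.
have x0E : x0 = ins i (g y, y) by rewrite /x0 /Psi /= add0r.
pose q (s : R) := \sum_a Gr a y * Z a (Psi (s, y)).
have ld a s : is_derive s (1 : R) (fun s => Z a (Psi (s, y))) ('D_(e_ i) (Z a) (Psi (s, y))).
  rewrite (_ : (fun s => Z a (Psi (s, y))) = (fun s => Z a (x0 + s *: e_ i))); last first.
    by apply/funext => t; rewrite lineE.
  by rewrite lineE; apply: derive_line; exact: diff_derivable.
apply: (Logic.eq_trans (@integral_half_line _ b q (fun s => Q (s, y)) (M + `|g y|) _ _ _ _)).
- move=> s; rewrite /q /Q /=.
  have -> : (fun s => \sum_a Gr a y * Z a (Psi (s, y))) = \sum_a (fun s => Gr a y * Z a (Psi (s, y))).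
    by apply/funext => t; rewrite fct_sumE.
  apply: is_derive_sum => a; have := is_deriveZ (Gr a y) (ld a s); exact.
- apply: continuous_sum => a s.
  apply: (@continuous_comp _ _ _ (fun s => 'D_(e_ i) (Z a) (Psi (s, y))) ( *%R (Gr a y))); last exact: mulrl_continuous.
  have cP : continuous (fun s : R => Psi (s, y)).
    by apply: (@Psi_continuous _ id (fun=> y)) => ?; [exact: cvg_id|exact: cst_continuous].
  exact: (continuous_comp (cP s) (cDZ a i _)).
- move=> s; apply: contra_neqT => sM; rewrite /q big1 // => a _.
  apply/eqP; rewrite mulf_eq0; apply/orP; right; apply: contraNT sM.
  by move=> /(Psi_supp (ZM a))[].
- move=> s; apply: contra_neqT => sM; rewrite /Q big1 // => a _.
  apply/eqP; rewrite mulf_eq0; apply/orP; right; apply: contraNT sM.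
  by move=> /(Psi_supp (derive_supp (ZM a)))[].
- by rewrite /q mulr_sumr; apply: eq_bigr => a _; rewrite mulrA -/x0 -x0E.
Qed.

End ChartDivergenceTheorem.

(** * Elementary symmetric functions of the eigenvalues *)

Section ElementarySymmetric.
Context {R : realType} {n : nat}.
Variable kappa : 'rV[R]_n.

(** sigma_j of the entries other than kappa_i; this is the eigenvalue of the Newton tensor T_j on
    the i-th principal direction. *)
Definition esym_wo (j : nat) (i : 'I_n) : R :=
  \sum_(J : {set 'I_n} | (#|J| == j) && (i \notin J)) \prod_(l in J) kappa ord0 l.

Lemma esym_with j i : kappa 0 i * esym_wo j i =
  \sum_(J : {set 'I_n} | (#|J| == j.+1) && (i \in J)) \prod_(l in J) kappa ord0 l.
Proof.
rewrite [RHS](reindex_onto (fun J => i |: J) (fun J => J :\ i)) /=; last first.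
  by move=> J /andP[_ iJ]; rewrite finset.setD1K.
rewrite /esym_wo mulr_sumr; apply: eq_big => [J|J /andP[_ iJ]].
  case: (boolP (i \in J)) => iJ /=.
    rewrite andbF; apply: Logic.eq_sym; apply/negbTE; rewrite !negb_and -orbA; apply/orP; right.
    apply/orP; right; apply: contraL iJ => /eqP <-.
    by rewrite !inE eqxx.
  by rewrite finset.setU1K // eqxx finset.cardsU1 iJ finset.setU11 add1n eqSS !andbT.
by rewrite finset.big_setU1.
Qed.

Lemma esym0 : esym 0 kappa = 1.
Proof.
rewrite /esym (bigD1 finset.set0) ?finset.cards0 //= finset.big_set0 big1 ?addr0 // => J /andP[+ J0].
by rewrite finset.cards_eq0 (negPf J0).
Qed.

Lemma esym_wo0 i : esym_wo 0 i = 1.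
Proof.
rewrite /esym_wo (bigD1 finset.set0) ?finset.cards0 ?inE //= finset.big_set0 big1 ?addr0 // => J /andP[/andP[+ _] J0].
by rewrite finset.cards_eq0 (negPf J0).
Qed.

Lemma esym_woS j i : esym_wo j.+1 i = esym j.+1 kappa - kappa 0 i * esym_wo j i.
Proof.
apply/eqP; rewrite eq_sym subr_eq esym_with /esym (bigID (fun J : {set 'I_n} => i \in J)) /=.
by rewrite addrC.
Qed.

(** Each set of size j + 1 is counted once for each of its elements. *)
Lemma sum_esym_wo j : \sum_i kappa 0 i * esym_wo j i = esym j.+1 kappa *+ j.+1.
Proof.
under eq_bigr do rewrite esym_with.
rewrite (exchange_big_dep (fun J : {set 'I_n} => #|J| == j.+1)) /=; last first.
  by move=> i J _ /andP[].
rewrite /esym -sumrMnl; apply: eq_bigr => J cJ.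
transitivity (\sum_(i in J) \prod_(l in J) kappa ord0 l).
  by apply: eq_bigl => i; rewrite cJ.
by rewrite sumr_const (eqP cJ).
Qed.

Definition invn (j : nat) : R := j.+1%:R^-1.
Lemma invnK j : invn j * j.+1%:R = 1.
Proof. by rewrite mulVf // pnatr_eq0. Qed.

(* The eigenvectors e_i together with nu resolve the identity. *)
Lemma esym_trsig (S : 'M[R]_n.+1) (nu : 'rV[R]_n.+1) (e : 'I_n -> 'rV[R]_n.+1) :
  nu *m nu^T = 1%:M -> nu *m S = 0 ->
  (forall i, e i *m nu^T = 0) -> (forall i j, e i *m (e j)^T = (i == j)%:R%:M) ->
  (forall i, e i *m S = kappa 0 i *: e i) ->
  forall j, trsig invn S j = esym j kappa.
Proof.
move=> nu1 nuS enu ee eS.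
have e_ortho i j : e i *m (e j)^T = (i == j)%:R%:M by [].
pose P : 'M[R]_(1 + n) := col_mx nu (\matrix_i e i).
have rowP' i : row i (\matrix_i e i) = e i by apply/rowP => a; rewrite !mxE.
have PP : P *m P^T = 1%:M.
  rewrite tr_col_mx mul_col_row nu1.
  have -> : nu *m (\matrix_i e i)^T = 0.
    apply/rowP => j; transitivity ((e j *m nu^T) 0 0); last by rewrite enu !mxE.
    by rewrite !mxE; apply: eq_bigr => l _; rewrite !mxE mulrC.
  have -> : (\matrix_i e i) *m nu^T = 0.
    by apply/row_matrixP => i; rewrite row_mul rowP' enu row0.
  have -> : (\matrix_i e i) *m (\matrix_i e i)^T = 1%:M.
    apply/matrixP => i j; transitivity ((e i *m (e j)^T) 0 0).
      by rewrite !mxE; apply: eq_bigr => l _; rewrite !mxE.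
    by rewrite e_ortho !mxE.
  by rewrite -scalar_mx_block.
(* P is square, so orthonormality of its rows gives the resolution of the identity. *)
have PP' : P^T *m P = 1%:M by exact: mulmx1C.
have I_sum : nu^T *m nu + \sum_i (e i)^T *m e i = 1%:M.
  rewrite -PP' tr_col_mx mul_row_col; congr (_ + _).
  apply/matrixP => a c; rewrite summxE mxE; apply: eq_bigr => i _.
  by rewrite !mxE big_ord1 !mxE.
have S_sum : S = \sum_i kappa 0 i *: ((e i)^T *m e i).
  rewrite -[LHS]mul1mx -I_sum mulmxDl -mulmxA nuS mulmx0 add0r mulmx_suml.
  by apply: eq_bigr => i _; rewrite -mulmxA eS -scalemxAr.
(* The Newton tensor in the eigenbasis: sigma_j on nu, where S vanishes, and [esym_wo j i] on e_i.
   It satisfies the recursion of [trsig_uniq]. *)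
pose T j := esym j kappa *: (nu^T *m nu) + \sum_i esym_wo j i *: ((e i)^T *m e i).
have ST j : S *m T j = \sum_i (kappa 0 i * esym_wo j i) *: ((e i)^T *m e i).
  rewrite S_sum mulmxDr mulmx_suml [X in X + _]big1 ?add0r; last first.
    by move=> i _; rewrite -scalemxAr -scalemxAl -mulmxA [e i *m _]mulmxA enu mul0mx mulmx0 !scaler0.
  rewrite mulmx_suml; apply: eq_bigr => i _; rewrite mulmx_sumr (bigD1 i) //= big1 ?addr0.
    by rewrite -scalemxAr -scalemxAl -mulmxA [e i *m _]mulmxA e_ortho eqxx mul1mx scalerA mulrC.
  move=> j' /negPf ji; rewrite -scalemxAr -scalemxAl -mulmxA [e i *m _]mulmxA e_ortho.
  by rewrite eq_sym ji raddf0 mul0mx mulmx0 !scaler0.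
suff H j : esym j kappa = trsig invn S j /\ T j = trnewt invn S j by move=> j; have [<-] := H j.
apply: (trsig_uniq invnK (s := fun j => esym j kappa) (T := T)).
- exact: esym0.
- rewrite /T esym0 scale1r -I_sum; congr (_ + _); apply: eq_bigr => i _.
  by rewrite esym_wo0 scale1r.
- move=> k; rewrite ST raddf_sum /= -sum_esym_wo; apply: eq_bigr => i _.
  by rewrite linearZ /= mxtrace_mulC e_ortho eqxx mxtrace1 mulr1.
- move=> k; rewrite ST -[in RHS]scalemx1 -I_sum scalerDr -addrA; congr (_ + _).
  rewrite scaler_sumr -sumrB; apply: eq_bigr => i _.
  by rewrite esym_woS scalerBl.
Qed.
End ElementarySymmetric.

(** * Principal curvatures *)

Section Spectral.
Context {R : realType}.

Lemma mulmx_row_continuous N p (M : 'M[R]_(N, p)) j :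
  continuous (fun v : 'rV[R]_N => (v *m M) 0 j).
Proof.
under eq_fun do rewrite mxE.
apply: continuous_sum => a v.
apply: (@continuous_comp _ _ _ (fun v : 'rV[R]_N => v 0 a) ( *%R^~ (M a j))).
  exact: coord_continuous.
exact: mulrr_continuous.
Qed.

Lemma quad_continuous N (M : 'M[R]_N) : continuous (fun v : 'rV[R]_N => (v *m M *m v^T) 0 0).
Proof.
have -> : (fun v : 'rV[R]_N => (v *m M *m v^T) 0 0) = (fun v => \sum_a (v *m M) 0 a * v 0 a).
  by apply/funext => v; rewrite mxE; apply: eq_bigr => a _; rewrite [_^T _ _]mxE.
apply: continuous_sum => a v.
exact: (cvgM (@mulmx_row_continuous _ _ M a v) (@coord_continuous _ _ _ 0 a v)).
Qed.

Lemma sqnorm_ge0 N (v : 'rV[R]_N) : 0 <= (v *m v^T) 0 0.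
Proof. by rewrite mxE sumr_ge0 // => a _; rewrite mxE -expr2 sqr_ge0. Qed.

Lemma sqnorm_eq0 N (v : 'rV[R]_N) : (v *m v^T) 0 0 = 0 -> v = 0.
Proof.
rewrite mxE => /eqP; rewrite psumr_eq0 => [/allP h|a _]; last by rewrite mxE -expr2 sqr_ge0.
apply/rowP => a; have := h a (mem_index_enum _).
by rewrite !mxE -expr2 sqrf_eq0 => /eqP.
Qed.

(** A nonzero linear term cannot be bounded by a quadratic one near t = 0; t = b / (|C| + 1) makes
    this quantitative. *)
Lemma linear_dominated (b C : R) : (forall t, 2 * t * b <= t ^+ 2 * C) -> b = 0.
Proof.
move=> H; apply/eqP; rewrite -sqrf_eq0 eq_le sqr_ge0 andbT.
have q0 : 0 < `|C| + 1 by rewrite ltr_wpDl.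
have := H (b / (`|C| + 1)); rewrite expr_div_n => H1.
have H2 : 2 * b ^+ 2 * (`|C| + 1) <= b ^+ 2 * C.
  rewrite -(ler_pM2r (x := (`|C| + 1) ^- 2)) ?invr_gt0 ?exprn_gt0 //.
  have -> : 2 * b ^+ 2 * (`|C| + 1) * (`|C| + 1) ^- 2 = 2 * (b / (`|C| + 1)) * b.
    by field; rewrite gt_eqF.
  by rewrite [leRHS]mulrAC.
have := ler_norm C; have := sqr_ge0 b => b2 CC.
have : b ^+ 2 * C <= b ^+ 2 * `|C| by rewrite ler_wpM2l.
by have := normr_ge0 C; nra.
Qed.

Lemma unit_sphere_compact N p (B : 'M[R]_(N, p)) :
  compact [set v : 'rV[R]_N | v *m B = 0 /\ (v *m v^T) 0 0 = 1].
Proof.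
apply: bounded_closed_compact.
  exists 1; split; first exact: num_real.
  move=> M M1 v [_ v1]; rewrite /Num.Def.normr /= mx_normrE.
  apply: bigmax_le => [|[i j] _]; first by rewrite (le_trans _ (ltW M1)).
  apply: le_trans (ltW M1); rewrite /= ord1 -(expr_le1 (n := 2)) // real_normK ?num_real //.
  rewrite -v1 mxE (bigD1 j) //= mxE -expr2 lerDl sumr_ge0 // => a _.
  by rewrite mxE -expr2 sqr_ge0.
have -> : [set v : 'rV[R]_N | v *m B = 0 /\ (v *m v^T) 0 0 = 1] =
  (\bigcap_(j in [set: 'I_p]) (fun v : 'rV[R]_N => (v *m B) 0 j) @^-1` [set 0])
  `&` (fun v : 'rV[R]_N => (v *m 1%:M *m v^T) 0 0) @^-1` [set 1].
  apply/seteqP; split=> v /=; rewrite mulmx1 => -[h1 h2]; split=> //.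
    by move=> j _; rewrite /= h1 mxE.
  by apply/rowP => j; rewrite [RHS]mxE; exact: (h1 j I).
apply: closedI.
  apply: closed_bigI => j _; apply: closed_comp => [v _|]; first exact: mulmx_row_continuous.
  exact: closed_eq.
apply: closed_comp => [v _|]; first exact: quad_continuous.
exact: closed_eq.
Qed.

(** Maximizes the quadratic form of S over the unit vectors orthogonal to the rows of B; p < N makes
    this set nonempty. Invariance of the row space under the symmetric S makes its orthogonal
    complement invariant too. *)
Lemma max_eigenvector N p (S : 'M[R]_N) (B : 'M[R]_(p, N)) :
  S^T = S -> (B *m S <= B)%MS -> (p < N)%N ->
  exists (lambda : R) (v : 'rV[R]_N), [/\ v *m B^T = 0, v *m v^T = 1%:M & v *m S = lambda *: v].
Proof.
move=> sS BS pN.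
have lin4 (a b c d : 'M[R]_1) (t : R) : (a + t *: b + (t *: c + t *: (t *: d))) 0 0 =
    a 0 0 + t * b 0 0 + (t * c 0 0 + t * (t * d 0 0)) by rewrite !mxE.
pose K := [set v : 'rV[R]_N | v *m B^T = 0 /\ (v *m v^T) 0 0 = 1].
have scale_K u : u *m B^T = 0 -> u != 0 ->
    K ((Num.sqrt ((u *m u^T) 0 0))^-1 *: u).
  move=> uB u0; split; first by rewrite -scalemxAl uB scaler0.
  rewrite linearZ /= -scalemxAl -scalemxAr scalerA mxE -invfM -expr2 sqr_sqrtr ?sqnorm_ge0 //.
  by rewrite mulVf //; apply: contra u0 => /eqP/sqnorm_eq0 ->.
have K0 : K !=set0.
  have : kermx B^T != 0.
    rewrite kermx_eq0 /row_free; apply/eqP => h.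
    by have := rank_leq_col B^T; rewrite h leqNgt pN.
  move=> /rowV0Pn[u /sub_kermxP uB u0].
  by eexists; exact: scale_K uB u0.
have cK : compact K := @unit_sphere_compact _ _ B^T.
pose f (v : 'rV[R]_N) : R := (v *m S *m v^T) 0 0.
have [v vK vmax] : exists2 v, v \in K & forall t, t \in K -> f t <= f v.
  by apply: EVT_max_rV => //; apply: continuous_subspaceT; exact: quad_continuous.
have [vB v1] : K v by move: vK; rewrite inE.
have v1' : v *m v^T = 1%:M by rewrite [LHS]mx11_scalar v1.
exists (f v), v; split=> //.
have fmax (u : 'rV[R]_N) : u *m B^T = 0 -> f u <= f v * (u *m u^T) 0 0.
  move=> uB; have [->|u0] := eqVneq u 0.
    by rewrite /f !mul0mx mxE mulr0.
  have := vmax _ (mem_set (scale_K u uB u0)).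
  rewrite /f linearZ /= -!scalemxAl -scalemxAr scalerA mxE -invfM -expr2 sqr_sqrtr ?sqnorm_ge0 //.
  rewrite mulrC ler_pdivrMr // lt_neqAle sqnorm_ge0 andbT eq_sym.
  by apply: contra u0 => /eqP/sqnorm_eq0 ->.
(* First variation of the maximum in an admissible direction w: the inequality is linear against
   quadratic in t. *)
have ortho (w : 'rV[R]_N) : w *m B^T = 0 -> w *m v^T = 0 -> (w *m S *m v^T) 0 0 = 0.
  move=> wB wv; apply: (@linear_dominated _ (f v * (w *m w^T) 0 0 - f w)) => t.
  have := fmax (v + t *: w).
  rewrite mulmxDl -scalemxAl wB scaler0 vB addr0 => /(_ Logic.eq_refl).
  have vw : v *m w^T = 0 by rewrite -[v]trmxK -trmx_mul wv trmx0.
  have vSw : (v *m S *m w^T) 0 0 = (w *m S *m v^T) 0 0.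
    by rewrite -[in RHS](trmxK (w *m S *m v^T)) [RHS]mxE trmx_mul trmxK trmx_mul sS mulmxA.
  have e1 : f (v + t *: w) = f v + 2 * t * (w *m S *m v^T) 0 0 + t ^+ 2 * f w.
    rewrite /f !mulmxDl linearD linearZ /= !mulmxDr -!scalemxAl -!scalemxAr.
    by rewrite lin4 vSw; ring.
  have e2 : ((v + t *: w) *m (v + t *: w)^T) 0 0 = 1 + t ^+ 2 * (w *m w^T) 0 0.
    rewrite !mulmxDl linearD linearZ /= !mulmxDr -!scalemxAl -!scalemxAr.
    have z0 : (0 : 'M[R]_1) 0 0 = 0 by rewrite mxE.
    by rewrite lin4 v1 vw wv z0; ring.
  by rewrite e1 e2 => h; lra.
(* The residual of the eigenvalue equation is itself an admissible direction, so its squared norm is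
   a vanishing first variation. *)
pose z := v *m S - f v *: v.
have zB : z *m B^T = 0.
  rewrite mulmxBl -scalemxAl vB scaler0 subr0 -mulmxA.
  have /submxP[D BSD] := BS.
  by rewrite -[S *m _]trmxK trmx_mul trmxK sS BSD trmx_mul mulmxA vB mul0mx.
have zv : z *m v^T = 0.
  rewrite mulmxBl -scalemxAl v1' scalemx1 [v *m S *m _]mx11_scalar subrr //.
have := ortho z zB zv.
have -> : (z *m S *m v^T) 0 0 = (z *m z^T) 0 0.
  rewrite [in z^T]/z linearB linearZ /= trmx_mul sS mulmxBr -scalemxAr zv scaler0 subr0.
  by rewrite mulmxA.
by move=> /sqnorm_eq0 /eqP; rewrite subr_eq0 => /eqP.
Qed.

(** Eigenvectors are added one at a time, each orthogonal to nu and to its predecessors; these m + 1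
    rows are fewer than n + 1 as long as m < n. *)
Lemma spectral_orthonormal n (S : 'M[R]_n.+1) (nu : 'rV[R]_n.+1) :
  S^T = S -> nu *m nu^T = 1%:M -> nu *m S = 0 ->
  exists (kappa : 'rV[R]_n) (e : 'I_n -> 'rV[R]_n.+1),
    [/\ forall i, e i *m nu^T = 0, forall i j, e i *m (e j)^T = (i == j)%:R%:M
      & forall i, e i *m S = kappa 0 i *: e i].
Proof.
move=> sS nu1 nuS.
suff H m : (m <= n)%N -> exists (kappa : 'rV[R]_m) (e : 'I_m -> 'rV[R]_n.+1),
    [/\ forall i, e i *m nu^T = 0, forall i j, e i *m (e j)^T = (i == j)%:R%:M
      & forall i, e i *m S = kappa 0 i *: e i] by exact: (H n).
elim: m => [_|m IH mn].
  by exists 0, (fun=> 0); split=> [[]|[]|[]].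
have [kappa [e [enu ee eS]]] := IH (ltnW mn).
pose E := \matrix_i e i.
have rowE i : row i E = e i by apply/rowP => a; rewrite !mxE.
pose B := col_mx E nu.
have BS : (B *m S <= B)%MS.
  rewrite mul_col_mx nuS; apply/row_subP => i.
  case: (split_ordP i) => j ->; last by rewrite rowKd row0 sub0mx.
  rewrite rowKu row_mul rowE eS scalemx_sub // -rowE.
  have -> : row j E = row (lshift 1 j) B by rewrite rowKu.
  exact: row_sub.
have [|la [v [vB v1 vS]]] := max_eigenvector sS BS; first by rewrite addn1 ltnS.
have vE i : v *m (e i)^T = 0.
  move: vB; rewrite tr_col_mx mul_mx_row => vB.
  have vE : v *m E^T = 0 by have := congr1 lsubmx vB; rewrite row_mxKl => ->; apply/matrixP => a c; rewrite !mxE.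
  apply/matrixP => a c.
  have := congr1 (fun M : 'rV_m => M 0 i) vE; rewrite !ord1 !mxE => h.
  by rewrite -[RHS]h; apply: eq_bigr => l _; rewrite !mxE.
have vn : v *m nu^T = 0.
  have := congr1 rsubmx vB; rewrite tr_col_mx mul_mx_row row_mxKr => ->.
  by apply/matrixP => a c; rewrite !mxE.
pose e' (i : 'I_m.+1) := if unlift ord_max i is Some j then e j else v.
exists (\row_i (if unlift ord_max i is Some j then kappa 0 j else la)), e'.
split.
- by move=> i; rewrite /e'; case: unliftP.
- move=> i j; rewrite /e'; case: (unliftP ord_max i) => [i' ->|->];
    case: (unliftP ord_max j) => [j' ->|->].
  + by rewrite ee (inj_eq (@lift_inj _ _)).
  + rewrite [lift _ _ == _]eq_sym (negPf (neq_lift _ _)) raddf0.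
    by rewrite -[LHS]trmxK trmx_mul trmxK (vE i') trmx0.
  + by rewrite (negPf (neq_lift _ _)) raddf0 (vE j').
  + by rewrite eqxx.
- by move=> i; rewrite mxE /e'; case: unliftP.
Qed.
End Spectral.

(** * Graph charts of the boundary *)

Section Charts.
Context {R : realType} {n : nat}.
Local Notation e_ j := (delta_mx ord0 j).
Variable Omega : set 'rV[R]_n.+1.

Lemma curve_comp (V W : normedModType R) (F : V -> W) (c : R -> V) t v :
  is_derive t (1 : R) c v -> differentiable F (c t) ->
  is_derive t (1 : R) (F \o c) ('D_v F (c t)).
Proof.
move=> [dc <-] dF; have dc' : differentiable c t by apply/derivable1_diffP.
have dFc := differentiable_comp dc' dF.
split; first by apply/derivable1_diffP.
by rewrite !deriveE // diff_comp.
Qed.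

Lemma is_derive_affine (V : normedModType R) (x v : V) (t : R) :
  is_derive t (1 : R) (fun s : R => x + s *: v) v.
Proof.
have H : (h^-1 *: (((fun s : R => x + s *: v) \o shift t) (h *: (1 : R)) - (x + t *: v))) @[h --> 0^'] --> v.
  apply: cvg_near_cst; near=> h.
  have h0 : h != 0 by near: h; exact: nbhs_dnbhs_neq.
  rewrite /= [h *: 1]mulr1 scalerDl opprD addrACA subrr add0r addrK.
  by rewrite scalerA mulVf // scale1r.
split; first by apply/cvg_ex; exists v.
by apply/cvg_lim.
Unshelve. all: by end_near. Qed.

Lemma open_line N (V : set 'rV[R]_N) x v : open V -> V x ->
  \forall t \near (0 : R)^'+, V (x + t *: v).
Proof.
move=> oV Vx.
have cl : {for 0, continuous (fun t : R => x + t *: v)}.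
  apply: differentiable_continuous; apply/derivable1_diffP.
  by have [] := is_derive_affine x v 0.
have H : \forall t \near (0 : R), V (x + t *: v).
  by apply: cl; rewrite scale0r addr0; exact: open_nbhs_nbhs.
by move: H => /nbhs_ballP[e /= e0 He]; exists e => //= t te _; exact: He.
Qed.

Lemma derive_sum_coord N (W : normedModType R) (F : 'rV[R]_N -> W) y v : differentiable F y ->
  'D_v F y = \sum_j v 0 j *: 'D_(e_ j) F y.
Proof.
move=> dF; rewrite deriveE // [in LHS](row_sum_delta v) linear_sum.
by apply: eq_bigr => j _; rewrite linearZ /= deriveE.
Qed.

Section OneChart.
Variables (i : 'I_n.+1) (b : bool) (g : @smooth_fun R n) (U : set 'rV[R]_n.+1).

Definition side (x : 'rV[R]_n.+1) : R := (-1) ^+ b * (x 0 i - g (col' i x)).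
Definition chart_on := open U /\ forall x, U x -> (Omega x <-> 0 < side x).
Definition gphi (y : 'rV[R]_n) : 'rV[R]_n.+1 := ins i (g y, y).
Definition nuv (y : 'rV[R]_n) : 'rV[R]_n.+1 := map_mx (sev y) (cnu i b g).

Lemma side_cont : continuous side. Proof. exact: side_continuous. Qed.

Lemma sign_sq : (-1) ^+ b * (-1) ^+ b = 1 :> R.
Proof. by rewrite -expr2 sqrr_sign. Qed.

Lemma side_eq0 x : side x = 0 <-> x = gphi (col' i x).
Proof.
rewrite /side; split=> [/eqP|->].
  rewrite mulf_eq0 signr_eq0 /= subr_eq0 => /eqP xi.
  by rewrite -[LHS](ins_col' i) xi.
by rewrite /gphi ins_i col'_ins subrr mulr0.
Qed.

Lemma gphi_derive (y v : 'rV[R]_n) : differentiable gphi y /\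
  'D_v gphi y = ins i ('D_v g y, v).
Proof.
by have [d D] := graph_differentiable i (@smooth_fun_diff _ _ g y); split.
Qed.

Lemma col'_derive (x v : 'rV[R]_n.+1) : differentiable (col' i : 'rV[R]_n.+1 -> 'rV[R]_n) x
  /\ 'D_v (col' i : 'rV[R]_n.+1 -> 'rV[R]_n) x = col' i v.
Proof.
have cc := @col'_continuous R n i.
have dc : differentiable (col' i : 'rV[R]_n.+1 -> 'rV[R]_n) x.
  by apply: linear_differentiable; exact: cc.
split=> //; have [_] := is_derive_linear (f := col' i : {linear 'rV[R]_n.+1 -> 'rV[R]_n}) x v cc.
by [].
Qed.

Lemma side_derive (x v : 'rV[R]_n.+1) : differentiable side x /\
  'D_v side x = (-1) ^+ b * (v 0 i - 'D_(col' i v) g (col' i x)).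
Proof.
have [dc Dc] := col'_derive x v.
have dg : differentiable g (col' i x) by exact: smooth_fun_diff.
have dgc := differentiable_comp dc dg.
have dxi : differentiable (coord_fun i : 'rV[R]_n.+1 -> R) x.
  by apply: linear_differentiable; exact: coord_fun_continuous.
have dd := differentiableB dxi dgc.
have E : side = (-1) ^+ b \*: (coord_fun i \- (g \o col' i)) by [].
have ds : differentiable side x by rewrite E; exact: differentiableZ.
split=> //; rewrite E deriveZ; last exact: diff_derivable.
congr (_ * _); rewrite deriveB; [|exact: diff_derivable|exact: diff_derivable].
congr (_ - _); first by have [_] := is_derive_coord_fun i x v.
by rewrite deriveE // diff_comp //= -!deriveE // Dc.
Qed.

Hypothesis cU : chart_on.

(** A point with [side] = 0 is approached from Omega along (-1)^b e_i, a direction in which [side]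
    grows at unit speed. *)
Lemma chart_closure x : U x -> (closure Omega x <-> 0 <= side x).
Proof.
have [oU HU] := cU => Ux; split=> [clx|].
  rewrite leNgt; apply/negP => sx.
  have nb : nbhs x (U `&` side @^-1` [set t | t < 0]).
    apply: filterI; first exact: open_nbhs_nbhs.
    by apply: side_cont; apply: open_nbhs_nbhs; split=> //; exact: open_lt.
  have [z [Oz [Uz /= sz]]] := clx _ nb.
  by have := (HU z Uz).1 Oz; rewrite ltNge ltW.
move=> sx B nB.
have nb : nbhs x (B `&` U) by apply: filterI => //; exact: open_nbhs_nbhs.
pose l (t : R) := x + t *: ((-1) ^+ b *: (e_ i : 'rV[R]_n.+1)).
have cl : continuous l.
  by move=> t; apply: cvgD; [exact: cvg_cst|apply: cvgZr_tmp; exact: cvg_id].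
have l0 : l 0 = x by rewrite /l scale0r addr0.
have : nbhs (0 : R) (l @^-1` (B `&` U)) by apply: cl; rewrite l0.
move=> /nbhs_ballP[e /= e0 He].
have [Bl Ul] : (B `&` U) (l (e / 2)).
  apply: He; rewrite -ball_normE /= sub0r normrN gtr0_norm ?divr_gt0 //.
  by rewrite ltr_pdivrMr // mulr_natr mulr2n ltrDl.
exists (l (e / 2)); split => //; apply/(HU _ Ul).
have -> : side (l (e / 2)) = side x + e / 2.
  rewrite /side /l; have -> : col' i (x + (e / 2) *: ((-1) ^+ b *: (e_ i : 'rV[R]_n.+1))) = col' i x.
    apply/rowP => j; rewrite ![col' _ _ _ _]mxE rvD !rvZ rv_delta eq_sym (negPf (neq_lift _ _)).
    by rewrite !mulr0 addr0.
  rewrite rvD !rvZ rv_delta eqxx mulr1.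
  transitivity ((-1) ^+ b * (x 0 i - g (col' i x)) + ((-1) ^+ b * (-1) ^+ b) * (e / 2)); first by ring.
  by rewrite sign_sq mul1r.
by rewrite ltr_wpDl // divr_gt0.
Qed.

Lemma chart_interior x : U x -> 0 < side x -> interior Omega x.
Proof.
have [oU HU] := cU => Ux sx.
have : nbhs x (U `&` side @^-1` [set t | 0 < t]).
  apply: filterI; first exact: open_nbhs_nbhs.
  by apply: side_cont; apply: open_nbhs_nbhs; split=> //; exact: open_gt.
by apply: filterS => z [Uz /= sz]; apply/(HU z Uz).
Qed.

Lemma chart_frontier x : U x -> (frontier Omega x <-> side x = 0).
Proof.
have [oU HU] := cU => Ux; split=> [[/(chart_closure Ux) s0 ni]|s0].
  apply/eqP; rewrite eq_le s0 andbT leNgt; apply/negP => sx; apply: ni.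
  exact: chart_interior.
split; first by apply/(chart_closure Ux); rewrite s0.
by move=> /interior_subset /(HU x Ux); rewrite s0 ltxx.
Qed.

Lemma gphi_frontier y : U (gphi y) -> frontier Omega (gphi y).
Proof. by move=> Uy; apply/(chart_frontier Uy)/side_eq0; rewrite /gphi col'_ins. Qed.

Lemma dotp_nuv w y : dotp w (nuv y) =
  - (-1) ^+ b * (cnorm i g y)^-1 * (w 0 i - 'D_(col' i w) g y).
Proof.
rewrite /dotp (bigD1_ord i) //= (derive_sum_coord _ (smooth_fun_diff g y)).
have nuE a : nuv y 0 a = (- (-1) ^+ b * (cnorm i g y)^-1) * cgrad i g 0 a y.
  by rewrite !mxE /sev; rewrite smooth_mulE.
rewrite nuE cgrad_i mulr1 mulrBr mulrC; congr (_ + _).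
rewrite -mulrN -sumrN mulr_sumr; apply: eq_bigr => j _.
rewrite nuE cgrad_lift [col' i w 0 j]mxE; move: ('D_(e_ j) g y) => q.
by rewrite -[_ *: q]/(_ * q) !mulrN mulrCA mulrA; congr (- (_ * _)); rewrite mulrC.
Qed.

Lemma dotp_nuv_eq0 w y : dotp w (nuv y) = 0 <-> w 0 i = 'D_(col' i w) g y.
Proof.
rewrite dotp_nuv; split=> [/eqP|->]; last by rewrite subrr mulr0.
rewrite mulf_eq0 mulf_eq0 oppr_eq0 signr_eq0 invr_eq0 gt_eqF ?cnorm_gt0 //=.
by rewrite subr_eq0 => /eqP.
Qed.

(** [side] vanishes along every curve in the boundary, which gives one direction. Conversely, a
    vector satisfying the linear equation is the velocity of the graph over a straight line of
    parameters. *)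
Lemma chart_tangent x w : U x -> frontier Omega x ->
  tangent (frontier Omega) x w <-> dotp w (nuv (col' i x)) = 0.
Proof.
move=> Ux fx; rewrite dotp_nuv_eq0; have [oU _] := cU.
have s0 := (chart_frontier Ux).1 fx; split=> [[c [c0 cf dc]]|wi].
  have cc : {for 0, continuous c}.
    by apply: differentiable_continuous; apply/derivable1_diffP; have [] := dc.
  have nU : \forall t \near (0 : R), U (c t).
    by apply: cc; rewrite c0; exact: open_nbhs_nbhs.
  have ds : is_derive (0 : R) 1 (side \o c) ('D_w side (c 0)).
    by apply: curve_comp => //; have [] := side_derive (c 0) w.
  have z : is_derive (0 : R) 1 (side \o c) 0.
    apply: (@near_eq_is_derive _ _ _ (fun=> 0)).
    by apply: filterS2 nU cf => t Ut ft /=; apply: Logic.eq_sym; apply/(chart_frontier Ut).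
  have : 'D_w side (c 0) = 0 by rewrite -(@derive_val _ _ _ _ _ _ _ ds) (@derive_val _ _ _ _ _ _ _ z).
  rewrite c0 (side_derive x w).2 => /eqP; rewrite mulf_eq0 signr_eq0 /= subr_eq0.
  by move/eqP.
pose l (t : R) : 'rV[R]_n := col' i x + t *: col' i w.
have dl : is_derive (0 : R) 1 l (col' i w).
  exact: is_derive_affine.
exists (gphi \o l); split.
- by rewrite /= /l scale0r addr0; apply/Logic.eq_sym/side_eq0.
- have cl : {for 0, continuous (gphi \o l)}.
    apply: continuous_comp; first by apply: differentiable_continuous; apply/derivable1_diffP; have [] := dl.
    by apply: differentiable_continuous; have [] := gphi_derive (l 0) 0.
  have : \forall t \near (0 : R), U ((gphi \o l) t).
    apply: cl; rewrite /= /l scale0r addr0.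
    by rewrite -((side_eq0 x).1 s0); exact: open_nbhs_nbhs.
  by apply: filterS => t Ut; exact: gphi_frontier.
- have [dg Dg] := gphi_derive (l 0) (col' i w).
  have := curve_comp dl dg; rewrite Dg /= {2}/l scale0r addr0 -wi ins_col'.
  exact.
Qed.

End OneChart.
End Charts.

(** * Normal and shape operator in a chart *)

Section ChartGeometry.
Context {R : realType} {n : nat}.
Local Notation e_ j := (delta_mx ord0 j).
Variable Omega : set 'rV[R]_n.+1.

Lemma dotpE N (u v : 'rV[R]_N) : dotp u v = (u *m v^T) 0 0.
Proof. by rewrite mxE; apply: eq_bigr => a _; rewrite mxE. Qed.

Lemma dotpC N (u v : 'rV[R]_N) : dotp u v = dotp v u.
Proof. by apply: eq_bigr => a _; rewrite mulrC. Qed.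

Lemma dotpDl N (u v w : 'rV[R]_N) : dotp (u + v) w = dotp u w + dotp v w.
Proof. by rewrite -big_split; apply: eq_bigr => a _; rewrite rvD mulrDl. Qed.

Lemma dotpZl N c (u v : 'rV[R]_N) : dotp (c *: u) v = c * dotp u v.
Proof. by rewrite mulr_sumr; apply: eq_bigr => a _; rewrite rvZ mulrA. Qed.

Lemma dotpBl N (u v w : 'rV[R]_N) : dotp (u - v) w = dotp u w - dotp v w.
Proof. by rewrite dotpDl -scaleN1r dotpZl mulN1r. Qed.

Lemma dotpBr N (u v w : 'rV[R]_N) : dotp u (v - w) = dotp u v - dotp u w.
Proof. by rewrite dotpC dotpBl !(dotpC u). Qed.

Lemma dotpZr N c (u v : 'rV[R]_N) : dotp u (c *: v) = c * dotp u v.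
Proof. by rewrite dotpC dotpZl dotpC. Qed.

Lemma dotp_ge0 N (u : 'rV[R]_N) : 0 <= dotp u u.
Proof. by rewrite dotpE sqnorm_ge0. Qed.

Lemma dotp_eq0 N (u : 'rV[R]_N) : dotp u u = 0 -> u = 0.
Proof. by rewrite dotpE => /sqnorm_eq0. Qed.

Lemma derive_pos_near (f : R -> R) d : is_derive (0 : R) (1 : R) f d -> f 0 = 0 -> 0 < d ->
  \forall t \near 0^'+, 0 < f t.
Proof.
move=> [df <-] f0 d0.
have H : (h^-1 *: (f (h *: (1 : R) + 0) - f 0)) @[h --> (0 : R)^'] --> 'D_1 f 0 by exact: df.
have {}H : \forall h \near (0 : R)^', 0 < h^-1 *: (f (h *: (1 : R) + 0) - f 0).
  exact: (cvgr_gt _ H _ d0).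
move: H => /nbhs_ballP[e /= e0 He]; exists e => //= t te t0.
have := He t te (lt0r_neq0 t0).
by rewrite f0 subr0 addr0 [t *: 1]mulr1 pmulr_rgt0 // invr_gt0.
Qed.

Definition rowv N (f : 'I_N -> @smooth_fun R n) (y : 'rV[R]_n) : 'rV[R]_N := \row_a f a y.

Lemma rowv_derive N (f : 'I_N -> @smooth_fun R n) y v : differentiable (rowv f) y /\
  'D_v (rowv f) y = \row_a 'D_v (f a) y.
Proof.
have E : rowv f = \sum_(a < N) (fun y => f a y *: (e_ a : 'rV[R]_N)).
  by apply/funext => z; rewrite fct_sumE [LHS]row_sum_delta; apply: eq_bigr => a _; rewrite mxE.
have da a : differentiable (fun y => f a y *: (e_ a : 'rV[R]_N)) y.
  exact/differentiableZl/smooth_fun_diff.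
have dE : differentiable (rowv f) y by rewrite E; exact: differentiable_sum.
split=> //; rewrite E derive_sum; last by move=> a; exact: diff_derivable.
rewrite [RHS]row_sum_delta; apply: eq_bigr => a _.
rewrite !deriveE // [in RHS]mxE ?deriveE ?diffZl //; exact: smooth_fun_diff.
Qed.

Section OneChart.
Variables (i : 'I_n.+1) (b : bool) (g : @smooth_fun R n) (U : set 'rV[R]_n.+1).
Hypothesis cU : chart_on Omega i b g U.
Local Notation nuv := (nuv i b g).
Local Notation mev y := (map_mx (sev y)).

Lemma nuv1 y : dotp (nuv y) (nuv y) = 1.
Proof.
rewrite dotpE -[nuv y]/(mev y (cnu i b g)) map_trmx -map_mxM cnu1.
by rewrite map_scalar_mx mxE rmorph1.
Qed.

Lemma mev_tan y (Z : 'rV[@smooth_fun R n]_n.+1) : Z *m (cnu i b g)^T = 0 -> dotp (mev y Z) (nuv y) = 0.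
Proof.
move=> Zn; rewrite dotpE -[nuv y]/(mev y (cnu i b g)) map_trmx -map_mxM Zn.
by rewrite map_mx0 mxE.
Qed.

Lemma side_derive_nuv y : (-1) ^+ b * (nuv y 0 i - 'D_(col' i (nuv y)) g y) = - cnorm i g y.
Proof.
have := nuv1 y; rewrite dotp_nuv => H.
have W0 : cnorm i g y != 0 by rewrite gt_eqF // cnorm_gt0.
set X := (_ - _) in H *.
have -> : (-1) ^+ b * X = - cnorm i g y * (- (-1) ^+ b / cnorm i g y * X) by field.
by rewrite H mulr1.
Qed.

Lemma side_line x v : side i b g x = 0 ->
  is_derive (0 : R) (1 : R) (fun t => side i b g (x + t *: v))
    ((-1) ^+ b * (v 0 i - 'D_(col' i v) g (col' i x))).
Proof.
move=> s0; rewrite -(side_derive i b g x v).2.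
have := @derive_line R _ (side i b g) x v 0; rewrite scale0r addr0; apply.
by apply: diff_derivable; have [] := side_derive i b g x v.
Qed.

(** [normal] is a choice, so uniqueness is required. Orthogonality to the tangent vectors and unit
    length leave nu and - nu, and the outward condition excludes - nu, along which [side] becomes
    positive. *)
Lemma chart_normal x : U x -> frontier Omega x -> normal Omega x = nuv (col' i x).
Proof.
move=> Ux fx; have s0 := (chart_frontier cU Ux).1 fx.
set y := col' i x; rewrite /normal; set P := [set v : 'rV[R]_n.+1 | _].
have tan w : tangent (frontier Omega) x w <-> dotp w (nuv y) = 0 := chart_tangent cU w Ux fx.
have Pnu : P (nuv y).
  split; first by rewrite /enorm nuv1 sqrtr1.
  - by move=> w /tan; rewrite dotpC.
  - have dl := side_line (nuv y) s0; rewrite side_derive_nuv in dl.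
    have dl' : is_derive (0 : R) (1 : R) (fun t => - side i b g (x + t *: nuv y)) (cnorm i g y).
      by have := is_deriveN dl; rewrite opprK.
    have nl := derive_pos_near dl' _ (cnorm_gt0 i g y).
    have {}nl : \forall t \near 0^'+, 0 < - side i b g (x + t *: nuv y).
      by apply: nl; rewrite scale0r addr0 s0 oppr0.
    near=> t => /(chart_closure cU) h.
    have : 0 < - side i b g (x + t *: nuv y) by near: t.
    rewrite oppr_gt0 ltNge h //; near: t; exact: (open_line _ cU.1 Ux).
suff H v : P v -> v = nuv y.
  by apply: H; exact: (xgetPex point (ex_intro _ _ Pnu)).
move=> [v1 vtan vout].
have v1' : dotp v v = 1.
  have : Num.sqrt (dotp v v) = 1 by [].
  by move/(congr1 (fun z => z ^+ 2)); rewrite sqr_sqrtr ?dotp_ge0 // expr1n.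
pose c := dotp v (nuv y); pose w := v - c *: nuv y.
have wn : dotp w (nuv y) = 0 by rewrite dotpBl dotpZl nuv1 mulr1 subrr.
have vw : dotp v w = 0 by apply: vtan; apply/tan.
have vE : v = c *: nuv y.
  apply/eqP; rewrite -subr_eq0; apply/eqP; apply: dotp_eq0.
  rewrite -/w; transitivity (dotp v w - c * dotp (nuv y) w).
    by rewrite -dotpZl -dotpBl.
  by rewrite vw (dotpC (nuv y)) wn mulr0 subr0.
have : c ^+ 2 = 1 by rewrite -v1' vE dotpZl dotpZr nuv1 mulr1.
move=> /eqP; rewrite sqrf_eq1 => /orP[/eqP c1|/eqP c1]; first by rewrite vE c1 scale1r.
exfalso; have dl := side_line v s0.
have dv : (-1) ^+ b * (v 0 i - 'D_(col' i v) g (col' i x)) = cnorm i g y.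
  rewrite vE c1 rvZ (_ : col' i (-1 *: nuv y) = -1 *: col' i (nuv y)); last first.
    by apply/rowP => j; rewrite !mxE.
  rewrite (_ : 'D_(-1 *: col' i (nuv y)) g (col' i x) = - 'D_(col' i (nuv y)) g (col' i x)); last first.
    by rewrite !(deriveE _ (smooth_fun_diff g (col' i x))) linearZ /= scaleN1r.
  by rewrite mulN1r -opprD mulrN side_derive_nuv opprK.
rewrite dv in dl.
have nl : \forall t \near 0^'+, 0 < side i b g (x + t *: v).
  by apply: (derive_pos_near dl _ (cnorm_gt0 i g y)); rewrite scale0r addr0.
have : \forall t \near (0 : R)^'+, False.
  near=> t; have : ~ closure Omega (x + t *: v) by near: t.
  apply; apply/(chart_closure cU); first by near: t; exact: (open_line _ cU.1 Ux).
  by apply: ltW; near: t.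
by move=> /filter_ex[].
Unshelve. all: by end_near. Qed.

Lemma near_chart_curve x v (c : R -> 'rV[R]_n.+1) : U x -> curve_in (frontier Omega) x v c ->
  \forall t \near (0 : R), U (c t) /\ frontier Omega (c t).
Proof.
move=> Ux [c0 cf dc]; have [oU _] := cU.
have cc : {for 0, continuous c}.
  by apply: differentiable_continuous; apply/derivable1_diffP; have [] := dc.
have nU : \forall t \near (0 : R), U (c t) by apply: cc; rewrite c0; exact: open_nbhs_nbhs.
by apply: filterS2 nU cf.
Qed.

Lemma derive_col' (h : @smooth_fun R n) (w : 'rV[R]_n.+1) y :
  'D_(col' i w) h y = \sum_a w 0 a * cpart i a h y.
Proof.
rewrite (derive_sum_coord _ (smooth_fun_diff h y)) (bigD1_ord i) //=.
rewrite {1}/cpart unlift_none mulr0 add0r; apply: eq_bigr => j _.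
by rewrite /cpart liftK [col' i w 0 j]mxE.
Qed.

(** [cshape] uses projected derivatives; they differ from the partials by a multiple of nu_c, which
    contributes nothing against a tangent w. *)
Lemma nuv_derive y w : dotp w (nuv y) = 0 ->
  differentiable nuv y /\ 'D_(col' i w) nuv y = w *m mev y (cshape i b g).
Proof.
move=> wn; have E : nuv = rowv (fun a => cnu i b g 0 a).
  by apply/funext => z; apply/rowP => a; rewrite !mxE.
have [d D] := rowv_derive (fun a => cnu i b g 0 a) y (col' i w).
rewrite E; split=> //; rewrite D; apply/rowP => a; rewrite mxE derive_col' [RHS]mxE.
transitivity (\sum_c w 0 c * cpart i c (cnu i b g 0 a) y
   - (\sum_c w 0 c * cnu i b g 0 c y) * (dnormal (cpart i) (cgrad i g) (ctau i b g) (cnu i b g 0 a)) y).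
  rewrite (_ : \sum_c _ * cnu i b g 0 c y = 0) ?mul0r ?subr0 //.
  by rewrite -[RHS]wn; apply: eq_bigr => c _; rewrite [nuv _ _ _]mxE.
rewrite mulr_suml -sumrB; apply: eq_bigr => c _.
have -> : mev y (cshape i b g) c a = cdel i b g c (cnu i b g 0 a) y.
  by rewrite mxE /cshape /shape_mx [X in sev y X]mxE.
rewrite /cdel /gdel smooth_addE smooth_oppE smooth_mulE -/(cnu i b g) mulrBr mulrA //.
Qed.

(** The derivative of the normal along a curve depends only on the velocity, so the chosen vector is
    unique. The chart formula for [normal] holds on the boundary inside U, where the curve stays
    near t = 0. *)
Lemma chart_shape x w : U x -> frontier Omega x -> tangent (frontier Omega) x w ->
  shape Omega x w = w *m mev (col' i x) (cshape i b g).
Proof.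
move=> Ux fx tw; set y := col' i x; rewrite /shape; set P := [set z : 'rV[R]_n.+1 | _].
have wn : dotp w (nuv y) = 0 by apply/(chart_tangent cU w Ux fx).
have [dn Dn] := nuv_derive wn.
have H c : curve_in (frontier Omega) x w c ->
    is_derive (0 : R) (1 : R) (fun t => normal Omega (c t)) (w *m mev y (cshape i b g)).
  move=> cc; have nc := near_chart_curve Ux cc; have [c0 _ dc] := cc.
  apply: (@near_eq_is_derive _ _ _ (nuv \o (col' i \o c))).
    apply: filterS nc => t [Ut ft] /=.
    by rewrite (chart_normal Ut ft).
  have [dcol Dcol] := col'_derive i (c 0) w.
  have d1 : is_derive (0 : R) (1 : R) (col' i \o c) (col' i w).
    by rewrite -Dcol; exact: curve_comp.
  have := curve_comp (F := nuv) d1; rewrite /= c0 -/y Dn; exact.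
have [c cc] := tw.
have Pw : P (w *m mev y (cshape i b g)) by exists c; split=> //; exact: H.
have : P (get P) by exact: (xgetPex point (ex_intro _ _ Pw)).
move=> [c' [cc' dc']].
by rewrite -(@derive_val _ _ _ _ _ _ _ dc') (@derive_val _ _ _ _ _ _ _ (H c' cc')).
Qed.

End OneChart.
End ChartGeometry.

(** * Curvature functions in a chart *)

Section ChartCurvature.
Context {R : realType} {n : nat}.
Variable Omega : set 'rV[R]_n.+1.

(** Applied to evaluation at a point, it specializes the smooth sigma_j and T_j to those of a real
    matrix. *)
Lemma trsig_map (F G : comNzRingType) N (c : nat -> F) (d : nat -> G) (f : {rmorphism F -> G})
    (A : 'M[F]_N) j : (forall m, f (c m) = d m) ->
  f (trsig c A j) = trsig d (map_mx f A) j /\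
  map_mx f (trnewt c A j) = trnewt d (map_mx f A) j.
Proof.
move=> fc; elim: j => [|j [IH1 IH2]]; first by rewrite /trsig /trnewt /= rmorph1 map_mx1.
have e : f (trsig c A j.+1) = trsig d (map_mx f A) j.+1.
  rewrite /trsig /= rmorphM /= fc; congr (_ * _).
  by rewrite -/(trnewt c A j) -/(trnewt d (map_mx f A) j) -IH2 -map_mxM trace_map_mx.
by split=> //; rewrite !trnewtS map_mxB map_scalar_mx e map_mxM IH2.
Qed.

Variables (i : 'I_n.+1) (b : bool) (g : @smooth_fun R n) (U : set 'rV[R]_n.+1).
Hypothesis cU : chart_on Omega i b g U.
Local Notation nuv := (nuv i b g).
Local Notation mev y := (map_mx (sev y)).
Local Notation cshape := (cshape i b g).

Lemma dotp0_mx N (u v : 'rV[R]_N) : dotp u v = 0 <-> u *m v^T = 0.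
Proof.
rewrite dotpE; split=> [h|->]; last by rewrite mxE.
by rewrite [LHS]mx11_scalar h raddf0.
Qed.

Lemma mev_shape_sym y : (mev y cshape)^T = mev y cshape.
Proof. by rewrite map_trmx cshape_sym. Qed.

Lemma nuv_shape y : nuv y *m mev y cshape = 0.
Proof.
rewrite -[nuv y]/(mev y (cnu i b g)) -map_mxM.
have -> : cnu i b g *m cshape = 0.
  by rewrite -[LHS]trmxK trmx_mul cshape_sym cshape_nu trmx0.
exact: map_mx0.
Qed.

Lemma nuv_mx1 y : nuv y *m (nuv y)^T = 1%:M.
Proof. by rewrite [LHS]mx11_scalar -dotpE nuv1. Qed.

Section AtPoint.
Variable x : 'rV[R]_n.+1.
Hypotheses (Ux : U x) (fx : frontier Omega x).
Let y := col' i x.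

Lemma gphi_at : gphi i g y = x.
Proof. exact/Logic.eq_sym/(side_eq0 i b g x)/(chart_frontier cU Ux). Qed.

Lemma tangent_mx w : tangent (frontier Omega) x w <-> w *m (nuv y)^T = 0.
Proof. by rewrite (chart_tangent cU w Ux fx) dotp0_mx. Qed.

(** The spectral theorem produces a witness, so the chosen curvatures are genuine eigenvalues at x;
    nothing is claimed about their dependence on x. *)
Lemma curvatures_spec : exists e : 'I_n -> 'rV[R]_n.+1,
  [/\ forall l, tangent (frontier Omega) x (e l),
      forall l m, dotp (e l) (e m) = (l == m)%:R
    & forall l, shape Omega x (e l) = curvatures Omega x ord0 l *: e l].
Proof.
rewrite /curvatures; set P := [set kappa : 'rV[R]_n | _].
have [kappa [e [enu ee eS]]] := spectral_orthonormal (mev_shape_sym y) (nuv_mx1 y) (nuv_shape y).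
have Pk : P kappa.
  exists e; split.
  - by move=> l; apply/tangent_mx.
  - by move=> l m; rewrite dotpE ee mxE eqxx.
  - by move=> l; rewrite (chart_shape cU Ux fx) ?eS //; apply/tangent_mx.
exact: (xgetPex point (ex_intro _ _ Pk)).
Qed.

(** Whichever eigenvalue list is chosen, its symmetric functions are those of the trace recursion,
    and these are smooth in y. This is what makes the integrands continuous on the boundary. *)
Lemma chart_esym k : esym k (curvatures Omega x) = csig i b g k y.
Proof.
have [e' [tan ortho eig]] := curvatures_spec; move: (curvatures Omega x) eig => kap eig.
rewrite -(@esym_trsig _ _ kap (mev y cshape) (nuv y) e' (nuv_mx1 y) (nuv_shape y)).
- by have [+ _] := @trsig_map _ _ _ (@sinvn R n) (@invn R) (sev y) cshape k (fun=> Logic.eq_refl).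
- by move=> l; apply/tangent_mx.
- by move=> l m; rewrite [LHS]mx11_scalar -dotpE ortho.
- by move=> l; rewrite -(chart_shape cU Ux fx (tan l)) eig.
Qed.

Lemma chart_mean_curv k : mean_curv Omega k x = csig i b g k y / 'C(n, k)%:R.
Proof. by rewrite /mean_curv chart_esym. Qed.

Lemma mev_pos : mev y (cpos i g) = x.
Proof.
rewrite -[RHS]gphi_at; apply/rowP => a; rewrite !mxE.
by case: (unliftP i a).
Qed.

Lemma chart_support : support_fun Omega x = csupp i b g y.
Proof.
rewrite /support_fun (chart_normal cU Ux fx) dotpE -{1}mev_pos.
rewrite -[nuv _]/(mev y (cnu i b g)) map_trmx -map_mxM mxE //.
Qed.

Lemma chart_tang_part : tang_part Omega x = mev y (cXtan i b g).
Proof.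
rewrite /tang_part chart_support (chart_normal cU Ux fx) -{1}mev_pos.
by rewrite /cXtan /Xtan map_mxB map_mxZ.
Qed.

(** Tangency of w T_j is carried along because [shape] is known only on tangent vectors. With rows
    acted on from the right, A and T_j appear in the opposite order, hence the use of
    commutation. *)
Lemma chart_newton j w : w *m (nuv y)^T = 0 ->
  newton Omega x j w = w *m mev y (cnewt i b g j) /\
  (w *m mev y (cnewt i b g j)) *m (nuv y)^T = 0.
Proof.
move=> wn; have tanT l : w *m mev y (cnewt i b g l) *m (nuv y)^T = 0.
  rewrite -mulmxA.
  have -> : mev y (cnewt i b g l) *m (nuv y)^T = csig i b g l y *: (nuv y)^T.
    rewrite -[nuv y]/(mev y (cnu i b g)) map_trmx -map_mxM.
    have -> : cnewt i b g l *m (cnu i b g)^T = csig i b g l *: (cnu i b g)^T.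
      rewrite -[cnewt i b g l](trnewt_sym (@sinvn R n) l (cshape_sym i b g)) -trmx_mul.
      by rewrite (nu_trnewt (@sinvn R n) (cdel_nu i b g)) linearZ.
    by rewrite map_mxZ.
  by rewrite -scalemxAr wn scaler0.
split; last exact: tanT.
elim: j => [|j IH] /=.
  by rewrite /cnewt /trnewt /= map_mx1 mulmx1.
rewrite IH (chart_shape cU Ux fx); last by apply/tangent_mx.
rewrite chart_esym /cnewt trnewtS map_mxB map_scalar_mx mulmxBr mul_mx_scalar; congr (_ - _).
by rewrite (trnewt_comm (@sinvn R n)) map_mxM mulmxA.
Qed.

Lemma chart_newton_integrand k :
  dotp (newton Omega x k (shape Omega x (tang_part Omega x))) (tang_part Omega x) =
  (cXtan i b g *m cshape *m cnewt i b g k *m (cXtan i b g)^T) 0 0 y.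
Proof.
have Xn : mev y (cXtan i b g) *m (nuv y)^T = 0.
  by apply/dotp0_mx; apply: mev_tan; exact: cXtan_nu.
rewrite chart_tang_part (chart_shape cU Ux fx); last by apply/tangent_mx.
have XAn : mev y (cXtan i b g) *m mev y cshape *m (nuv y)^T = 0.
  rewrite -mulmxA -[nuv y]/(mev y (cnu i b g)) map_trmx -map_mxM cshape_nu map_mx0.
  by rewrite mulmx0.
have [-> _] := @chart_newton k _ XAn.
by rewrite dotpE map_trmx -!map_mxM mxE.
Qed.
End AtPoint.
End ChartCurvature.

(** * Surface integrals *)

Section DensityTransfer.
Local Open Scope ereal_scope.
Context d1 d2 (X : measurableType d1) (Y : measurableType d2) (R : realType).
Variables (lam : {measure set X -> \bar R}) (mu : {measure set Y -> \bar R}).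
Variables (phi : X -> Y) (D : set X) (A : set Y) (w : X -> R).
Hypotheses (mD : measurable D) (mA : measurable A).
Hypotheses (mphi : measurable_fun [set: X] phi) (mw : measurable_fun [set: X] w).
Hypotheses (w0 : forall x, (0 <= w x)%R) (DA : D `<=` phi @^-1` A).
Hypothesis muE : forall E, measurable E -> E `<=` A ->
  mu E = \int[lam]_(x in D `&` phi @^-1` E) (w x)%:E.

Import HBNNSimple.

Let mwE : measurable_fun D (fun x => (w x)%:E).
Proof. by apply/measurable_EFinP; exact: measurable_funTS. Qed.

Let mindic B : measurable B -> measurable_fun [set: X] (fun x => \1_B (phi x) : R).
Proof.
move=> mB; rewrite (_ : (fun x => _) = \1_(phi @^-1` B)).
  by apply: measurable_indic; rewrite -[X in measurable X]setTI; exact: mphi.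
by apply/funext => x; rewrite !indicE.
Qed.

Let transfer_indic B (r : R) : measurable B -> (0 <= r)%R ->
  \int[mu]_(y in A) (r * \1_B y)%:E = \int[lam]_(x in D) ((r * \1_B (phi x))%:E * (w x)%:E).
Proof.
move=> mB r0.
have mB' : measurable (phi @^-1` B) by rewrite -[X in measurable X]setTI; exact: mphi.
under eq_integral do rewrite EFinM.
rewrite ge0_integralZl //; last first.
- by apply/measurable_EFinP; exact: measurable_indic.
rewrite integral_indic // muE; [|exact: measurableI|by move=> y []].
under [RHS]eq_integral do rewrite EFinM -muleA.
rewrite ge0_integralZl //; last 2 first.
- apply: emeasurable_funM => //; apply/measurable_EFinP.
  by apply: measurable_funTS; exact: mindic.
- by move=> x _; rewrite mule_ge0 // lee_fin.
congr (_ * _).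
rewrite (_ : D `&` _ = D `&` (phi @^-1` B)); last first.
  apply/seteqP; split=> x [Dx] /=; first by move=> [].
  by move=> Bx; split=> //; split=> //; exact: DA.
rewrite integral_mkcondr; apply: eq_integral => x _; rewrite patchE indicE.
have -> : (x \in phi @^-1` B) = (phi x \in B) by apply/idP/idP; rewrite !inE.
by case: ifP => _; rewrite ?mul1e ?mul0e.
Qed.

(** The density formula is given on sets; indicators, simple functions and monotone convergence
    extend it to nonnegative functions. *)
Lemma ge0_density_transfer (f : Y -> \bar R) : measurable_fun A f -> (forall y, A y -> 0 <= f y) ->
  \int[mu]_(y in A) f y = \int[lam]_(x in D) (f (phi x) * (w x)%:E).
Proof.
move=> mf f0; pose h := nnsfun_approx mA mf.
have mhphi n : measurable_fun D (fun x => (h n (phi x))%:E).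
  by apply/measurable_EFinP; apply: measurable_funTS; exact: measurableT_comp.
have transfer_h n : \int[mu]_(y in A) (h n y)%:E = \int[lam]_(x in D) ((h n (phi x))%:E * (w x)%:E).
  transitivity (\int[mu]_(y in A) (\sum_(r \in range (h n)) (r * \1_(h n @^-1` [set r]) y)%:E)).
    by apply: eq_integral => y _; rewrite fimfunE -fsumEFin.
  rewrite ge0_integral_fsum //; last 2 first.
  - by move=> r; apply/measurable_EFinP; apply: measurable_funM => //; exact: measurable_indic.
  - by move=> r y _; exact: nnfun_muleindic_ge0.
  transitivity (\int[lam]_(x in D) (\sum_(r \in range (h n)) ((r * \1_(h n @^-1` [set r]) (phi x))%:E * (w x)%:E))).
    rewrite ge0_integral_fsum //; last 2 first.
    - move=> r; apply: emeasurable_funM => //; apply/measurable_EFinP; apply: measurable_funTS.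
      by apply: measurable_funM => //; exact: mindic.
    - by move=> r x _; rewrite mule_ge0 ?lee_fin //; exact: nnfun_muleindic_ge0.
    apply: eq_fsbigr => r; rewrite inE => -[y _ <-]; exact: transfer_indic.
  apply: eq_integral => x _; rewrite -ge0_mule_fsuml; last first.
    by move=> r; exact: nnfun_muleindic_ge0.
  by rewrite fsumEFin // -(fimfunE _ (phi x)).
transitivity (limn (fun n => \int[mu]_(y in A) (h n y)%:E)).
  rewrite -monotone_convergence //.
  - by apply: eq_integral => y /[!inE] yA; apply/Logic.eq_sym/cvg_lim => //; exact: cvg_nnsfun_approx.
  - by move=> n; apply/measurable_EFinP; exact: measurable_funTS.
  - by move=> n y _; rewrite lee_fin.
  - by move=> y _ a c ac; rewrite lee_fin; exact/lefP/nd_nnsfun_approx.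
under eq_fun do rewrite transfer_h.
rewrite -monotone_convergence //.
- apply: eq_integral => x /[!inE] xD; apply/cvg_lim => //; apply: cvgeZr => //.
  by apply: cvg_nnsfun_approx => //; exact: DA.
- by move=> n; exact: emeasurable_funM.
- by move=> n x _; rewrite mule_ge0 // lee_fin.
- move=> x _ a c ac; rewrite lee_wpmul2r ?lee_fin //.
  exact/lefP/nd_nnsfun_approx.
Qed.
End DensityTransfer.

(** * The area measure of a graph patch *)

Section ChartArea.
Context {R : realType} {n : nat}.
Local Notation e_ j := (delta_mx ord0 j).

(* Both sides are the determinant of the block matrix [[1, -u], [u^T, 1]]. *)
Lemma det_rank1_update (u : 'rV[R]_n) : \det (1%:M + u^T *m u) = 1 + (u *m u^T) 0 0.
Proof.
pose M : 'M[R]_(1 + n) := block_mx 1%:M (- u) u^T 1%:M.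
have e1 : \det M = \det (1%:M + u^T *m u).
  have : \det (block_mx 1%:M 0 (- u^T) 1%:M *m M) = \det (1%:M + u^T *m u).
    rewrite mulmx_block !mul1mx !mul0mx !addr0 mulmx1 addNr mulNmx mulmxN opprK.
    by rewrite det_ublock det1 mul1r addrC.
  by rewrite det_mulmx det_lblock !det1 !mul1r.
have : \det (block_mx 1%:M u 0 1%:M *m M) = 1 + (u *m u^T) 0 0.
  rewrite mulmx_block !mul1mx !mul0mx !mulmx1 !add0r addNr.
  by rewrite det_lblock det1 mulr1 det_mx11 mxE mxE eqxx.
by rewrite det_mulmx det_ublock !det1 !mul1r e1.
Qed.

Variables (Omega : set 'rV[R]_n.+1) (i : 'I_n.+1) (b : bool) (g : @smooth_fun R n).
Variable (U : set 'rV[R]_n.+1).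
Hypothesis cU : chart_on Omega i b g U.
Local Notation gphi := (gphi i g).
Local Notation S := (frontier Omega).
Definition cdom := gphi @^-1` U.

Lemma gphi_continuous : continuous gphi.
Proof. by move=> y; apply: differentiable_continuous; have [] := gphi_derive i g y 0. Qed.

Lemma cdom_open : open cdom.
Proof. by have [oU _] := cU; apply: open_comp => // y _; exact: gphi_continuous. Qed.

Lemma jacobian_gphi y j : row j ('J gphi y) = ins i ('D_(e_ j) g y, e_ j).
Proof.
have [d D] := gphi_derive i g y (e_ j).
by rewrite -D deriveEjacobian // rowE.
Qed.

Lemma jacobian_gphi_coord y j l : ('J gphi y) j (lift i l) = (l == j)%:R.
Proof.
transitivity (row j ('J gphi y) 0 (lift i l)); first by rewrite [RHS]mxE.
by rewrite jacobian_gphi ins_lift /= rv_delta.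
Qed.

Lemma jacobian_gphi_i y j : ('J gphi y) j i = 'D_(e_ j) g y.
Proof.
transitivity (row j ('J gphi y) 0 i); first by rewrite [RHS]mxE.
by rewrite jacobian_gphi ins_i.
Qed.

(** The Gram matrix is 1 + u^T u with u the gradient of g, so its determinant is 1 + |u|^2, the
    squared length of [cgrad]. *)
Lemma gram_gphi y : Num.sqrt (\det ('J gphi y *m ('J gphi y)^T)) = cnorm i g y.
Proof.
pose u : 'rV[R]_n := \row_j 'D_(e_ j) g y.
have -> : 'J gphi y *m ('J gphi y)^T = 1%:M + u^T *m u.
  apply/matrixP => j l; rewrite mxE (bigD1_ord i) //= [('J gphi y)^T i l]mxE !jacobian_gphi_i.
  rewrite addrC [RHS]mxE; congr (_ + _).
    rewrite (bigD1 j) //= [('J gphi y)^T _ _]mxE !jacobian_gphi_coord eqxx mul1r [RHS]mxE big1 ?addr0 //.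
    by move=> k kj; rewrite jacobian_gphi_coord (negPf kj) mul0r.
  by rewrite [RHS]mxE big_ord1 !mxE.
rewrite det_rank1_update; congr (Num.sqrt _).
rewrite /cnorm2 smooth_sumE (bigD1_ord i) //; congr (_ + _).
  by rewrite expr2 smooth_mulE (cgrad_i i g y) mulr1.
rewrite mxE; apply: eq_bigr => j _.
by rewrite expr2 smooth_mulE !(cgrad_lift i g j y) mulrNN [u^T _ _]mxE mxE.
Qed.

Lemma smooth_gphi : smooth_on setT gphi.
Proof.
move=> k; apply: (@Ck_on_ext _ _ _ _ _ (fun y => ins_lin i y + g y *: e_ i)).
  by move=> y; rewrite -[gphi y]/(ins i (g y, y)) ins_split.
apply: Ck_on_add; first by apply: Ck_on_linear; exact: ins_lin_continuous.
by apply: Ck_on_scale; exact: smooth_funP.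
Qed.

Lemma chart_local_param : local_param S cdom gphi.
Proof.
split.
- exact: cdom_open.
- by move=> k; apply: (@Ck_on_sub _ _ _ setT) => //; exact: smooth_gphi.
- by move=> _ [y Vy <-]; exact: (gphi_frontier cU).
- move=> y z _ _ e; have := congr1 (col' i) e.
  by rewrite !col'_ins.
- move=> y _; apply/row_freeP; exists (\matrix_(a, l) (a == lift i l)%:R).
  apply/matrixP => j l; rewrite mxE (bigD1 (lift i l)) //= big1 ?addr0.
    by rewrite mxE eqxx mulr1 jacobian_gphi_coord !mxE eq_sym.
  by move=> a al; rewrite mxE (negPf al) mulr0.
Qed.

Variable mu : {measure set 'rV[R]_n.+1 -> \bar R}.
Hypothesis hmu : area_measure S mu.

Lemma frontier_closed : closed S.
Proof.
rewrite /frontier setDE; apply: closedI; first exact: closed_closure.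
by apply: open_closedC; exact: open_interior.
Qed.

Lemma patch_measurable : measurable (S `&` U).
Proof.
apply: measurableI; first exact: rV_closed_measurable frontier_closed.
by apply: rV_open_measurable; have [] := cU.
Qed.

Lemma patch_image : gphi @` cdom = S `&` U.
Proof.
apply/seteqP; split=> [_ [y Vy <-]|x [Sx Ux]].
  by split=> //; exact: (gphi_frontier cU).
have xE := (side_eq0 i b g x).1 ((chart_frontier cU Ux).1 Sx).
by exists (col' i x) => //; rewrite /cdom /preimage /mkset -xE.
Qed.

Lemma chart_mu E : measurable E -> E `<=` S `&` U ->
  mu E = (\int[leb n]_(y in cdom `&` gphi @^-1` E) (cnorm i g y)%:E)%E.
Proof.
have [_ H] := hmu => mE EA.
rewrite (H _ _ chart_local_param E mE); last by rewrite patch_image.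
by rewrite lebE; under eq_integral do rewrite gram_gphi.
Qed.

Lemma gphi_measurable : measurable_fun [set: 'rV[R]_n] gphi.
Proof.
apply: (@measurability _ _ _ 'rV[R]_n.+1 _ _ (@open 'rV[R]_n.+1)) => //.
move=> _ [V oV <-]; rewrite setTI; apply: rV_open_measurable.
by apply: open_comp => // y _; exact: gphi_continuous.
Qed.

Lemma chart_ge0_integral (f : 'rV[R]_n.+1 -> \bar R) :
  measurable_fun (S `&` U) f -> (forall x, (S `&` U) x -> (0 <= f x)%E) ->
  (\int[mu]_(x in S `&` U) f x = \int[leb n]_(y in cdom) (f (gphi y) * (cnorm i g y)%:E))%E.
Proof.
move=> mf f0; apply: ge0_density_transfer => //.
- exact: rV_open_measurable cdom_open.
- exact: patch_measurable.
- exact: gphi_measurable.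
- by apply: continuous_rV_measurable => //; exact: smooth_fun_cont.
- by move=> y; rewrite ltW // cnorm_gt0.
- by move=> y Vy; rewrite /preimage /mkset -patch_image; exists y.
- exact: chart_mu.
Qed.

Definition lift_chart (h : 'rV[R]_n -> R) (x : 'rV[R]_n.+1) : R :=
  if `[< U x >] then h (col' i x) else 0.

Lemma lift_chart_ge0_integral (h : 'rV[R]_n -> R) M : continuous h -> (forall y, 0 <= h y) ->
  (forall y, h y != 0 -> cube M y /\ U (gphi y)) ->
  (\int[mu]_(x in S) (lift_chart h x)%:E = \int[leb n]_y (h y * cnorm i g y)%:E)%E.
Proof.
move=> ch h0 hM.
transitivity (\int[mu]_(x in S `&` U) (h (col' i x))%:E)%E.
  rewrite [RHS]integral_mkcondr; apply: eq_integral => x _; rewrite patchE /lift_chart.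
  by case: asboolP => [Ux|nU]; [rewrite mem_set|rewrite memNset].
have chc : continuous (fun x : 'rV[R]_n.+1 => h (col' i x)).
  move=> x; apply: (@continuous_comp _ _ _ (col' i) h); [exact: col'_continuous|exact: ch].
rewrite chart_ge0_integral; last by move=> x _; rewrite lee_fin.
  rewrite [LHS]integral_mkcond; apply: eq_integral => y _; rewrite patchE -EFinM.
  rewrite -[gphi y]/(ins i (g y, y)) col'_ins /=; case: ifPn => //; rewrite notin_setE => nV.
  have [->|/hM[_ /nV]//] := eqVneq (h y) 0.
  by rewrite mul0r.
apply/measurable_EFinP; apply: continuous_rV_measurable => //.
exact: patch_measurable.
Qed.

Lemma chart_density_bb (h : 'rV[R]_n -> R) M : continuous h -> (forall y, h y != 0 -> cube M y) ->
  bb (fun y => h y * cnorm i g y).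
Proof.
move=> ch hM; apply: (@continuous_bb _ _ M) => [y|y]; last first.
  by apply: contra_neqP => nM; have [->|/hM//] := eqVneq (h y) 0; rewrite mul0r.
exact: (cvgM (ch y) (@smooth_fun_cont _ _ (cnorm i g) y)).
Qed.

Lemma lift_chart_measurable (h : 'rV[R]_n -> R) : continuous h -> measurable_fun S (lift_chart h).
Proof.
move=> ch; have [oU _] := cU.
rewrite /lift_chart; apply: measurable_funTS; apply: measurable_fun_ifT => //.
- apply: (measurable_fun_bool true); rewrite setTI (_ : _ @^-1` _ = U); last first.
    by apply/seteqP; split=> x /= => [/asboolP|/asboolP].
  exact: rV_open_measurable.
- apply: continuous_rV_measurable => // x.
  by apply: (@continuous_comp _ _ _ (col' i) h); [exact: col'_continuous|exact: ch].
Qed.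

(** The transfer formula covers nonnegative functions, so h is split into its positive and negative
    parts, both continuous with the same support bound. *)
Lemma lift_chart_integral (h : 'rV[R]_n -> R) M : continuous h ->
  (forall y, h y != 0 -> cube M y /\ U (gphi y)) ->
  mu.-integrable S (EFin \o lift_chart h) /\
  \int[mu]_(x in S) lift_chart h x = \int[leb n]_y (h y * cnorm i g y).
Proof.
move=> ch hM.
have mS : measurable S by exact: rV_closed_measurable frontier_closed.
pose hp y : R := Num.max (h y) 0; pose hn y : R := Num.max (- h y) 0.
have chp : continuous hp.
  by move=> y; apply: (@continuous_max _ _ h (fun=> 0)); [exact: ch|exact: cst_continuous].
have chn : continuous hn.
  move=> y; apply: (@continuous_max _ _ (fun y => - h y) (fun=> 0)); last exact: cst_continuous.
  exact: (cvgN (ch y)).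
have sp y : hp y != 0 -> cube M y /\ U (gphi y).
  move=> /eqP hy; apply: hM; apply: contra_notN hy => /eqP hy; by rewrite /hp hy maxxx.
have sn y : hn y != 0 -> cube M y /\ U (gphi y).
  move=> /eqP hy; apply: hM; apply: contra_notN hy => /eqP hy; by rewrite /hn hy oppr0 maxxx.
have hE y : h y = hp y - hn y.
  by rewrite /hp /hn; case: (lerP (h y) 0) => h0; case: (lerP (- h y) 0) => h1; lra.
have bp := chart_density_bb chp (fun y hy => (sp y hy).1).
have bn := chart_density_bb chn (fun y hy => (sn y hy).1).
have ge0_int (k : 'rV[R]_n -> R) : continuous k -> (forall y, 0 <= k y) ->
    (forall y, k y != 0 -> cube M y /\ U (gphi y)) -> mu.-integrable S (EFin \o lift_chart k) /\
  \int[mu]_(x in S) lift_chart k x = \int[leb n]_y (k y * cnorm i g y).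
  move=> ck k0 kM; have E := lift_chart_ge0_integral ck k0 kM.
  have bk := chart_density_bb ck (fun y hy => (kM y hy).1).
  split; last by rewrite /Rintegral E.
  apply/integrableP; split; first by apply/measurable_EFinP; exact: lift_chart_measurable.
  have lk0 x : 0 <= lift_chart k x by rewrite /lift_chart; case: ifP.
  rewrite (eq_integral (fun x => (lift_chart k x)%:E)); last first.
    by move=> x _; rewrite /= ger0_norm.
  have fin := integrable_fin_num measurableT (bb_integrable bk).
  by rewrite E ltey_eq; apply/orP; left; exact: fin.
have [ip Ep] := ge0_int hp chp (fun y => ltac:(by rewrite /hp le_max lexx orbT)) sp.
have [inn En] := ge0_int hn chn (fun y => ltac:(by rewrite /hn le_max lexx orbT)) sn.
have lE x : lift_chart h x = lift_chart hp x - lift_chart hn x.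
  by rewrite /lift_chart; case: ifP; rewrite ?subr0 // hE.
have -> : lift_chart h = (fun x => lift_chart hp x - lift_chart hn x) by apply/funext.
split.
  have := integrableB mS ip inn; rewrite (_ : (_ \- _)%E = EFin \o (fun x => lift_chart hp x - lift_chart hn x)) //.
rewrite RintegralB // Ep En -RintegralB //; [|exact: bb_integrable|exact: bb_integrable].
by apply: eq_Rintegral => y _; rewrite hE mulrBl.
Qed.

End ChartArea.

(** Replaces explicit finite subcovers: it serves for boundedness and finite area on the boundary
    and for the product of cutoffs. *)
Lemma compact_induction (T : ptopologicalType) (K : set T) (P : set T -> Prop) : compact K ->
  P set0 -> (forall A B, P A -> P B -> P (A `|` B)) ->
  (forall p, K p -> exists2 W, open_nbhs p W & P W) ->
  exists W, [/\ open W, K `<=` W & P W].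
Proof.
rewrite compact_cover => cK P0 PU loc.
pose W (p : T) := if pselect (K p) is left Kp then sval (cid2 (loc p Kp)) else set0.
have WK p : K p -> open_nbhs p (W p) /\ P (W p).
  by move=> Kp; rewrite /W; case: pselect => // Kp'; case: cid2.
have oW p : K p -> open (W p) by move=> /WK[[]].
have KW : K `<=` cover K W by move=> p Kp; exists p => //; have [[]] := WK _ Kp.
have [D DK KD] := cK _ K W oW KW.
have {}KD x : K x -> exists2 p, p \in finmap.enum_fset D & W p x by move=> /KD[p pD Wp]; exists p.
have : forall p, p \in finmap.enum_fset D -> K p by move=> p pD; apply/set_mem; exact: DK.
move: (finmap.enum_fset D) KD => s KD sK.
have [V [oV sV PV]] : exists V, [/\ open V, forall p, p \in s -> W p `<=` V & P V].
  elim: s {KD} sK => [|p s IH] sK; first by exists set0; split=> //; exact: open0.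
  have [|V [oV sV PV]] := IH; first by move=> q qs; apply: sK; rewrite inE qs orbT.
  have Kp : K p by apply: sK; rewrite inE eqxx.
  exists (W p `|` V); split.
  - by apply: openU => //; exact: oW.
  - move=> q; rewrite inE => /orP[/eqP->|/sV qV]; first by move=> x; left.
    by move=> x /qV; right.
  - by apply: PU => //; have [] := WK _ Kp.
by exists V; split=> // x /KD[p /sV]; apply.
Qed.

(** * Divergence theorems *)

Section C1Functions.
Context {R : realType} {N : nat}.
Local Notation e_ j := (delta_mx ord0 j).
Implicit Types F G : 'rV[R]_N -> R.

Lemma C1f_cst (c : R) : C1f (fun _ : 'rV[R]_N => c).
Proof. exact: (smooth_C1f (scst c)). Qed.

Lemma C1f_derivable F x v : C1f F -> derivable F x v.
Proof. by move=> [dF _]; exact: diff_derivable. Qed.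

Lemma C1f_deriveD F G x v : C1f F -> C1f G ->
  'D_v (fun y => F y + G y) x = 'D_v F x + 'D_v G x.
Proof. by move=> cF cG; apply: deriveD; exact: C1f_derivable. Qed.

Lemma C1f_deriveM F G x v : C1f F -> C1f G ->
  'D_v (fun y => F y * G y) x = F x * 'D_v G x + G x * 'D_v F x.
Proof. by move=> cF cG; apply: deriveM; exact: C1f_derivable. Qed.

Lemma C1f_add F G : C1f F -> C1f G -> C1f (fun y => F y + G y).
Proof.
move=> cF cG; split=> [x|a].
  by apply: differentiableD; [case: cF|case: cG].
rewrite (_ : 'D_(e_ a) _ = fun x => 'D_(e_ a) F x + 'D_(e_ a) G x); last first.
  by apply/funext => x; exact: C1f_deriveD.
by move=> x; exact: (cvgD (cF.2 a x) (cG.2 a x)).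
Qed.

Lemma C1f_mul F G : C1f F -> C1f G -> C1f (fun y => F y * G y).
Proof.
move=> cF cG; split=> [x|a].
  by apply: differentiableM; [case: cF|case: cG].
rewrite (_ : 'D_(e_ a) _ = fun x => F x * 'D_(e_ a) G x + G x * 'D_(e_ a) F x); last first.
  by apply/funext => x; exact: C1f_deriveM.
move=> x; exact: (cvgD (cvgM (C1f_cont cF (x:=x)) (cG.2 a x)) (cvgM (C1f_cont cG (x:=x)) (cF.2 a x))).
Qed.

Lemma C1f_comp (q q' : R -> R) F : continuous q' -> (forall t, is_derive t (1 : R) q (q' t)) ->
  C1f F -> C1f (fun y => q (F y)).
Proof.
move=> cq dq cF; have H x := derive_comp_R (cF.1 x) (dq (F x)).
split=> [x|a]; first by have [] := H x.
rewrite (_ : 'D_(e_ a) _ = fun x => q' (F x) * 'D_(e_ a) F x); last first.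
  by apply/funext => x; have [_ ->] := H x.
move=> x; apply: (cvgM _ (cF.2 a x)).
by apply: (@continuous_comp _ _ _ F q'); [exact: C1f_cont|exact: cq].
Qed.

(* A C^1 square is enough to build cutoffs. *)
Definition sqpos (t : R) : R := Num.max 0 t ^+ 2.

Lemma maxr0_continuous : continuous (fun t : R => Num.max 0 t).
Proof. by move=> t; apply: (@continuous_max _ _ (fun=> 0) id); [exact: cst_continuous|exact: cvg_id]. Qed.

Lemma sqpos_derive t : is_derive t (1 : R) sqpos (2 * Num.max 0 t).
Proof.
have H : (h^-1 *: ((sqpos \o shift t) (h *: (1 : R)) - sqpos t)) @[h --> 0^'] --> (2 * Num.max 0 t).
  apply/cvgrPdist_le => e e0; near=> h.
  have h0 : h != 0 by near: h; exact: nbhs_dnbhs_neq.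
  have he : `|h| <= e by near: h; exact: dnbhs0_le.
  rewrite /= [h *: 1]mulr1 -[_ *: _]/(h^-1 * _).
  have -> : 2 * Num.max 0 t = h^-1 * (h * (2 * Num.max 0 t)) by rewrite mulrA mulVf // mul1r.
  rewrite -mulrBr normrM normfV ler_pdivrMl ?normr_gt0 //.
  (* The first-order Taylor error of [sqpos] is at most h^2. *)
  apply: (@le_trans _ _ (`|h| * `|h|)); last by rewrite ler_pM2l ?normr_gt0.
  rewrite -normrM /sqpos !expr2.
  have hh : 0 <= h * h by rewrite -expr2 sqr_ge0.
  rewrite (ger0_norm hh) ler_norml; case: (lerP 0 t) => t0; case: (lerP 0 (h + t)) => ht; apply/andP; split; nra.
split; first by apply/cvg_ex; exists (2 * Num.max 0 t).
by apply/cvg_lim.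
Unshelve. all: by end_near. Qed.

Lemma C1f_sqpos F : C1f F -> C1f (fun y => sqpos (F y)).
Proof.
apply: (C1f_comp (q' := fun t => 2 * Num.max 0 t)); last exact: sqpos_derive.
by move=> t; apply: cvgM; [exact: cst_continuous|exact: maxr0_continuous].
Qed.

Lemma sqpos_le0 t : t <= 0 -> sqpos t = 0.
Proof. by move=> t0; rewrite /sqpos (max_idPl t0) expr0n. Qed.

Lemma sqpos_ge1 t : 1 <= t -> 1 <= sqpos t.
Proof.
move=> t1; have t0 : 0 <= t by exact: le_trans t1.
by rewrite /sqpos (max_idPr t0) expr2; nra.
Qed.

(** The function f = 2 - 2 |x - p|^2 / e^2 exceeds 1 near p and is at most 0 outside the ball of
    radius e. Applying t |-> 1 - [sqpos] (1 - [sqpos] t) flattens it to exactly 1 where f >= 1 and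
    to 0 where f <= 0. *)
Lemma bump_exists (p : 'rV[R]_N) (W : set 'rV[R]_N) : nbhs p W ->
  exists b V, [/\ C1f b, open_nbhs p V, forall x, V x -> b x = 1
                & forall x, b x != 0 -> W x].
Proof.
move=> /nbhs_ballP[e /= e0 eW].
pose d2 : @smooth_fun R N := \sum_j (scoord j - scst (p 0 j)) ^+ 2.
have d2E x : d2 x = \sum_j (x 0 j - p 0 j) ^+ 2.
  by rewrite smooth_sumE; apply: eq_bigr => j _; rewrite !expr2 smooth_mulE.
pose l := 2 * e ^- 2.
have e20 : 0 < e ^+ 2 by rewrite exprn_gt0.
have l0 : 0 < l by rewrite mulr_gt0 // invr_gt0.
pose f : @smooth_fun R N := scst 2 - scst l * d2.
have fE x : f x = 2 - l * d2 x by [].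
have cb : C1f (fun x => 1 + (-1) * sqpos (1 + (-1) * sqpos (f x))).
  apply: C1f_add (C1f_cst 1) (C1f_mul (C1f_cst (-1)) (C1f_sqpos _)).
  apply: C1f_add (C1f_cst 1) (C1f_mul (C1f_cst (-1)) (C1f_sqpos _)).
  exact: smooth_C1f.
exists (fun x => 1 + (-1) * sqpos (1 + (-1) * sqpos (f x))), [set x | 1 < f x]; split => //.
- split.
    apply: (@open_comp _ _ f [set t | 1 < t]); last exact: open_gt.
    by move=> x _; exact: smooth_fun_cont.
  rewrite /mkset fE d2E big1 ?mulr0 ?subr0 ?ltr1n // => j _.
  by rewrite subrr expr0n.
- move=> x /= fx; rewrite (@sqpos_le0 (1 + _)) ?mulr0 ?addr0 //.
  by have := sqpos_ge1 (ltW fx); lra.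
- move=> x; apply: contra_neqP => nW; rewrite (@sqpos_le0 (f x)).
    by rewrite mulr0 addr0 /sqpos (max_idPr ler01) expr1n mulr1 subrr.
  rewrite fE subr_le0.
  have [j xj] : exists j, e <= `|x 0 j - p 0 j|.
    apply: contrapT => H; apply: nW; apply: eW; split=> // i j.
    rewrite ord1 /ball /= distrC ltNge; apply/negP => H1; apply: H; by exists j.
  have : e ^+ 2 <= d2 x.
    rewrite d2E (bigD1 j) //=; apply: (@le_trans _ _ ((x 0 j - p 0 j) ^+ 2)).
      by rewrite -[leRHS]real_normK ?num_real // lerXn2r ?nnegrE ?normr_ge0 // ltW.
    by rewrite lerDl sumr_ge0 // => k _; exact: sqr_ge0.
  rewrite -(ler_pM2l l0) => /(le_trans _); apply.
  by rewrite /l mulfVK ?gt_eqF.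
Qed.

(* Multiplying by 1 - b for a bump b supported in a chart does not change L;
   after finitely many charts the product vanishes near K. *)
Lemma partition_telescope (K : set 'rV[R]_N) (L : ('rV[R]_N -> R) -> R) : compact K ->
  (forall F G, C1f F -> C1f G -> L (fun x => F x + G x) = L F + L G) ->
  (forall p, K p -> exists2 W, nbhs p W &
     forall F, C1f F -> (forall x, F x != 0 -> W x) -> L F = 0) ->
  (forall F V, C1f F -> open V -> K `<=` V -> (forall x, V x -> F x = 0) -> L F = 0) ->
  forall F, C1f F -> L F = 0.
Proof.
move=> cK Ladd Lloc L0.
pose P W := exists2 b, C1f b & (forall x, W x -> b x = 0) /\
  forall F, C1f F -> L (fun x => F x * b x) = L F.
have [W [oW KW [b cb [b0 bL]]]] : exists W, [/\ open W, K `<=` W & P W].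
  apply: compact_induction cK _ _ _.
  - exists (fun=> 1); first exact: C1f_cst.
    by split=> // F _; congr L; apply/funext => x; rewrite mulr1.
  - move=> A B [f cf [f0 fL]] [g cg [g0 gL]]; exists (fun x => f x * g x); first exact: C1f_mul.
    split=> [x [/f0->|/g0->]|F cF]; rewrite ?mul0r ?mulr0 //.
    rewrite -[RHS](fL F cF) -[RHS](gL _ (C1f_mul cF cf)).
    by congr L; apply/funext => x; rewrite mulrA.
  - move=> p /Lloc[W Wp LW]; have [f [V [cf oV V1 fW]]] := bump_exists Wp.
    exists V => //; exists (fun x => 1 + (-1) * f x).
      exact: C1f_add (C1f_cst 1) (C1f_mul (C1f_cst (-1)) cf).
    split=> [x /V1->|F cF]; first by rewrite mulr1 subrr.
    have cFf := C1f_mul cF cf.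
    have e0 : L (fun x => F x * f x) = 0.
      by apply: LW => // x; rewrite mulf_eq0 negb_or => /andP[_ /fW].
    have cG : C1f (fun x => F x * (1 + (-1) * f x)).
      exact: C1f_mul cF (C1f_add (C1f_cst 1) (C1f_mul (C1f_cst (-1)) cf)).
    rewrite -[LHS]add0r -e0 -(Ladd _ _ cFf cG); congr L.
    by apply/funext => x; ring.
move=> F cF; rewrite -(bL F cF); apply: (L0 _ W) => //; first exact: C1f_mul.
by move=> x /b0->; rewrite mulr0.
Qed.
End C1Functions.

Lemma norm_coord_le (R : realType) N (x : 'rV[R]_N) j : `|x 0 j| <= `|x|.
Proof.
rewrite {2}/Num.Def.normr /= mx_normrE.
exact: (le_bigmax _ (fun ij : 'I_1 * 'I_N => `|x ij.1 ij.2|) (0, j)).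
Qed.

(** * Continuity and integrability on the boundary *)

Section SurfaceIntegrals.
Context {R : realType} {n : nat}.
Local Notation e_ j := (delta_mx ord0 j).
Variable Omega : set 'rV[R]_n.+1.
Local Notation S := (frontier Omega).

Lemma smooth_boundary_chart : smooth_boundary Omega -> forall p, S p ->
  exists i b (g : @smooth_fun R n) U, chart_on Omega i b g U /\ U p.
Proof.
move=> sb p /sb[i [b [g [sg ng]]]].
exists i, b, (mk_smooth sg), (interior [set x | Omega x <-> 0 < side i b (mk_smooth sg) x]).
by split=> //; split; [exact: open_interior|move=> x /interior_subset].
Qed.

Lemma bounded_sub_cube : bounded_set Omega -> exists M, closure Omega `<=` cube M.
Proof.
move=> [M [Mr HM]]; exists (M + 1).
rewrite [X in _ `<=` X](closure_id _).1; last exact: cube_closed.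
apply: closure_subset => x Ox j; apply: le_trans (norm_coord_le x j) _.
by apply: (HM (M + 1)); rewrite ?ltrDl.
Qed.

Lemma closure_compact : bounded_set Omega -> compact (closure Omega).
Proof.
move=> /bounded_sub_cube[M HM]; apply: (@subclosed_compact _ _ (cube M)) => //.
  exact: closed_closure.
exact: cube_compact.
Qed.

Lemma frontier_compact : bounded_set Omega -> compact S.
Proof.
move=> /closure_compact cO; apply: (@subclosed_compact _ _ (closure Omega)) => //.
  exact: frontier_closed.
by move=> x [].
Qed.

Hypothesis charts : forall p, S p ->
  exists i b (g : @smooth_fun R n) U, chart_on Omega i b g U /\ U p.
Hypothesis cS : compact S.

(** Continuity is relative to the boundary, since normal and curvatures are meaningful only
    there. *)
Definition surf_cont (f : 'rV[R]_n.+1 -> R) :=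
  forall p, S p -> f x @[x --> within S (nbhs p)] --> f p.

Definition surf_smooth (f : 'rV[R]_n.+1 -> R) := forall i b g U, chart_on Omega i b g U ->
  exists h : @smooth_fun R n, forall x, U x -> S x -> f x = h (col' i x).

Lemma surf_contD f g : surf_cont f -> surf_cont g -> surf_cont (fun x => f x + g x).
Proof. by move=> cf cg p Sp; exact: (cvgD (cf p Sp) (cg p Sp)). Qed.

Lemma surf_contM f g : surf_cont f -> surf_cont g -> surf_cont (fun x => f x * g x).
Proof. by move=> cf cg p Sp; exact: (cvgM (cf p Sp) (cg p Sp)). Qed.

Lemma continuous_surf f : continuous f -> surf_cont f.
Proof. by move=> cf p Sp; apply: cvg_within_filter; exact: cf. Qed.

Lemma surf_cont_sum I (r : seq I) f : (forall a, surf_cont (f a)) ->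
  surf_cont (fun x => \sum_(a <- r) f a x).
Proof.
move=> cf; elim: r => [|a r IH].
  by under eq_fun do rewrite big_nil; apply: continuous_surf; exact: cst_continuous.
by under eq_fun do rewrite big_cons; exact: surf_contD.
Qed.

Lemma smooth_surf f : surf_smooth f -> surf_cont f.
Proof.
move=> sf p Sp; have [i [b [g [U [cU Up]]]]] := charts Sp.
have [h fE] := sf _ _ _ _ cU; rewrite (fE _ Up Sp).
have H : h (col' i x) @[x --> within S (nbhs p)] --> h (col' i p).
  apply: cvg_within_filter.
  by apply: (@continuous_comp _ _ _ (col' i) h); [exact: col'_continuous|exact: smooth_fun_cont].
apply: cvg_trans H; apply: near_eq_cvg.
have : \forall x \near p, S x -> h (col' i x) = f x; last exact.
have [oU _] := cU; apply: filterS (open_nbhs_nbhs (conj oU Up)) => x Ux Sx.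
exact/Logic.eq_sym/fE.
Qed.

(** The preimage of an open set is the boundary cut with an open set of the ambient space. *)
Lemma surf_cont_measurable f : surf_cont f -> measurable_fun S (f : _ -> measurableTypeR R).
Proof.
move=> cf; apply: measurable_to_R => V oV.
have -> : S `&` f @^-1` V = S `&` interior [set x | S x -> V (f x)].
  apply/seteqP; split=> x [Sx] H; split=> //; last exact: interior_subset H Sx.
  by apply: (cf x Sx V); exact: open_nbhs_nbhs.
apply: measurableI; first exact: rV_closed_measurable (@frontier_closed _ _ Omega).
by apply: rV_open_measurable; exact: open_interior.
Qed.

Lemma surf_cont_bounded f : surf_cont f -> exists C, forall x, S x -> `|f x| <= C.
Proof.
move=> cf; pose P W := exists C, forall x, S x -> W x -> `|f x| <= C.
have [W [_ SW [C HC]]] : exists W, [/\ open W, S `<=` W & P W].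
  apply: compact_induction cS _ _ _.
  - by exists 0.
  - move=> A B [C HC] [D HD]; exists (Num.max C D) => x Sx.
    by rewrite le_max => -[/(HC _ Sx)->|/(HD _ Sx)->]; rewrite ?orbT.
  - move=> p Sp; exists (interior [set x | S x -> `|f x| <= `|f p| + 1]).
      split; first exact: open_interior.
      apply: (cf p Sp [set y | `|y| <= `|f p| + 1]).
      have : \forall y \near f p, `|f p - y| < 1 by exact: (nbhsx_ballx (f p) (1 : R) ltr01).
      apply: filterS => y fy; rewrite /mkset -[y](subKr (f p)).
      by rewrite (le_trans (ler_normB _ _)) // lerD2l ltW.
    by exists (`|f p| + 1) => x Sx /interior_subset; apply.
by exists C => x Sx; apply: HC => //; exact: SW.
Qed.

Variable mu : {measure set 'rV[R]_n.+1 -> \bar R}.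
Hypothesis hmu : area_measure S mu.

Let mS : measurable S. Proof. exact: rV_closed_measurable (@frontier_closed _ _ Omega). Qed.

(** W is closed so that derivatives of a function supported in W are supported in W as well. *)
Lemma chart_nbhs (U : set 'rV[R]_n.+1) p : open U -> U p ->
  exists W M, [/\ nbhs p W, closed W, W `<=` U & W `<=` cube M].
Proof.
move=> oU Up; have /nbhs_closedballP[e eU] : nbhs p U by exact: open_nbhs_nbhs.
have e0 : 0 < e%:num by [].
exists (closed_ball p e%:num), (`|p| + e%:num); split=> //.
- by apply: (filterS (@subset_closed_ball _ _ p e%:num)); exact: nbhsx_ballx.
- exact: closed_ball_closed.
- rewrite closed_ballE // => x /= xe j.
  have : `|x| <= `|p| + e%:num.
    by rewrite -[x](subKr p) (le_trans (ler_normB _ _)) // lerD2l.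
  by apply: le_trans; exact: norm_coord_le.
Qed.

Lemma lift_bump_integrable i b (g : @smooth_fun R n) U W M (f : 'rV[R]_n.+1 -> R) :
  chart_on Omega i b g U -> W `<=` U -> W `<=` cube M -> continuous f ->
  (forall x, f x != 0 -> W x) -> mu.-integrable S (EFin \o f) /\
  \int[mu]_(x in S) f x = \int[leb n]_y (f (gphi i g y) * cnorm i g y).
Proof.
move=> cU WU WM cf fW.
have ch : continuous (fun y => f (gphi i g y)).
  by move=> y; apply: (@continuous_comp _ _ _ (gphi i g) f); [exact: gphi_continuous|exact: cf].
have hM y : f (gphi i g y) != 0 -> cube M y /\ U (gphi i g y).
  move=> /fW Wy; split; last exact: WU.
  by move=> j; have := WM _ Wy (lift i j); rewrite ins_lift.
have [] := lift_chart_integral cU hmu ch hM.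
have fE x : S x -> lift_chart i U (fun y => f (gphi i g y)) x = f x.
  move=> Sx; rewrite /lift_chart; case: asboolP => [Ux|nU].
    by rewrite (gphi_at cU Ux Sx).
  by apply/Logic.eq_sym; apply: contra_notP nU => /eqP/fW/WU.
move=> fi <-; split.
  by apply: eq_integrable fi => // x /set_mem Sx; rewrite /= fE.
by apply: eq_Rintegral => x /set_mem Sx; rewrite fE.
Qed.

(** [area_measure] prescribes densities in charts; finiteness comes from compactness, because a bump
    supported in a chart is integrable and equals 1 near the point. *)
Lemma surface_finite : (mu S < +oo)%E.
Proof.
pose P W := measurable W /\ (mu (S `&` W) < +oo)%E.
have [W [_ SW [mW fW]]] : exists W, [/\ open W, S `<=` W & P W].
  apply: compact_induction cS _ _ _.
  - by rewrite /P setI0 measure0 ltry.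
  - move=> A B [mA fA] [mB fB]; split; first exact: measurableU.
    have := @measureU2 _ _ _ mu _ _ (measurableI _ _ mS mA) (measurableI _ _ mS mB).
    rewrite -setIUr => /le_lt_trans; apply; exact: lte_add_pinfty.
  - move=> p Sp; have [i [b [g [U [cU Up]]]]] := charts Sp; have [oU _] := cU.
    have [W [M [Wp _ WU WM]]] := chart_nbhs oU Up.
    have [f [V [cf oV V1 fW]]] := bump_exists Wp.
    exists V => //; split; first by apply: rV_open_measurable; have [] := oV.
    have mSV : measurable (S `&` V).
      by apply: measurableI => //; apply: rV_open_measurable; have [] := oV.
    have [fi _] := lift_bump_integrable cU WU WM (C1f_cont cf) fW.
    have /integrableP[_] := integrableS mS mSV (@subIsetl _ _ _) fi.
    rewrite (eq_integral (cst 1%E)); last by move=> x /set_mem[_ Vx]; rewrite /= V1 // normr1.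
    by rewrite integral_cst // mul1e.
by apply: le_lt_trans fW; apply: le_measure; rewrite ?inE //; [exact: measurableI|move=> x Sx; split=> //; exact: SW].
Qed.

Lemma surf_cont_integrable f : surf_cont f -> mu.-integrable S (EFin \o f).
Proof.
move=> cf; apply: measurable_bounded_integrable => //; first exact: surface_finite.
- exact: surf_cont_measurable.
- have [C HC] := surf_cont_bounded cf; exists C; split; first exact: num_real.
  by move=> y Cy x Sx; apply: le_trans (HC _ Sx) (ltW Cy).
Qed.

End SurfaceIntegrals.

(** * Divergence theorem on the closed hypersurface *)

Section SurfaceDivergence.
Context {R : realType} {n : nat}.
Local Notation e_ j := (delta_mx ord0 j).

Lemma C1f_graph i (g : @smooth_fun R n) (F : 'rV[R]_n.+1 -> R) : C1f F ->
  C1f (fun y => F (gphi i g y)).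
Proof.
move=> cF; have H y := chain_graph (smooth_fun_diff g y) (cF.1 (ins i (g y, y))).
split=> [y|j]; first by have [] := H y.
rewrite (_ : 'D_(e_ j) _ = fun y => 'D_(e_ (lift i j)) F (gphi i g y) +
    'D_(e_ j) g y * 'D_(e_ i) F (gphi i g y)); last first.
  by apply/funext => y; have [_ ->] := H y.
have c a : continuous (fun y => 'D_(e_ a) F (gphi i g y)).
  move=> y; apply: (@continuous_comp _ _ _ (gphi i g) ('D_(e_ a) F)).
    exact: gphi_continuous.
  exact: cF.2.
move=> y; exact: (cvgD (c (lift i j) y) (cvgM (smooth_fun_cont (f := spart j g) (x:=y)) (c i y))).
Qed.

Lemma sum_flux_terms (p q r : R) (s z d e : 'I_n -> R) :
  \sum_j (p * s j + q * (z j * d j + (z j * e j) * r)) =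
  p * (\sum_j s j) + q * (\sum_j z j * d j + (\sum_j z j * e j) * r).
Proof. by rewrite big_split -!mulr_sumr big_split -mulr_suml. Qed.

Lemma derive_near0 N (F : 'rV[R]_N -> R) x v : (\forall y \near x, F y = 0) -> 'D_v F x = 0.
Proof. by move=> H; rewrite (near_eq_derive (g := fun=> 0) _ H) derive_cst. Qed.

(** The integrand is the Euclidean divergence of F W Z in the parameters, W being the area density.
    Tangency expresses Z_i through the other components, which turns the ambient gradient of F into
    its derivative along the graph. *)
Lemma chart_flux_zero i b (g : @smooth_fun R n) (Z : 'rV[@smooth_fun R n]_n.+1)
    (F : 'rV[R]_n.+1 -> R) M :
  Z *m (cnu i b g)^T = 0 -> C1f F -> (forall x, F x != 0 -> cube M x) ->
  \int[leb n]_y ((F (gphi i g y) * divg (cdel i b g) Z y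
     + \sum_a Z 0 a y * 'D_(e_ a) F (gphi i g y)) * cnorm i g y) = 0.
Proof.
move=> Zn cF FM.
pose c := cnorm i g; pose h j y := F (gphi i g y) * (c * Z 0 (lift i j)) y.
have cG := C1f_graph i g cF.
have ch j : C1f (h j) by apply: C1f_mul cG _; exact: smooth_C1f.
have hM j y : h j y != 0 -> cube M y.
  rewrite mulf_eq0 negb_or => /andP[/FM FM' _] l.
  by have := FM' (lift i l); rewrite ins_lift.
have E y : (F (gphi i g y) * divg (cdel i b g) Z y
     + \sum_a Z 0 a y * 'D_(e_ a) F (gphi i g y)) * cnorm i g y = \sum_j 'D_(e_ j) (h j) y.
  have eh j : 'D_(e_ j) (h j) y = F (gphi i g y) * spart j (c * Z 0 (lift i j)) y +
      c y * (Z 0 (lift i j) y * 'D_(e_ (lift i j)) F (gphi i g y) +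
             (Z 0 (lift i j) y * 'D_(e_ j) g y) * 'D_(e_ i) F (gphi i g y)).
    rewrite (C1f_deriveM _ _ cG (smooth_C1f (c * Z 0 (lift i j)))).
    have [_ ->] := chain_graph (smooth_fun_diff g y) (cF.1 (ins i (g y, y))).
    rewrite smooth_mulE -[X in _ = _ * X + _]/('D_(e_ j) (c * Z 0 (lift i j)) y).
    move: ('D_(e_ j) (c * Z 0 (lift i j)) y) => q0.
    move: ('D_(e_ (lift i j)) F _) ('D_(e_ i) F _) ('D_(e_ j) g y) => q1 q2 q3.
    by rewrite -[gphi i g y]/(ins i (g y, y)); ring.
  under [RHS]eq_bigr do rewrite eh.
  rewrite sum_flux_terms -smooth_sumE -(cdivg_graph Zn) smooth_mulE.
  have Zi : Z 0 i y = \sum_j Z 0 (lift i j) y * 'D_(e_ j) g y.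
    have /(dotp_nuv_eq0 _ _ _ _ _).1 := mev_tan y Zn.
    rewrite (derive_sum_coord _ (smooth_fun_diff g y)) mxE => H.
    by apply: (Logic.eq_trans H); apply: eq_bigr => j _; rewrite !mxE.
  rewrite -Zi (bigD1_ord i) //.
  have alg (p d z D s q : R) : (p * d + (z * D + s)) * q = p * (q * d) + q * (s + z * D) by ring.
  exact: alg.
under eq_Rintegral do rewrite E.
have bbh j : bb ('D_(e_ j) (h j)).
  by apply: (continuous_bb (M := M)); [exact: (ch j).2|exact: derive_supp (hM j)].
rewrite Rintegral_sum //; last by move=> j; exact: bb_integrable.
rewrite big1 // => j _; apply: (integral_partial (M := M)).
- exact: C1f_cont.
- by move=> x; exact: C1f_derivable.
- exact: (ch j).2.
- exact: hM.
Qed.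

Variable Omega : set 'rV[R]_n.+1.
Local Notation S := (frontier Omega).
Hypothesis charts : forall p, S p ->
  exists i b (g : @smooth_fun R n) U, chart_on Omega i b g U /\ U p.
Hypothesis cS : compact S.
Variable mu : {measure set 'rV[R]_n.+1 -> \bar R}.
Hypothesis hmu : area_measure S mu.
Variables (Y : 'I_n.+1 -> 'rV[R]_n.+1 -> R) (Q : 'rV[R]_n.+1 -> R).
(** Y has ambient components and is one global field; its smooth representative Z and the divergence
    are read in charts. *)
Hypothesis YQ : forall i b g U, chart_on Omega i b g U ->
  exists Z : 'rV[@smooth_fun R n]_n.+1, Z *m (cnu i b g)^T = 0 /\
    forall x, U x -> S x -> (forall a, Y a x = Z 0 a (col' i x)) /\
                            Q x = divg (cdel i b g) Z (col' i x).

Lemma surf_smooth_Y a : surf_smooth Omega (Y a).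
Proof. by move=> i b g U /YQ[Z [_ H]]; exists (Z 0 a) => x Ux Sx; have [->] := H x Ux Sx. Qed.

Lemma surf_smooth_Q : surf_smooth Omega Q.
Proof. by move=> i b g U /YQ[Z [_ H]]; exists (divg (cdel i b g) Z) => x Ux Sx; have [_ ->] := H x Ux Sx. Qed.

(** This is div (F Y) for an ambient function F, so that cutoffs can be inserted. *)
Let flux (F : 'rV[R]_n.+1 -> R) x := F x * Q x + \sum_a Y a x * 'D_(e_ a) F x.

Lemma flux_cont F : C1f F -> surf_cont Omega (flux F).
Proof.
move=> cF; apply: surf_contD.
  apply: surf_contM; first by apply: continuous_surf; exact: C1f_cont.
  by apply: smooth_surf => //; exact: surf_smooth_Q.
apply: surf_cont_sum => a; apply: surf_contM.
  by apply: smooth_surf => //; exact: surf_smooth_Y.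
by apply: continuous_surf; exact: cF.2.
Qed.

Lemma flux_local p : S p -> exists2 W, nbhs p W &
  forall F, C1f F -> (forall x, F x != 0 -> W x) -> \int[mu]_(x in S) flux F x = 0.
Proof.
move=> Sp; have [i [b [g [U [cU Up]]]]] := charts Sp; have [oU _] := cU.
have [W [M [Wp cW WU WM]]] := chart_nbhs oU Up.
exists W => // F cF FW; have [Z [Zn ZE]] := YQ cU.
have FM x : F x != 0 -> cube M x by move=> /FW/WM.
have dW a x : 'D_(e_ a) F x != 0 -> W x.
  apply: contra_neqP => nW; apply: derive_near0.
    apply: filterS (open_nbhs_nbhs (conj (closed_openC cW) nW)) => y nWy.
    by apply/eqP; apply: contra_notT nWy => /FW.
pose h y := F (gphi i g y) * divg (cdel i b g) Z y + \sum_a Z 0 a y * 'D_(e_ a) F (gphi i g y).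
have cGa (f : 'rV[R]_n.+1 -> R) : continuous f -> continuous (fun y => f (gphi i g y)).
  by move=> cf y; apply: (@continuous_comp _ _ _ (gphi i g) f); [exact: gphi_continuous|exact: cf].
have ch : continuous h.
  have c1 := cGa _ (C1f_cont cF).
  have c2 : continuous (fun y => \sum_a Z 0 a y * 'D_(e_ a) F (gphi i g y)).
    apply: continuous_sum => a y.
    exact: (cvgM (@smooth_fun_cont _ _ (Z 0 a) y) (cGa _ (cF.2 a) y)).
  by move=> y; exact: (cvgD (cvgM (c1 y) (@smooth_fun_cont _ _ (divg (cdel i b g) Z) y)) (c2 y)).
have hM y : h y != 0 -> cube M y /\ U (gphi i g y).
  move=> hy; have Wy : W (gphi i g y).
    apply: contrapT => nW; move/negP: hy; apply; apply/eqP; rewrite /h.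
    have -> : F (gphi i g y) = 0 by apply/eqP; apply: contra_notT nW => /FW.
    rewrite mul0r add0r big1 // => a _.
    have -> : 'D_(e_ a) F (gphi i g y) = 0 by apply/eqP; apply: contra_notT nW => /dW.
    by rewrite mulr0.
  split; last exact: WU.
  by move=> j; have := WM _ Wy (lift i j); rewrite ins_lift.
have [_ <-] : True /\ \int[mu]_(x in S) lift_chart i U h x = \int[mu]_(x in S) flux F x.
  split=> //; apply: eq_Rintegral => x /set_mem Sx; rewrite /lift_chart.
  case: asboolP => [Ux|nU].
    rewrite /h (gphi_at cU Ux Sx) /flux; have [YE ->] := ZE x Ux Sx; congr (_ + _).
    by apply: eq_bigr => a _; rewrite YE.
  have nW : ~ W x by move/WU.
  rewrite /flux; have -> : F x = 0 by apply/eqP; apply: contra_notT nW => /FW.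
  rewrite mul0r add0r big1 // => a _.
  have -> : 'D_(e_ a) F x = 0 by apply/eqP; apply: contra_notT nW => /dW.
  by rewrite mulr0.
have [_ ->] := lift_chart_integral cU hmu ch hM.
exact: (chart_flux_zero Zn cF FM).
Qed.

(** The integral of div (F Y) is additive in F and vanishes for F supported near a boundary point,
    hence also for F = 1. *)
Theorem surface_divergence : \int[mu]_(x in S) Q x = 0.
Proof.
have H : \int[mu]_(x in S) flux (fun=> 1) x = 0.
  apply: (partition_telescope cS (L := fun F => \int[mu]_(x in S) flux F x)).
  - move=> F G cF cG; rewrite -RintegralD //; last 3 first.
    + exact: rV_closed_measurable (@frontier_closed _ _ Omega).
    + exact: surf_cont_integrable (flux_cont cF).
    + exact: surf_cont_integrable (flux_cont cG).
    apply: eq_Rintegral => x _; rewrite /flux.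
    under eq_bigr do rewrite C1f_deriveD // mulrDr.
    by rewrite big_split mulrDl addrACA.
  - exact: flux_local.
  - move=> F V cF oV SV F0; transitivity (\int[mu]_(x in S) 0 : R).
      apply: eq_Rintegral => x /set_mem Sx; rewrite /flux (F0 _ (SV _ Sx)) mul0r add0r.
      rewrite big1 // => a _; rewrite derive_near0 ?mulr0 //.
      by apply: filterS (open_nbhs_nbhs (conj oV (SV _ Sx))) => y /F0.
    by rewrite Rintegral_cst ?mul0r //; exact: rV_closed_measurable (@frontier_closed _ _ Omega).
  - exact: C1f_cst.
rewrite -H; apply: eq_Rintegral => x _; rewrite /flux mul1r big1 ?addr0 // => a _.
by rewrite derive_cst mulr0.
Qed.

End SurfaceDivergence.

(** * Divergence theorem in the domain *)

Section Volume.
Context {R : realType} {n : nat}.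
Local Notation e_ j := (delta_mx ord0 j).
Variable Omega : set 'rV[R]_n.+1.
Local Notation S := (frontier Omega).
Hypothesis oO : open Omega.
Hypothesis bO : bounded_set Omega.
Hypothesis charts : forall p, S p ->
  exists i b (g : @smooth_fun R n) U, chart_on Omega i b g U /\ U p.
Variable mu : {measure set 'rV[R]_n.+1 -> \bar R}.
Hypothesis hmu : area_measure S mu.

Let cS : compact S. Proof. exact: frontier_compact. Qed.

Lemma support_smooth : surf_smooth Omega (support_fun Omega).
Proof. by move=> i b g U cU; exists (csupp i b g) => x Ux Sx; exact: (chart_support cU Ux Sx). Qed.

Let Z (F : 'rV[R]_n.+1 -> R) (a : 'I_n.+1) x := F x * scoord a x.
Let div F x := \sum_a 'D_(e_ a) (Z F a) x.
Let inside F x := \1_Omega x * div F x.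
(** The defect in the divergence theorem for the field F X, X the position; F = 1 is the case
    sought. *)
Let L F := \int[leb n.+1]_x inside F x - \int[mu]_(x in S) (F x * support_fun Omega x).

Lemma C1f_Z F a : C1f F -> C1f (Z F a).
Proof. by move=> cF; apply: C1f_mul cF _; exact: smooth_C1f. Qed.

Lemma div_cont F : C1f F -> continuous (div F).
Proof. by move=> cF; apply: continuous_sum => a; exact: (C1f_Z a cF).2. Qed.

Lemma inside_bb F : C1f F -> bb (inside F).
Proof.
move=> cF; have [M HM] := bounded_sub_cube bO.
have [C HC] := cube_bounded M (div_cont cF).
split.
  apply: measurable_funM; last by apply: continuous_rV_measurable => //; exact: div_cont.
  by apply: measurable_indic; exact: rV_open_measurable.
exists `|C|, M => x; rewrite /inside indicE; case: (boolP (x \in Omega)) => [/set_mem Ox|_].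
  have xM : cube M x by apply: HM; exact: subset_closure.
  by rewrite mul1r; split=> // ; rewrite (le_trans (HC _ xM)) // ler_norm.
by rewrite mul0r normr0 eqxx; split.
Qed.

Lemma surf_term_cont F : C1f F -> surf_cont Omega (fun x => F x * support_fun Omega x).
Proof.
move=> cF; apply: surf_contM; first by apply: continuous_surf; exact: C1f_cont.
by apply: smooth_surf => //; exact: support_smooth.
Qed.

Lemma frontier_notin x : S x -> ~ Omega x.
Proof. by move=> [_ nI] Ox; apply: nI; exact: open_nbhs_nbhs. Qed.

Lemma div_add F G x : C1f F -> C1f G -> div (fun y => F y + G y) x = div F x + div G x.
Proof.
move=> cF cG; rewrite /div -big_split; apply: eq_bigr => a _.
have -> : Z (fun y => F y + G y) a = fun y => Z F a y + Z G a y.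
  by apply/funext => y; exact: mulrDl.
exact: C1f_deriveD (C1f_Z a cF) (C1f_Z a cG).
Qed.

Lemma div_supp F W : closed W -> (forall x, F x != 0 -> W x) -> forall x, div F x != 0 -> W x.
Proof.
move=> cW FW x; apply: contra_neqP => nW; rewrite /div big1 // => a _.
apply: derive_near0; apply: filterS (open_nbhs_nbhs (conj (closed_openC cW) nW)) => y nWy.
rewrite /Z; have -> : F y = 0 by apply/eqP; apply: contra_notT nWy => /FW.
by rewrite mul0r.
Qed.

Lemma L_interior p : Omega p -> exists2 W, nbhs p W &
  forall F, C1f F -> (forall x, F x != 0 -> W x) -> L F = 0.
Proof.
move=> Op; have [W [M [Wp cW WO WM]]] := chart_nbhs oO Op; exists W => // F cF FW.
rewrite /L; have -> : \int[mu]_(x in S) (F x * support_fun Omega x) = 0.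
  transitivity (\int[mu]_(x in S) 0 : R); last first.
    by rewrite Rintegral_cst ?mul0r //; exact: rV_closed_measurable (@frontier_closed _ _ Omega).
  apply: eq_Rintegral => x /set_mem Sx.
  have -> : F x = 0 by apply/eqP; apply: contra_notT (frontier_notin Sx) => /FW/WO.
  by rewrite mul0r.
rewrite subr0; transitivity (\int[leb n.+1]_x div F x).
  apply: eq_Rintegral => x _; rewrite /inside indicE; case: (boolP (x \in Omega)); rewrite ?mul1r //.
  rewrite notin_setE mul0r => nO; apply/Logic.eq_sym/eqP; apply: contra_notT nO => /(div_supp cW FW)/WO.
  by [].
have ZM a x : Z F a x != 0 -> cube M x by rewrite mulf_eq0 negb_or => /andP[/FW/WM].
rewrite Rintegral_sum //; last first.
  move=> a; apply: bb_integrable; apply: (continuous_bb (M := M)); first exact: (C1f_Z a cF).2.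
  exact: derive_supp (ZM a).
rewrite big1 // => a _; apply: (integral_partial (M := M)).
- exact: C1f_cont (C1f_Z a cF).
- by move=> x; exact: C1f_derivable (C1f_Z a cF).
- exact: (C1f_Z a cF).2.
- exact: ZM.
Qed.

(** The boundary term of [chart_divergence] for F X is matched with F u times the area density W.
    This rests on W u = sum_a (W nu_a) X_a, where W nu is the signed gradient of x_i - g. *)
Lemma L_frontier p : S p -> exists2 W, nbhs p W &
  forall F, C1f F -> (forall x, F x != 0 -> W x) -> L F = 0.
Proof.
move=> Sp; have [i [b [g [U [cU Up]]]]] := charts Sp; have [oU UO] := cU.
have [W [M [Wp cW WU WM]]] := chart_nbhs oU Up; exists W => // F cF FW.
have ZM a x : Z F a x != 0 -> cube M x by rewrite mulf_eq0 negb_or => /andP[/FW/WM].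
have cG := C1f_cont (C1f_graph i g cF).
pose h y := F (gphi i g y) * csupp i b g y.
have ch : continuous h by move=> y; exact: (cvgM (cG y) (@smooth_fun_cont _ _ (csupp i b g) y)).
have hM y : h y != 0 -> cube M y /\ U (gphi i g y).
  rewrite mulf_eq0 negb_or => /andP[/FW Wy _]; split; last exact: WU.
  by move=> j; have := WM _ Wy (lift i j); rewrite ins_lift.
have [_ E] := lift_chart_integral cU hmu ch hM.
rewrite /L; have -> : \int[mu]_(x in S) (F x * support_fun Omega x) = \int[mu]_(x in S) lift_chart i U h x.
  apply: eq_Rintegral => x /set_mem Sx; rewrite /lift_chart; case: asboolP => [Ux|nU].
    by rewrite /h (gphi_at cU Ux Sx) (chart_support cU Ux Sx).
  have -> : F x = 0 by apply/eqP; apply: contra_notT nU => /FW/WU.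
  by rewrite mul0r.
rewrite E; have := chart_divergence i b g (fun a => C1f_Z a cF) ZM.
rewrite (_ : \int[leb n.+1]_x _ = \int[leb n.+1]_x inside F x); last first.
  apply: eq_Rintegral => x _; rewrite -/(div F x) -/(side i b g x) /inside.
  have [->|d0] := eqVneq (div F x) 0; first by rewrite mulr0; case: ifP.
  have Ux := WU _ (div_supp cW FW d0).
  case: ifPn => s0; rewrite indicE.
    by rewrite mem_set ?mul1r //; apply/UO.
  by rewrite memNset ?mul0r // => /(UO _ Ux); exact/negP.
move=> ->; apply/eqP; rewrite subr_eq0; apply/eqP; apply: eq_Rintegral => y _.
rewrite /h -mulrA [_ * cnorm i g y]mulrC -smooth_mulE.
have -> : (cnorm i g * csupp i b g : @smooth_fun R n) y =
    \sum_a (- (-1) ^+ b * cgrad i g 0 a y) * gphi i g y 0 a.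
  have -> : cnorm i g * csupp i b g = \sum_a csign b * cgrad i g 0 a * cpos i g 0 a.
    rewrite /csupp /supp mxE mulr_sumr; apply: eq_bigr => a _.
    rewrite [_^T a 0]mxE [cnu i b g 0 a]gnormalE.
    by rewrite -(cnorm_tau i b g); ring.
  rewrite smooth_sumE; apply: eq_bigr => a _; rewrite !smooth_mulE; congr (_ * _).
  by rewrite !mxE; case: (unliftP i a).
by rewrite mulr_sumr; apply: eq_bigr => a _; rewrite /Z mulrCA.
Qed.

Theorem support_integral :
  \int[mu]_(x in S) support_fun Omega x = n.+1%:R * fine (leb n.+1 Omega).
Proof.
have H : L (fun=> 1) = 0.
  apply: (partition_telescope (closure_compact bO) (L := L)).
  - move=> F G cF cG; rewrite /L.
    have -> : \int[leb n.+1]_x inside (fun y => F y + G y) x =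
        \int[leb n.+1]_x inside F x + \int[leb n.+1]_x inside G x.
      rewrite -RintegralD //; [|exact: bb_integrable (inside_bb cF)|exact: bb_integrable (inside_bb cG)].
      by apply: eq_Rintegral => x _; rewrite /inside div_add // mulrDr.
    have -> : \int[mu]_(x in S) ((F x + G x) * support_fun Omega x) =
        \int[mu]_(x in S) (F x * support_fun Omega x) + \int[mu]_(x in S) (G x * support_fun Omega x).
      rewrite -RintegralD //; last 3 first.
      + exact: rV_closed_measurable (@frontier_closed _ _ Omega).
      + exact: (surf_cont_integrable charts cS hmu (surf_term_cont cF)).
      + exact: (surf_cont_integrable charts cS hmu (surf_term_cont cG)).
      by apply: eq_Rintegral => x _; rewrite mulrDl.
    by rewrite opprD addrACA.
  - move=> p cp; have [Op|nO] := pselect (Omega p); first exact: L_interior.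
    by apply: L_frontier; split=> // /interior_subset.
  - move=> F V cF oV KV F0.
    rewrite /L; have -> : \int[leb n.+1]_x inside F x = 0.
      transitivity (\int[leb n.+1]_x 0 : R); last by rewrite Rintegral_cst ?mul0r.
      apply: eq_Rintegral => x _; rewrite /inside indicE.
      case: (boolP (x \in Omega)) => [/set_mem Ox|]; rewrite ?mul0r // mul1r.
      rewrite /div big1 // => a _; apply: derive_near0.
      have Vx : V x by apply: KV; exact: subset_closure.
      by apply: filterS (open_nbhs_nbhs (conj oV Vx)) => y /F0; rewrite /Z => ->; rewrite mul0r.
    rewrite sub0r -[RHS]oppr0; congr (- _).
    transitivity (\int[mu]_(x in S) 0 : R); last first.
      by rewrite Rintegral_cst ?mul0r //; exact: rV_closed_measurable (@frontier_closed _ _ Omega).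
    by apply: eq_Rintegral => x /set_mem[Kx _]; rewrite F0 ?mul0r //; exact: KV.
  - exact: C1f_cst.
have := H; rewrite /L => /eqP; rewrite subr_eq0 => /eqP E.
under eq_Rintegral do rewrite -[support_fun Omega _]mul1r.
(* For F = 1 the field is X itself, of divergence n + 1. *)
rewrite -E; transitivity (\int[leb n.+1]_x (n.+1%:R * \1_Omega x)).
  apply: eq_Rintegral => x _; rewrite /inside mulrC; congr (_ * _).
  rewrite /div (eq_bigr (fun=> 1)); first by rewrite sumr_const card_ord.
  move=> a _; rewrite (_ : Z _ a = coord_fun a); last by apply/funext => y; rewrite /Z mul1r.
  by rewrite (@derive_val _ _ _ _ _ _ _ (is_derive_coord_fun a x (e_ a))) mxE !eqxx.
rewrite RintegralZl //; last first.
  have [M HM] := bounded_sub_cube bO; apply: bb_integrable; split.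
    by apply: measurable_indic; exact: rV_open_measurable.
  exists 1, M => x; rewrite indicE; case: (boolP (x \in Omega)) => [/set_mem Ox|_].
    by rewrite normr1 lexx; split=> // _; apply: HM; exact: subset_closure.
  by rewrite normr0 ler01 eqxx.
congr (_ * _); rewrite /Rintegral integral_indic ?setIT //.
exact: rV_open_measurable.
Qed.

End Volume.

(** * Minkowski formulas *)

Section Minkowski.
Context {R : realType} {n : nat}.
Variable Omega : set 'rV[R]_n.+1.
Local Notation S := (frontier Omega).
Local Notation H := (mean_curv Omega).
Local Notation u := (support_fun Omega).
Local Notation Xt := (tang_part Omega).
Hypothesis charts : forall p, S p ->
  exists i b (g : @smooth_fun R n) U, chart_on Omega i b g U /\ U p.
Hypothesis cS : compact S.
Variable mu : {measure set 'rV[R]_n.+1 -> \bar R}.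
Hypothesis hmu : area_measure S mu.

Lemma mean_curv_smooth k : surf_smooth Omega (H k).
Proof.
move=> i b g U cU; exists (csig i b g k * scst ('C(n, k)%:R)^-1) => x Ux Sx.
exact: (chart_mean_curv cU Ux Sx).
Qed.

Lemma mean_curv_cont k : surf_cont Omega (H k).
Proof. by apply: smooth_surf => //; exact: mean_curv_smooth. Qed.

Lemma support_cont : surf_cont Omega u.
Proof. by apply: smooth_surf => //; exact: support_smooth. Qed.

Definition newton_flux m x := newton Omega x m (Xt x).
Definition newton_integrand m x := dotp (newton Omega x m (shape Omega x (Xt x))) (Xt x).
Definition newton_div m x : R := (m.+1 * 'C(n, m.+1))%:R * (H m x - u x * H m.+1 x).

(** Since (m+1) C(n,m+1) = (n-m) C(n,m), passing from sigma to the normalized H brings out the same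
    factor from both terms. *)
Lemma newton_coeff (a0 a1 q : R) m : (m < n)%N ->
  a0 *+ n.+1 - a0 *+ m.+1 - q * (a1 *+ m.+1) =
  (m.+1 * 'C(n, m.+1))%:R * (a0 / 'C(n, m)%:R - q * (a1 / 'C(n, m.+1)%:R)).
Proof.
move=> mn.
have C0 : ('C(n, m)%:R : R) != 0 by rewrite pnatr_eq0 -lt0n bin_gt0 ltnW.
have C1 : ('C(n, m.+1)%:R : R) != 0 by rewrite pnatr_eq0 -lt0n bin_gt0.
have e0 : (m.+1 * 'C(n, m.+1))%:R = (n - m)%:R * 'C(n, m)%:R :> R by rewrite mul_bin_left natrM.
have e1 : (m.+1 * 'C(n, m.+1))%:R = m.+1%:R * 'C(n, m.+1)%:R :> R by rewrite natrM.
rewrite mulrBr {1}e0 e1 -mulrnBr; last by rewrite ltnS ltnW.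
rewrite subSS -[a0 *+ _]mulr_natl -[a1 *+ _]mulr_natl.
move: (_%:R) C0 => c0 C0; move: ('C(n, m.+1)%:R) C1 => c1 C1; move: (m.+1%:R) ((n - m)%:R) => x y.
by field; rewrite C0 C1.
Qed.

Lemma divg_newton_eval i b (g : @smooth_fun R n) m y : (m < n)%N ->
  divg (cdel i b g) (cXtan i b g *m cnewt i b g m) y =
  (m.+1 * 'C(n, m.+1))%:R * (csig i b g m y / 'C(n, m)%:R
                             - csupp i b g y * (csig i b g m.+1 y / 'C(n, m.+1)%:R)).
Proof.
move=> mn; rewrite cdivg_newton.
move: (csig i b g m) (csig i b g m.+1) (csupp i b g) => s0 s1 q.
rewrite -[LHS]/(sev y _) rmorphB rmorphB rmorphM !rmorphMn.
exact: newton_coeff.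
Qed.

Lemma newton_flux_chart i b g U m : chart_on Omega i b g U -> forall x, U x -> S x -> forall a,
  newton_flux m x 0 a = (cXtan i b g *m cnewt i b g m) 0 a (col' i x).
Proof.
move=> cU x Ux Sx a; rewrite /newton_flux (chart_tang_part cU Ux Sx).
have Xn : map_mx (sev (col' i x)) (cXtan i b g) *m (nuv i b g (col' i x))^T = 0.
  by rewrite -[nuv _ _ _ _]/(map_mx (sev (col' i x)) (cnu i b g)) map_trmx -map_mxM cXtan_nu map_mx0.
by have [-> _] := chart_newton cU Ux Sx m Xn; rewrite -map_mxM mxE.
Qed.

Lemma newton_div_chart i b g U m : chart_on Omega i b g U -> (m < n)%N -> forall x, U x -> S x ->
  newton_div m x = divg (cdel i b g) (cXtan i b g *m cnewt i b g m) (col' i x).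
Proof.
move=> cU mn x Ux Sx; rewrite divg_newton_eval // /newton_div.
by rewrite !(chart_mean_curv cU Ux Sx) (chart_support cU Ux Sx).
Qed.

Lemma minkowski m : (m < n)%N ->
  \int[mu]_(x in S) H m x = \int[mu]_(x in S) (u x * H m.+1 x).
Proof.
move=> mn; have : \int[mu]_(x in S) newton_div m x = 0.
  apply: (surface_divergence charts cS hmu (Y := fun a x => newton_flux m x 0 a)).
  move=> i b g U cU; exists (cXtan i b g *m cnewt i b g m); split; first exact: cnewt_tan (cXtan_nu _ _ _).
  move=> x Ux Sx; split; first exact: (newton_flux_chart m cU Ux Sx).
  exact: (newton_div_chart cU mn Ux Sx).
have mS : measurable S by exact: rV_closed_measurable (@frontier_closed _ _ Omega).
have c2 : surf_cont Omega (fun x => u x * H m.+1 x).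
  by apply: surf_contM; [exact: support_cont|exact: mean_curv_cont].
have i1 := surf_cont_integrable charts cS hmu (mean_curv_cont (k := m)).
have i2 := surf_cont_integrable charts cS hmu c2.
rewrite RintegralZl //; last first.
  by have := integrableB mS i1 i2.
rewrite RintegralB // => /eqP; rewrite mulf_eq0 pnatr_eq0 muln_eq0 /=.
by rewrite -[_ == 0]negbK -lt0n bin_gt0 mn /= subr_eq0 => /eqP.
Qed.

Lemma newton_integrand_chart i b g U m : chart_on Omega i b g U -> forall x, U x -> S x ->
  newton_integrand m x =
  (cXtan i b g *m cshape i b g *m cnewt i b g m *m (cXtan i b g)^T) 0 0 (col' i x).
Proof. by move=> cU x Ux Sx; exact: (chart_newton_integrand cU Ux Sx m). Qed.

Lemma newton_integrand_cont m : surf_cont Omega (newton_integrand m).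
Proof.
apply: smooth_surf => // i b g U cU.
exists ((cXtan i b g *m cshape i b g *m cnewt i b g m *m (cXtan i b g)^T) 0 0).
exact: (newton_integrand_chart m cU).
Qed.

Lemma newton_integral m : (m < n)%N ->
  \int[mu]_(x in S) newton_integrand m x =
  (m.+1 * 'C(n, m.+1))%:R * (\int[mu]_(x in S) (u x ^+ 2 * H m.+1 x) -
                             \int[mu]_(x in S) (u x * H m x)).
Proof.
move=> mn.
have E : \int[mu]_(x in S) (u x * newton_div m x + newton_integrand m x) = 0.
  apply: (surface_divergence charts cS hmu (Y := fun a x => u x * newton_flux m x 0 a)).
  move=> i b g U cU; exists (csupp i b g *: (cXtan i b g *m cnewt i b g m)); split.
    by rewrite -scalemxAl cnewt_tan ?scaler0 ?cXtan_nu.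
  move=> x Ux Sx; split=> [a|].
    by rewrite mxE smooth_mulE (newton_flux_chart m cU Ux Sx) (chart_support cU Ux Sx).
  rewrite cdivg_supp_newton smooth_addE smooth_mulE -cdivg_newton.
  by rewrite (chart_support cU Ux Sx) (newton_div_chart cU mn Ux Sx) (newton_integrand_chart m cU Ux Sx).
have mS : measurable S by exact: rV_closed_measurable (@frontier_closed _ _ Omega).
have cc := surf_cont_integrable charts cS hmu.
have c1 : surf_cont Omega (fun x => u x * H m x).
  by apply: surf_contM; [exact: support_cont|exact: mean_curv_cont].
have c2 : surf_cont Omega (fun x => u x ^+ 2 * H m.+1 x).
  under eq_fun do rewrite expr2.
  exact: surf_contM (surf_contM support_cont support_cont) (mean_curv_cont (k := m.+1)).
have Q2 x : u x * newton_div m x + newton_integrand m x =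
   newton_integrand m x - (m.+1 * 'C(n, m.+1))%:R * (u x ^+ 2 * H m.+1 x - u x * H m x).
  rewrite /newton_div; move: (u x) (H m x) (H m.+1 x) (newton_integrand m x) (_%:R) => a b c d e.
  by ring.
have i12 : mu.-integrable S (EFin \o (fun x => u x ^+ 2 * H m.+1 x - u x * H m x)).
  by have := integrableB mS (cc _ c2) (cc _ c1).
have i3 : mu.-integrable S (EFin \o (fun x => (m.+1 * 'C(n, m.+1))%:R * (u x ^+ 2 * H m.+1 x - u x * H m x))).
  by have := integrableZl mS (m.+1 * 'C(n, m.+1))%:R i12.
move: E; under eq_Rintegral do rewrite Q2.
rewrite RintegralB //; last exact: cc (newton_integrand_cont (m := m)).
move=> /eqP; rewrite subr_eq0 => /eqP ->.
by rewrite RintegralZl // RintegralB //; exact: cc.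
Qed.

End Minkowski.

(** * Strict positivity of surface integrals *)

Section Positivity.
Context {R : realType}.

Let box N (p : 'rV[R]_N) (e : R) : set 'rV[R]_N := [set x | forall j, `|x 0 j - p 0 j| <= e].

Lemma box_measurable N (p : 'rV[R]_N) e : measurable (box p e).
Proof.
rewrite (_ : box p e = (fun x : 'rV[R]_N => x - p) @^-1` cube e); last first.
  by apply/seteqP; split=> x H j; have := H j; rewrite !mxE.
apply: rV_closed_measurable; apply: closed_comp (@cube_closed _ _ e) => x _.
exact: (cvgB cvg_id (cvg_cst p)).
Qed.

Lemma leb_box_gt0 N (p : 'rV[R]_N) e : 0 < e -> (0 < leb N (box p e))%E.
Proof.
move=> e0; elim: N p => [|N IH] p.
  rewrite leb0 diracE mem_set ?lte_fin ?ltr01 //.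
  by move=> [].
pose q := \row_j p 0 (lift ord0 j); have := IH q; have mB := box_measurable q e.
set B := box q e in mB * => B0.
rewrite lebS /rowprod /pushforward.
rewrite (_ : _ @^-1` _ = [set` `[p 0 0 - e, p 0 0 + e]] `*` B); last first.
  apply/seteqP; split=> -[s y] /=.
    move=> H; split; last by move=> j; have := H (lift ord0 j); rewrite rowcS mxE.
    by have := H 0; rewrite rowc0 /= in_itv /= ler_distl.
  rewrite in_itv /= -ler_distl => -[sM yM] j; case: (unliftP ord0 j) => [k ->|->].
    by rewrite rowcS; have := yM k; rewrite mxE.
  by rewrite rowc0.
rewrite product_measure1E //; apply: mule_gt0 => //.
have h : p 0 0 - e < p 0 0 + e by lra.
have : (0 < @lebesgue_measure R [set` `[p 0%R 0%R - e, p 0%R 0%R + e]%R])%E; last exact.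
by rewrite lebesgue_measure_itv /= lte_fin h -EFinD lte_fin; lra.
Qed.

Lemma leb_open_gt0 N (V : set 'rV[R]_N) : open V -> V !=set0 -> (0 < leb N V)%E.
Proof.
move=> oV [p Vp]; have /nbhs_ballP[e /= e0 eV] : nbhs p V by exact: open_nbhs_nbhs.
have e20 : 0 < e / 2 by rewrite divr_gt0.
apply: lt_le_trans (leb_box_gt0 p e20) _; apply: le_measure; rewrite ?inE.
- exact: box_measurable.
- exact: rV_open_measurable.
- move=> x H; apply: eV; split=> // i j; rewrite ord1 /ball /= distrC.
  by apply: le_lt_trans (H j) _; rewrite ltr_pdivrMr // mulr_natr mulr2n ltrDl.
Qed.

Context {n : nat}.
Variable Omega : set 'rV[R]_n.+1.
Local Notation S := (frontier Omega).
Hypothesis charts : forall p, S p ->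
  exists i b (g : @smooth_fun R n) U, chart_on Omega i b g U /\ U p.
Hypothesis cS : compact S.
Variable mu : {measure set 'rV[R]_n.+1 -> \bar R}.
Hypothesis hmu : area_measure S mu.

(** The area density is at least 1, so the patch has at least the Lebesgue measure of a nonempty
    open set of parameters. *)
Lemma patch_gt0 p V : S p -> open V -> V p -> (0 < mu (S `&` V))%E.
Proof.
move=> Sp oV Vp; have [i [b [g [U [cU Up]]]]] := charts Sp; have [oU _] := cU.
have mS : measurable S by exact: rV_closed_measurable (@frontier_closed _ _ Omega).
have mSVU : measurable (S `&` (V `&` U)).
  by apply: measurableI => //; apply: rV_open_measurable; exact: openI.
apply: (@lt_le_trans _ _ (mu (S `&` (V `&` U)))); last first.
  apply: le_measure; rewrite ?inE //.
    by apply: measurableI => //; exact: rV_open_measurable.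
  by move=> x [Sx [Vx _]].
rewrite (chart_mu cU hmu mSVU); last by move=> x [Sx [_ Ux]].
have oD : open (gphi i g @^-1` (V `&` U)).
  by apply: open_comp; [move=> y _; exact: gphi_continuous|exact: openI].
have -> : cdom i g U `&` gphi i g @^-1` (S `&` (V `&` U)) = gphi i g @^-1` (V `&` U).
  apply/seteqP; split=> y; first by move=> [_ [_]].
  by move=> [Vy Uy]; split=> //; split=> //; exact: (gphi_frontier cU).
have mD : measurable (gphi i g @^-1` (V `&` U)) by exact: rV_open_measurable.
apply: (@lt_le_trans _ _ (leb n (gphi i g @^-1` (V `&` U)))).
  apply: leb_open_gt0 => //; exists (col' i p).
  by rewrite /preimage /mkset (gphi_at cU Up Sp).
rewrite -[leLHS]mul1e -integral_cst //; apply: ge0_le_integral => //.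
- by apply/measurable_EFinP; apply: continuous_rV_measurable => //; exact: smooth_fun_cont.
- move=> y _; rewrite lee_fin -[leLHS]sqrtr1.
  by rewrite ler_wsqrtr // cnorm2_ge1.
Qed.

(** f exceeds f p / 2 on a piece of positive area. It serves twice: for I_k > 0 through the farthest
    point, and to make a nonnegative integrand vanish in the equality case. *)
Lemma surf_integral_gt0 f p : surf_cont Omega f -> (forall x, S x -> 0 <= f x) ->
  S p -> 0 < f p -> 0 < \int[mu]_(x in S) f x.
Proof.
move=> cf f0 Sp fp; pose c := f p / 2.
have c0 : 0 < c by rewrite divr_gt0.
pose V : set 'rV[R]_n.+1 := interior [set x | S x -> c < f x].
have Vp : V p.
  apply: (cf p Sp [set t | c < t]); apply: open_nbhs_nbhs; split; first exact: open_gt.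
  by rewrite /mkset /c ltr_pdivrMr // mulr_natr mulr2n ltrDl.
have oV : open V by exact: open_interior.
have mS : measurable S by exact: rV_closed_measurable (@frontier_closed _ _ Omega).
have mV : measurable V by exact: rV_open_measurable.
have i1 : mu.-integrable S (EFin \o \1_V).
  apply: measurable_bounded_integrable => //; first exact: surface_finite.
  exists 1; split; first exact: num_real.
  by move=> y y1 x _; rewrite /mkset indicE; case: (_ \in V); rewrite ?normr1 ?normr0 ltW // (lt_trans _ y1).
have i2 : mu.-integrable S (EFin \o (fun x => c * \1_V x)).
  by have := integrableZl mS c i1.
have fin : (mu (S `&` V) < +oo)%E.
  apply: le_lt_trans (surface_finite charts cS hmu); apply: le_measure; rewrite ?inE //.
  exact: measurableI.
apply: (@lt_le_trans _ _ (\int[mu]_(x in S) (c * \1_V x))); last first.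
  apply: le_Rintegral => //; first exact: surf_cont_integrable.
  move=> x Sx; rewrite indicE; case: (boolP (x \in V)) => [/set_mem/interior_subset Vx|_].
    by rewrite mulr1 ltW //; exact: Vx.
  by rewrite mulr0 f0.
rewrite RintegralZl // mulr_gt0 // /Rintegral integral_indic // setIC.
by rewrite fine_gt0 // fin (patch_gt0 Sp).
Qed.

End Positivity.

(** * The point farthest from the origin *)

Section FarthestPoint.
Context {R : realType}.
Local Notation e_ j := (delta_mx ord0 j).

Section Directional.
Context {n : nat}.
Local Notation F := (@smooth_fun R n).
Variable v : 'rV[R]_n.

Definition sdir (f : F) : F := \sum_j scst (v 0 j) * spart j f.

Lemma sdirE f y : sdir f y = 'D_v f y.
Proof.
rewrite smooth_sumE (derive_sum_coord _ (smooth_fun_diff f y)).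
by apply: eq_bigr => j _; rewrite smooth_mulE.
Qed.

Lemma sdirD f h : sdir (f + h) = sdir f + sdir h.
Proof. by rewrite -big_split; apply: eq_bigr => j _; rewrite spartD mulrDr. Qed.

Lemma sdirM f h : sdir (f * h) = sdir f * h + f * sdir h.
Proof.
rewrite mulr_suml mulr_sumr -big_split; apply: eq_bigr => j _.
by rewrite spartM mulrDr mulrA [f * (_ * _)]mulrCA.
Qed.

Lemma sdir_sum I (r : seq I) (f : I -> F) : sdir (\sum_(a <- r) f a) = \sum_(a <- r) sdir (f a).
Proof. exact: (der_sum sdirD). Qed.

Lemma derive_near (f : F) y : is_derive (0 : R) (1 : R) (fun t => f (y + t *: v)) (sdir f y).
Proof.
rewrite sdirE; have := @derive_line R _ f y v 0; rewrite scale0r addr0; apply.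
exact/diff_derivable/smooth_fun_diff.
Qed.

Lemma critical_le (f : F) y : (\forall t \near 0^'+, f (y + t *: v) <= f y) -> sdir f y <= 0.
Proof.
move=> fmax; rewrite leNgt; apply/negP => d0.
have H : is_derive (0 : R) (1 : R) (fun t => f (y + t *: v) - f y) (sdir f y).
  by rewrite -[sdir f y]subr0; apply: is_deriveB; exact: derive_near.
have := derive_pos_near H; rewrite scale0r addr0 subrr => /(_ erefl d0) Hpos.
have [t [/=]] : exists t : R, f (y + t *: v) <= f y /\ 0 < f (y + t *: v) - f y.
  by apply: (@filter_ex _ (0 : R)^'+ _ _); apply: filterI.
by rewrite subr_gt0 ltNge => ->.
Qed.

(** A positive second derivative makes the first derivative positive just to the right of y, so f
    increases strictly, against maximality. *)
Lemma second_order_max (f : F) y : (\forall t \near 0^'+, f (y + t *: v) <= f y) ->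
  sdir f y = 0 -> sdir (sdir f) y <= 0.
Proof.
move=> fmax f0; rewrite leNgt; apply/negP => d0.
have Hpos := derive_pos_near (derive_near (sdir f) y).
rewrite scale0r addr0 in Hpos; have {}Hpos := Hpos f0 d0.
have [e /= e0 He] : \forall t \near 0^'+, f (y + t *: v) <= f y /\ 0 < sdir f (y + t *: v).
  exact: filterI.
have [s [s0 He']] : exists s : R, 0 < s /\ forall t, 0 < t -> t <= 2 * s ->
    f (y + t *: v) <= f y /\ 0 < sdir f (y + t *: v).
  exists (e / 4); split; first by rewrite divr_gt0.
  move=> t t0 ts; apply: He => //=; rewrite sub0r normrN gtr0_norm //.
  by lra.
(* Two intervals of length s: the mean point of the first may be y itself, where the derivative
   vanishes, while the second lies strictly to the right and gives a strict increase. *)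
have [t /andP[t1 t2] E1] := MVT_line y v s0 (smooth_fun_diff f).
have [u /andP[u1 u2] E2] := MVT_line (y + s *: v) v s0 (smooth_fun_diff f).
rewrite -sdirE in E1; rewrite -!addrA -!scalerDl -sdirE in E2.
have [h1 _] : f (y + (s + s) *: v) <= f y /\ 0 < sdir f (y + (s + s) *: v) by apply: He'; lra.
have [_ h2] : f (y + (s + u) *: v) <= f y /\ 0 < sdir f (y + (s + u) *: v) by apply: He'; lra.
have h3 : 0 <= sdir f (y + t *: v).
  have [t0|t0] := eqVneq t 0; first by rewrite t0 scale0r addr0 f0.
  by have [] := He' t; [rewrite lt_neqAle eq_sym t0|lra|move=> _ /ltW].
have := mulr_gt0 s0 h2; have := mulr_ge0 (ltW s0) h3; rewrite -E1 -E2.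
by move: (f y) (f _) (f _) h1 => a b c; lra.
Qed.
End Directional.

Context {n : nat}.
Variable Omega : set 'rV[R]_n.+1.
Local Notation S := (frontier Omega).

Definition farthest p := S p /\ forall x, closure Omega x -> dotp x x <= dotp p p.

Lemma dotp_continuous : continuous (fun x : 'rV[R]_n.+1 => dotp x x).
Proof.
apply: continuous_sum => a x.
exact: (cvgM (coord_continuous (i := 0) (j := a) (x := x)) (coord_continuous (i := 0) (j := a) (x := x))).
Qed.

Lemma open_not_farthest p : open Omega -> Omega p ->
  ~ (forall x, closure Omega x -> dotp x x <= dotp p p).
Proof.
move=> oO Op pmax.
(* Moving outward along p increases the length; at p = 0 any nonzero direction does. *)
pose v : 'rV[R]_n.+1 := if p == 0 then e_ 0 else p.
have [pv v0] : 0 <= dotp p v /\ 0 < dotp v v.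
  rewrite /v; case: (eqVneq p 0) => [->|p0].
    rewrite -[0 : 'rV__](scale0r (e_ 0)) dotpZl mul0r lexx; split=> //.
    by rewrite /dotp (bigD1 0) //= big1 ?mxE ?eqxx ?mulr1 ?addr0 // => a /negPf a0; rewrite mxE a0 andbF mul0r.
  rewrite dotp_ge0 lt_neqAle dotp_ge0 eq_sym andbT; split=> //.
  by apply: contra p0 => /eqP/dotp_eq0->.
have nb := open_line v oO Op.
have [t [t0 Ot]] : exists t : R, 0 < t /\ Omega (p + t *: v).
  by apply: (@filter_ex _ (0 : R)^'+ _ _); apply: filterI => //; exact: nbhs_right_gt.
have := pmax _ (subset_closure Ot).
have -> : dotp (p + t *: v) (p + t *: v) = dotp p p + t * dotp p v + t * (dotp p v + t * dotp v v).
  have e1 w : dotp (p + t *: v) w = dotp p w + t * dotp v w.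
    by rewrite -dotpZl; exact: dotpDl.
  by rewrite e1 !(dotpC _ (p + t *: v)) !e1 (dotpC v p).
have := mulr_gt0 t0 (mulr_gt0 t0 v0); have := mulr_ge0 (ltW t0) pv.
by move: (dotp p p) (dotp p v) (dotp v v) => a b' c; lra.
Qed.

Lemma farthest_exists : open Omega -> bounded_set Omega -> Omega !=set0 -> exists p, farthest p.
Proof.
move=> oO bO [w Ow].
have [p pK pmax] : exists2 p, p \in closure Omega & forall x, x \in closure Omega -> dotp x x <= dotp p p.
  apply: (@EVT_max_rV _ _ (fun x => dotp x x)); [|exact: closure_compact|].
    by exists w; exact: subset_closure.
  by apply: continuous_subspaceT; exact: dotp_continuous.
exists p; have pm x : closure Omega x -> dotp x x <= dotp p p by move=> /mem_set/pmax.
split=> //; split; first exact: set_mem.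
by move=> /interior_subset Op; exact: (open_not_farthest oO Op).
Qed.

Variables (i : 'I_n.+1) (b : bool) (g : @smooth_fun R n) (U : set 'rV[R]_n.+1).
Hypothesis cU : chart_on Omega i b g U.
Variable p : 'rV[R]_n.+1.
Hypotheses (Up : U p) (pfar : farthest p).
Let y := col' i p.
Let Sp : S p := pfar.1.
Let nu := nuv i b g y.

Let sq : @smooth_fun R n := \sum_a cpos i g 0 a * cpos i g 0 a.
Let cposE z a : cpos i g 0 a z = gphi i g z 0 a.
Proof. by rewrite !mxE; case: (unliftP i a). Qed.

Let sqE z : sq z = dotp (gphi i g z) (gphi i g z).
Proof. by rewrite smooth_sumE; apply: eq_bigr => a _; rewrite smooth_mulE !cposE. Qed.

Let sq_max v : \forall t \near 0^'+, sq (y + t *: v) <= sq y.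
Proof.
have H : \forall t \near (0 : R)^'+, cdom i g U (y + t *: v).
  apply: open_line; first by apply: cdom_open; exact: cU.
  by rewrite /cdom /preimage /mkset (gphi_at cU Up Sp).
apply: filterS H => t Ut; rewrite !sqE (gphi_at cU Up Sp); apply: pfar.2.
by have [] := gphi_frontier cU Ut.
Qed.

Let sdirN v (f : @smooth_fun R n) z : sdir (- v) f z = - sdir v f z.
Proof.
rewrite !smooth_sumE -sumrN; apply: eq_bigr => j _.
by rewrite !smooth_mulE /= mxE mulNr.
Qed.

Let sq_crit v : sdir v sq y = 0.
Proof.
apply/eqP; rewrite eq_le critical_le ?sq_max //= -oppr_le0 -sdirN.
by apply: critical_le; exact: sq_max.
Qed.

Let T v a := sdir v (cpos i g 0 a).

Let TE v z : \row_a T v a z = ins i ('D_v g z, v).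
Proof.
apply/rowP => a; rewrite mxE /T sdirE -(gphi_derive i g z v).2.
have -> : gphi i g = rowv (fun a => cpos i g 0 a).
  by apply/funext => z'; apply/rowP => c; rewrite [RHS]mxE cposE.
by rewrite (rowv_derive _ z v).2 [RHS]mxE.
Qed.

Let tangent_ins w : tangent S p w -> w = ins i ('D_(col' i w) g y, col' i w).
Proof.
move=> /(chart_tangent cU w Up Sp)/(dotp_nuv_eq0 _ _ _ _ _).1 wi.
by rewrite -wi ins_col'.
Qed.

Lemma farthest_tangent w : tangent S p w -> dotp p w = 0.
Proof.
move=> tw; have := sq_crit (col' i w).
rewrite sdir_sum smooth_sumE; under eq_bigr do rewrite sdirM smooth_addE !smooth_mulE [_ * _ y]mulrC.
rewrite big_split /= -mulr2n => /eqP; rewrite mulrn_eq0 /= => /eqP H.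
rewrite -[RHS]H {1}(tangent_ins tw) -TE; apply: eq_bigr => a _.
by rewrite mxE cposE (gphi_at cU Up Sp).
Qed.

Lemma farthest_normal : p = support_fun Omega p *: normal Omega p.
Proof.
rewrite /support_fun (chart_normal cU Up Sp) -/nu; set u := dotp p nu.
have nn : dotp nu nu = 1 by exact: nuv1.
have Xn : dotp (p - u *: nu) nu = 0 by rewrite dotpBl dotpZl nn mulr1 subrr.
have Xt : tangent S p (p - u *: nu) by apply/(chart_tangent cU _ Up Sp).
have H := farthest_tangent Xt.
apply/eqP; rewrite -subr_eq0; apply/eqP/dotp_eq0.
by rewrite {1}dotpBl H dotpZl dotpC Xn mulr0 subrr.
Qed.

(** p - t nu lies in Omega for small t > 0. If u were not positive, the point (u - t) nu would be
    farther from the origin than p. *)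
Lemma farthest_support : 0 < support_fun Omega p.
Proof.
set u := support_fun Omega p; have pE : p = u *: nu.
  by rewrite {1}farthest_normal (chart_normal cU Up Sp).
have nn : dotp nu nu = 1 by exact: nuv1.
have s0 := (chart_frontier cU Up).1 Sp.
have ds := side_line (- nu) s0; rewrite -/y in ds.
have d0 : 0 < (-1) ^+ b * ((- nu) 0 i - 'D_(col' i (- nu)) g y).
  have -> : (-1) ^+ b * ((- nu) 0 i - 'D_(col' i (- nu)) g y) = cnorm i g y.
    rewrite -[RHS]opprK -(side_derive_nuv i b g y) -/nu -mulrN; congr (_ * _).
    have -> : col' i (- nu) = - col' i nu by apply/rowP => j; rewrite !mxE.
    rewrite mxE -!sdirE sdirN; move: (sdir _ _ _) (nu 0 i) => q1 q2; ring.
  exact: cnorm_gt0.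
have := derive_pos_near ds; rewrite scale0r addr0 => /(_ s0 d0) Hpos.
have [t [t0 [Ut st]]] : exists t : R, 0 < t /\ (U (p + t *: - nu) /\ 0 < side i b g (p + t *: - nu)).
  apply: (@filter_ex _ (0 : R)^'+ _ _); apply: filterI; first exact: nbhs_right_gt.
  by apply: filterI => //; exact: (open_line (- nu) cU.1 Up).
have Ot : Omega (p + t *: - nu) by have [_ UO] := cU; apply/UO.
have := pfar.2 _ (subset_closure Ot).
have -> : p + t *: - nu = (u - t) *: nu by rewrite {1}pE scalerN scalerBl.
have -> : dotp p p = u * (u * dotp nu nu) by rewrite {1 2}pE dotpZl dotpZr.
by rewrite dotpZl dotpZr nn; clearbody u; nra.
Qed.

(* Second-order condition for the maximum of |X|^2 along the surface. *)
Lemma farthest_shape w : tangent S p w ->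
  dotp w w <= support_fun Omega p * dotp (shape Omega p w) w.
Proof.
move=> tw; set u := support_fun Omega p; pose v := col' i w.
have wn : dotp w nu = 0 by apply/(chart_tangent cU w Up Sp).
have wE : \row_a T v a y = w by rewrite TE -(tangent_ins tw).
have Ta a : T v a y = w 0 a by rewrite -wE mxE.
have pE : p = u *: nu by rewrite {1}farthest_normal (chart_normal cU Up Sp).
(* Differentiating this orthogonality along v turns the normal component of the second derivative of
   X into - <A w, w>. *)
have nuT : \sum_a cnu i b g 0 a * T v a = 0.
  apply/smooth_fun_eqP => z; rewrite smooth_sumE smooth_0E.
  transitivity (dotp (ins i ('D_v g z, v)) (nuv i b g z)).
    by rewrite -TE; apply: eq_bigr => a _; rewrite smooth_mulE mulrC !mxE.
  by apply/dotp_nuv_eq0; rewrite ins_i col'_ins.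
have dnu a : sdir v (cnu i b g 0 a) y = shape Omega p w 0 a.
  rewrite (chart_shape cU Up Sp tw) -(nuv_derive wn).2 sdirE.
  have -> : nuv i b g = rowv (fun a => cnu i b g 0 a).
    by apply/funext => z'; apply/rowP => c; rewrite !mxE.
  by rewrite (rowv_derive _ y v).2 [RHS]mxE.
have nuTT : \sum_a nu 0 a * sdir v (T v a) y = - dotp (shape Omega p w) w.
  have := congr1 (fun f : @smooth_fun R n => sdir v f y) nuT.
  rewrite sdir_sum smooth_sumE; under eq_bigr do rewrite sdirM smooth_addE !smooth_mulE dnu Ta.
  have -> : sdir v (0 : @smooth_fun R n) y = 0 by rewrite (der0 (sdirD v)).
  rewrite big_split /= => /eqP; rewrite addrC addr_eq0 => /eqP E.
  by rewrite -E; apply: eq_bigr => a _; rewrite !mxE.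
have := second_order_max (sq_max v) (sq_crit v).
have -> : sdir v sq = \sum_a sdir v (cpos i g 0 a * cpos i g 0 a) by exact: sdir_sum.
rewrite sdir_sum smooth_sumE.
under eq_bigr do rewrite sdirM sdirD !sdirM !smooth_addE !smooth_mulE -/(T v _) Ta cposE (gphi_at cU Up Sp).
have -> : \sum_a (sdir v (T v a) y * p 0 a + w 0 a * w 0 a + (w 0 a * w 0 a + p 0 a * sdir v (T v a) y)) =
    2 * (dotp w w + u * \sum_a nu 0 a * sdir v (T v a) y).
  rewrite mulr_sumr -big_split mulr_sumr; apply: eq_bigr => a _.
  have -> : p 0 a = u * nu 0 a by rewrite {1}pE mxE.
  by move: (sdir v _ y) (w 0 a) (nu 0 a) => q1 q2 q3 /=; ring.
rewrite nuTT; move: (dotp w w) (dotp (shape _ _ _) _) => q1 q2.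
by rewrite mulrN; lra.
Qed.

Lemma farthest_mean_curv k : (k <= n)%N -> 0 < mean_curv Omega k p.
Proof.
move=> kn; have [e [te ee eS]] := curvatures_spec cU Up Sp.
have kap l : 0 < curvatures Omega p 0 l.
  have := farthest_shape (te l); rewrite eS dotpZl ee eqxx mulr1.
  by move=> /(lt_le_trans ltr01); rewrite pmulr_rgt0 //; exact: farthest_support.
rewrite /mean_curv divr_gt0 ?ltr0n ?bin_gt0 // /esym.
have [J /eqP Jk] : exists J : {set 'I_n}, #|J| == k.
  have : (0 < #|[set J : {set 'I_n} | #|J| == k]%SET|)%N by rewrite card_draws card_ord bin_gt0.
  by move=> /card_gt0P[J]; rewrite finset.inE; exists J.
rewrite (bigD1 J) ?Jk //= ltr_wpDr //.
  by apply: sumr_ge0 => J' _; apply: prodr_ge0 => l _; exact: ltW.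
by apply: prodr_gt0 => l _.
Qed.

End FarthestPoint.

(** * Recognizing a centred sphere *)

Section Spheres.
Context {R : realType} {n : nat}.
Variable Omega : set 'rV[R]_n.+1.
Local Notation S := (frontier Omega).
Hypothesis oO : open Omega.

(** The part of E in Omega is also its part in the closure, hence open and closed in E. *)
Lemma connected_avoid_frontier (E : set 'rV[R]_n.+1) : connected E ->
  E `&` S = set0 -> E `&` Omega !=set0 -> E `<=` Omega.
Proof.
move=> cE ES E0; have <- : E `&` Omega = E; last by move=> x [].
apply: cE => //; first by exists Omega.
exists (closure Omega); first exact: closed_closure.
apply/seteqP; split=> x [Ex Ox]; first by split=> //; exact: subset_closure.
split=> //; apply: contrapT => nO.
have : (E `&` S) x by split=> //; split=> // /interior_subset.
by rewrite ES.
Qed.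

Lemma enormE (x : 'rV[R]_n.+1) (r : R) : 0 < r -> enorm x = r <-> dotp x x = r ^+ 2.
Proof.
move=> r0; rewrite /enorm; split=> [<-|->]; first by rewrite sqr_sqrtr // dotp_ge0.
by rewrite sqrtr_sqr gtr0_norm.
Qed.

(** Omega is shown to be the open ball. Maximality at p puts it inside; conversely, a segment from w
    to a point of the ball keeps its norm below r, so it cannot meet the boundary. *)
Lemma frontier_sphere (r : R) p : 0 < r -> Omega !=set0 -> farthest Omega p ->
  dotp p p = r ^+ 2 -> (forall x, S x -> dotp x x = r ^+ 2) ->
  S = [set x | enorm x = r].
Proof.
move=> r0 [w Ow] [Sp pmax] pr Sr.
have in_ball x : Omega x -> dotp x x < r ^+ 2.
  move=> Ox; rewrite lt_neqAle -pr pmax ?andbT; last exact: subset_closure.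
  by apply/eqP => xp; apply: (open_not_farthest oO Ox) => z /pmax; rewrite xp.
have ball_in z : dotp z z < r ^+ 2 -> Omega z.
  move=> zr; pose c (t : R) := w + t *: (z - w).
  have cc : continuous c.
    move=> t; apply: differentiable_continuous; apply/derivable1_diffP.
    by have [] := is_derive_affine w (z - w) t.
  have cE : connected (c @` `[0, 1]).
    apply: connected_continuous_connected; first exact: segment_connected.
    exact: continuous_subspaceT.
  apply: (connected_avoid_frontier cE).
  - apply/seteqP; split=> // x [[t]]; rewrite /= in_itv /= => /andP[t0 t1] <- /Sr.
    (* Convexity of the squared norm, with the exact remainder t (1 - t) |z - w|^2. *)
    have -> : dotp (c t) (c t) = dotp w w + t * (dotp z z - dotp w w)
         - t * (1 - t) * dotp (z - w) (z - w).
      have e1 v : dotp (c t) v = dotp w v + t * (dotp z v - dotp w v).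
        by rewrite -dotpBl -dotpZl; exact: dotpDl.
      rewrite e1 !(dotpC _ (c t)) !e1 dotpBl !dotpBr (dotpC z w).
      by move: (dotp w w) (dotp w z) (dotp z z) => a d e; ring.
    have h1 := mulr_ge0 (mulr_ge0 t0 (etrans (subr_ge0 t 1) t1)) (dotp_ge0 (z - w)).
    have := in_ball _ Ow; move: h1 zr; move: (t * _ * _) (dotp w w) (dotp z z) (r ^+ 2) => q a d e.
    move=> q0 de ae E; have d0 : 0 <= t * (e - d) by rewrite mulr_ge0 // subr_ge0 ltW.
    have [t1'|t1'] := eqVneq t 1; first by rewrite t1' in E; lra.
    have a0 : 0 < (1 - t) * (e - a) by rewrite mulr_gt0 // subr_gt0 // lt_neqAle t1'.
    by lra.
  - exists w; split=> //; exists 0; first by rewrite /= in_itv /= lexx ler01.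
    by rewrite /c scale0r addr0.
  - exists 1; first by rewrite /= in_itv /= lexx ler01.
    by rewrite /c scale1r addrC subrK.
apply/seteqP; split=> x; first by move=> /Sr/(enormE _ r0).
move=> /= /(enormE _ r0) xr; split; last first.
  by move=> /interior_subset/in_ball; rewrite xr ltxx.
move=> V; rewrite nbhsE => -[V' [oV' V'x] V'V].
have [t [/= [t0 t1] Vt]] : exists t : R, (0 < t /\ t < 1) /\ V' (x + t *: - x).
  apply: (@filter_ex _ (0 : R)^'+ _ _); apply: filterI; last exact: open_line.
  by apply: filterI; [exact: nbhs_right_gt|exact: nbhs_right_lt].
exists (x + t *: - x); split; last exact: V'V.
apply: ball_in; have -> : x + t *: - x = (1 - t) *: x by rewrite scalerN scalerBl scale1r.
have r20 : 0 < r ^+ 2 by rewrite exprn_gt0.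
rewrite dotpZl dotpZr xr; move: (r ^+ 2) r20 => e e0.
have h : 0 < t * (2 - t) by apply: mulr_gt0 => //; lra.
by have := mulr_gt0 h e0; lra.
Qed.

(** Cauchy-Schwarz against the unit normal, by expanding |x - u nu|^2 >= 0. *)
Lemma support_le x u : S x -> (exists i b (g : @smooth_fun R n) U, chart_on Omega i b g U /\ U x) ->
  u = support_fun Omega x -> u ^+ 2 <= dotp x x.
Proof.
move=> Sx [i [b [g [U [cU Ux]]]]] ->.
rewrite /support_fun (chart_normal cU Ux Sx); set nu := nuv _ _ _ _.
have nn : dotp nu nu = 1 by exact: nuv1.
have := dotp_ge0 (x - dotp x nu *: nu).
rewrite dotpBl !dotpBr !(dotpZl, dotpZr) nn (dotpC nu x) expr2.
by move: (dotp x nu) (dotp x x) => a c; lra.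
Qed.

End Spheres.

Theorem theorem1p1 (R : realType) (n k : nat) (hn : (1 <= n)%N)
    (hk : (1 <= k <= n)%N) (Omega : set 'rV[R]_n.+1)
    (hOmega : smooth_bounded_domain Omega)
    (mu : {measure set 'rV[R]_n.+1 -> \bar R})
    (hmu : area_measure (frontier Omega) mu)
    (hH : forall x, frontier Omega x -> 0 <= mean_curv Omega k x) :
  let I := curv_int Omega mu in
  let K := k%:Z in
  let lhs := (I (K - 1) ^+ 2 - I K * I (K - 2)) / I K in
  let rhs := (k * 'C(n, k))%:R^-1 * newton_int Omega mu k in
  [/\ lhs + delta2 Omega mu k (I (K - 1) / I K) ^+ 2 = rhs,
      lhs <= rhs
    & (forall x, frontier Omega x -> 0 < mean_curv Omega k x) ->
      (lhs = rhs <-> centered_sphere (frontier Omega))].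
Proof.
have [nO oO _ bO sb] := hOmega.
have charts := smooth_boundary_chart sb.
have cS := frontier_compact bO.
case: k hk hH => [//|m] mn hH.
have {}mn : (m < n)%N by case/andP: mn.
pose S := frontier Omega; pose H := mean_curv Omega; pose u := support_fun Omega.
have mS : measurable S by exact: rV_closed_measurable (@frontier_closed _ _ Omega).
have uc : surf_cont Omega u := support_cont charts.
have Hc j : surf_cont Omega (H j) := mean_curv_cont charts (k := j).
have cc := surf_cont_integrable charts cS hmu.
have pos := surf_integral_gt0 charts cS hmu.
pose I1 := \int[mu]_(x in S) H m.+1 x; pose I0 := \int[mu]_(x in S) H m x.
pose I' := \int[mu]_(x in S) (u x * H m x).
have Iu : \int[mu]_(x in S) (u x * H m.+1 x) = I0 by rewrite -(minkowski charts cS hmu mn).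
have [p pfar] := farthest_exists oO bO nO; have Sp : S p := pfar.1.
have [i [b [g [U [cU Up]]]]] := charts p Sp.
have I1_gt0 : 0 < I1 by apply: (pos _ p (Hc m.+1) hH Sp); exact: (farthest_mean_curv cU Up pfar).
have I1_neq0 : I1 != 0 by rewrite gt_eqF.
(* For this r the cross term and the last term of the expansion combine to - I_(k-1)^2 / I_k. *)
pose r := I0 / I1.
pose F x := (u x - r) ^+ 2 * H m.+1 x.
have c1 : surf_cont Omega (fun x => u x * H m.+1 x) := surf_contM uc (Hc m.+1).
have c2 : surf_cont Omega (fun x => u x ^+ 2 * H m.+1 x).
  under eq_fun do rewrite expr2.
  exact: surf_contM (surf_contM uc uc) (Hc m.+1).
have FE x : F x = u x ^+ 2 * H m.+1 x - 2 * r * (u x * H m.+1 x) + r ^+ 2 * H m.+1 x.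
  have alg (a c e : R) : (a - e) ^+ 2 * c = a ^+ 2 * c - 2 * e * (a * c) + e ^+ 2 * c by ring.
  exact: alg.
have c3 : surf_cont Omega (fun x => (- (2 * r)) * (u x * H m.+1 x)).
  by apply: surf_contM c1; apply: continuous_surf; exact: cst_continuous.
have c4 : surf_cont Omega (fun x => r ^+ 2 * H m.+1 x).
  by apply: surf_contM (Hc m.+1); apply: continuous_surf; exact: cst_continuous.
have Fc : surf_cont Omega F.
  rewrite (_ : F = fun x => u x ^+ 2 * H m.+1 x + (- (2 * r)) * (u x * H m.+1 x) + r ^+ 2 * H m.+1 x).
    exact: surf_contD (surf_contD c2 c3) c4.
  by apply/funext => x; rewrite FE mulNr.
have F0 x : S x -> 0 <= F x by move=> Sx; rewrite mulr_ge0 ?sqr_ge0 // hH.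
have Fint : \int[mu]_(x in S) F x = \int[mu]_(x in S) (u x ^+ 2 * H m.+1 x) - I0 ^+ 2 / I1.
  transitivity (\int[mu]_(x in S) (u x ^+ 2 * H m.+1 x + (- (2 * r)) * (u x * H m.+1 x) + r ^+ 2 * H m.+1 x)).
    by apply: eq_Rintegral => x _; rewrite FE mulNr.
  rewrite RintegralD //; [|exact: cc (surf_contD c2 c3)|exact: cc c4].
  rewrite RintegralD //; [|exact: cc c2|exact: cc c3].
  rewrite RintegralZl //; last exact: cc c1.
  rewrite RintegralZl //; last exact: cc (Hc m.+1).
  have alg (q a c : R) : c != 0 -> q + - (2 * (a / c)) * a + (a / c) ^+ 2 * c = q - a ^+ 2 / c.
    by move=> c0; field.
  by rewrite Iu; exact: alg.
(* Squaring undoes the root because the integral is nonnegative, by H_k >= 0. *)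
have deltaE : delta2 Omega mu m.+1 r ^+ 2 = \int[mu]_(x in S) F x.
  by rewrite /delta2 sqr_sqrtr //; exact: Rintegral_ge0.
pose K0 := ((m.+1 * 'C(n, m.+1))%:R : R).
have K0_neq0 : K0 != 0 by rewrite pnatr_eq0 muln_eq0 /= -lt0n bin_gt0.
have rhsE : K0^-1 * newton_int Omega mu m.+1 = \int[mu]_(x in S) (u x ^+ 2 * H m.+1 x) - I'.
  by rewrite [newton_int _ _ _](newton_integral charts cS hmu mn) mulrA mulVf // mul1r.
have H0 x : H 0%N x = 1.
  rewrite /H /mean_curv bin0 divr1 /Defs.esym (big_pred1 finset.set0) => [|J].
    by rewrite big1 // => l; rewrite finset.inE.
  by rewrite /= cards_eq0.
have I'E : curv_int Omega mu ((m.+1)%:Z - 2) = I'.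
  (* For k = 1 the index k - 2 is [Negz 0], where I_(-1) = (n+1)|Omega| is the integral of u;
     otherwise the Minkowski formula one order lower applies. *)
  rewrite /I'; case: (m) mn => [_|j jn].
    have -> : 1%:Z - 2 = Negz 0 by [].
    rewrite /curv_int lebE -(support_integral oO bO charts hmu); apply: eq_Rintegral => x _.
    by rewrite H0 mulr1.
  have -> : j.+2%:Z - 2 = Posz j by rewrite -[j.+2]addn2 PoszD addrK.
  rewrite /curv_int; exact: (minkowski charts cS hmu (ltnW jn)).
have I0E : curv_int Omega mu ((m.+1)%:Z - 1) = I0 by rewrite -[m.+1]addn1 PoszD addrK.
move=> I K lhs rhs.
have lhsE : lhs = I0 ^+ 2 / I1 - I'.
  rewrite /lhs /I /K I'E I0E -/I1 mulrBl; congr (_ - _).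
  by rewrite mulrC mulrA mulVf // mul1r.
have rE : I (K - 1) / I K = r by rewrite /I /K I0E.
have rhs_lhs : lhs + \int[mu]_(x in S) F x = rhs.
  rewrite lhsE -[rhs]/(K0^-1 * newton_int Omega mu m.+1) rhsE Fint.
  by rewrite addrC subrKA.
have Fge0 : 0 <= \int[mu]_(x in S) F x by exact: Rintegral_ge0.
split; first by rewrite rE deltaE.
  by rewrite -rhs_lhs lerDl.
move=> Hpos; split=> [E|[r0 r00 Sr]].
  have F_int0 : \int[mu]_(x in S) F x = 0 by apply: (addrI lhs); rewrite addr0 rhs_lhs.
  have ur x : S x -> u x = r.
    move=> Sx; apply/eqP; rewrite -subr_eq0 -sqrf_eq0; apply/negPn/negP => ne.
    have Fx : 0 < F x.
      by rewrite mulr_gt0 ?Hpos // lt_neqAle eq_sym ne sqr_ge0.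
    by have := pos F x Fc F0 Sx Fx; rewrite F_int0 ltxx.
  have pE : dotp p p = r ^+ 2.
    rewrite -(ur p Sp) {1 2}(farthest_normal cU Up pfar) dotpZl dotpZr.
    by rewrite (chart_normal cU Up Sp) nuv1 mulr1.
  have r_gt0 : 0 < r by rewrite -(ur p Sp); exact: (farthest_support cU Up pfar).
  exists r => //; apply: (frontier_sphere oO r_gt0 nO pfar pE) => x Sx.
  apply/eqP; rewrite eq_le -{1}pE pfar.2; last by case: Sx.
  by rewrite (support_le Sx (charts x Sx) (Logic.eq_sym (ur x Sx))).
have normE x : S x -> dotp x x = r0 ^+ 2 by rewrite /S Sr => /(enormE _ r00).
have ur0 x : S x -> u x = r0.
  (* On the sphere every boundary point is farthest, so X = u nu with u > 0, and u is the radius. *)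
  move=> Sx; have xfar : farthest Omega x.
    by split=> // z /pfar.2; rewrite (normE p Sp) (normE x Sx).
  have [i' [b' [g' [U' [cU' Ux]]]]] := charts x Sx.
  have u0 := farthest_support cU' Ux xfar.
  have : dotp x x = u x ^+ 2.
    rewrite {1 2}(farthest_normal cU' Ux xfar) dotpZl dotpZr.
    by rewrite (chart_normal cU' Ux Sx) nuv1 mulr1.
  rewrite (normE x Sx) => /eqP; rewrite eqf_sqr => /orP[/eqP->//|/eqP e].
  by move: u0 r00; rewrite e -/(u x) oppr_gt0 => h1 /(lt_trans h1); rewrite ltxx.
(* By the Minkowski formula I_(k-1) is the integral of u H_k, which is r0 I_k here. *)
have rr : r = r0.
  rewrite /r -Iu; have -> : \int[mu]_(x in S) (u x * H m.+1 x) = r0 * I1.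
    rewrite -RintegralZl //; last exact: cc (Hc m.+1).
    by apply: eq_Rintegral => x /set_mem Sx; rewrite ur0.
  by rewrite mulfK.
rewrite -rhs_lhs; apply/Logic.eq_sym; rewrite -[RHS]addr0; congr (_ + _).
transitivity (\int[mu]_(x in S) 0 : R); last by rewrite Rintegral_cst ?mul0r.
by apply: eq_Rintegral => x /set_mem Sx; rewrite /F ur0 // rr subrr expr0n mul0r.
Qed.
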